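(* Consider a splitting algorithm with threshold $D\ge 2$, random branching degree $G$ and random weights $V_{i,\ell}$, let $\mathcal{W}$ be its splitting measure, and let $R_n$ be its cost when started with $n$ items (all as defined in the context, under Assumption (A)). Suppose that $$\int_0^1 \frac{|\log(y)|}{y}\,\mathcal{W}(dy)<+\infty .$$ Then: (i) If the splitting measure $\mathcal{W}$ is not exponentially arithmetic, then $$\lim_{n\to+\infty}\frac{\mathbb{E}(R_n)}{n}=\frac{\mathbb{E}(G)}{(D-1)\int_0^1|\log(y)|\,\mathcal{W}(dy)} .$$ (ii) If $\mathcal{W}$ is exponentially arithmetic with exponential span $\lambda>0$, then, as $n\to+\infty$, $$\frac{\mathbb{E}(R_n)}{n}\sim F\left(\frac{\log n}{\lambda}\right),$$ where $F$ is the periodic function with period $1$ defined, for $x\ge 0$, by $$F(x)=\frac{\mathbb{E}(G)}{\int_0^1|\log(y)|\,\mathcal{W}(dy)}\;\frac{\lambda}{1-e^{-\lambda}}\int_0^{+\infty}\exp\left(-\lambda\left\{x-\frac{\log y}{\lambda}\right\}\right)\frac{y^{D-2}}{(D-1)!}\,e^{-y}\,dy,$$ and $\{z\}=z-\lfloor z\rfloor$ denotes the fractional part of $z\in\mathbb{R}$.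
   Context: Splitting algorithm. Let $D\ge2$ be an integer, let $G$ be a random variable with values in $\{2,3,\ldots\}$, and for each $\ell\ge2$ let $V_\ell=(V_{1,\ell},\ldots,V_{\ell,\ell})$ be a random probability vector on $\{1,\ldots,\ell\}$ (nonnegative entries summing to $1$). Start with a set of $n$ items at the root of a tree. A node whose set has cardinality $<D$ is a leaf (the algorithm stops there). At a node with $m\ge D$ items, independently of everything else, draw a copy of $G$ and, given $G=\ell$, a copy of $V_\ell$; the node gets $\ell$ children, and, conditionally on $G=\ell$ and $V_\ell$, the numbers $(N_1,\ldots,N_\ell)$ of items sent to the children are multinomial with parameters $m$ and $(V_{1,\ell},\ldots,V_{\ell,\ell})$. The procedure is then applied to each child. The cost $R_n$ is the total number of nodes of the resulting tree. Thus $R_n=1$ for $n<D$, and for $n\ge D$, $R_n\stackrel{\text{dist.}}{=}1+R_{1,N_1}+\cdots+R_{G,N_G}$, where, given $G=\ell$, $V_\ell$ and $(N_i)$, the variables $R_{i,N_i}$ are independent and $R_{i,m}$ is distributed as $R_m$. Assumption (A). There is a constant $\delta\in(0,1)$ such that, almost surely, $\sup_{\ell\ge2}\sup_{1\le i\le \ell}V_{i,\ell}\le\delta$. Splitting measure. $\mathcal{W}$ is the probability distribution on $[0,1]$ defined, for nonnegative Borel $f$, by $$\int f(x)\,\mathcal{W}(dx)=\mathbb{E}\Big(\sum_{i=1}^{G}V_{i,G}f(V_{i,G})\Big)=\sum_{\ell\ge2}\sum_{i=1}^{\ell}\mathbb{P}(G=\ell)\,\mathbb{E}\big(V_{i,\ell}f(V_{i,\ell})\big).$$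 $\mathcal{W}$ is exponentially arithmetic if there is $\lambda>0$ with $\mathcal{W}(\{e^{-n\lambda}:n\ge1\})=1$; the largest such $\lambda$ is its exponential span. The notation $a_n\sim b_n$ means $a_n/b_n\to1$. Expectations are taken in $[0,+\infty]$; if $\mathbb{E}(G)=+\infty$ both conclusions are read as saying both sides equal $+\infty$ (for $n\ge D$). *)

(* Defs.v *)
From HB Require Import structures.
From mathcomp Require Import all_boot all_order all_algebra.
From mathcomp Require Import finmap.
From mathcomp Require Import all_classical all_reals all_analysis.
From mathcomp Require Import measurable_realfun.

Set Implicit Arguments.
Unset Strict Implicit.
Unset Printing Implicit Defensive.

Import Order.TTheory GRing.Theory Num.Theory.
Import numFieldNormedType.Exports.

Local Open Scope classical_set_scope.
Local Open Scope ring_scope.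

Definition probability_vector (R : realType) (l : nat) (v : l.-tuple R) : Prop :=
  (forall i, 0 <= tnth v i) /\ \sum_(i < l) tnth v i = 1.

(* The random degree G and, for every l >= 2, the random weight vector
   V_l = (V_{1,l}, ..., V_{l,l}); only their individual laws are ever used.
   The values of [weights] at l < 2 are irrelevant. *)
Record splitting_data d (T : measurableType d) (R : realType)
    (P : probability T R) := SplittingData {
  degree : {RV P >-> nat} ;
  weights : forall l, {RV P >-> l.-tuple R} ;
  degree_ge2 : forall w, (2 <= degree w)%N ;
  weights_simplex : forall l w, (2 <= l)%N -> probability_vector (weights l w)
}.

Section splitting_measure.
Context d (T : measurableType d) (R : realType) (P : probability T R).
Variable X : splitting_data P.
Local Open Scope ereal_scope.

Let V l i w : R := tnth (weights X l w) i.
Let p l := P (degree X @^-1` [set l]).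

(* The set function A |-> E(\sum_(i <= G) V_{i,G} 1_A(V_{i,G})); the defining
   identity for a general nonnegative Borel function is
   [ge0_integral_splitting_measure] below. *)
Definition splitting_measure (A : set R) : \bar R :=
  \sum_(l <oo | (2 <= l)%N) \sum_(i < l)
    p l * 'E_P[fun w => (V i w * \1_A (V i w))%R].

Let J (f : R -> \bar R) : \bar R :=
  \sum_(l <oo | (2 <= l)%N) \sum_(i < l)
    p l * \int[P]_w ((V i w)%:E * f (V i w)).

Let V_ge0 l (i : 'I_l) w : (2 <= l)%N -> (0 <= V i w)%R.
Proof. by move=> l2; have [+ _] := weights_simplex X w l2; apply. Qed.

Let mV l (i : 'I_l) : measurable_fun setT (V i).
Proof.
apply: (measurableT_comp (measurable_tnth i)).
exact: measurable_funPT.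
Qed.

Let mdeg l : measurable (degree X @^-1` [set l]).
Proof.
by rewrite -[_ @^-1` _]setTI; exact: measurable_funPT.
Qed.

Let p_ge0 l : 0 <= p l. Proof. exact: measure_ge0. Qed.

Let p_fin l : p l = (fine (p l))%:E.
Proof. by rewrite fineK// fin_num_measure. Qed.

Let term_ge0 (f : R -> \bar R) l (i : 'I_l) : (forall x, 0 <= f x) ->
  (2 <= l)%N -> 0 <= p l * \int[P]_w ((V i w)%:E * f (V i w)).
Proof.
move=> f0 l2; rewrite mule_ge0//.
by apply: integral_ge0 => w _; rewrite mule_ge0// lee_fin V_ge0.
Qed.

Let inner_ge0 (f : R -> \bar R) l : (forall x, 0 <= f x) -> (2 <= l)%N ->
  0 <= \sum_(i < l) p l * \int[P]_w ((V i w)%:E * f (V i w)).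
Proof. by move=> f0 l2; apply: sume_ge0 => i _; exact: term_ge0. Qed.

Let J_ge0 f : (forall x, 0 <= f x) -> 0 <= J f.
Proof. by move=> f0; apply: nneseries_ge0 => l _ l2; exact: inner_ge0. Qed.

Let splitting_measureE A : splitting_measure A = J (fun x => (\1_A x)%:E).
Proof.
apply: eq_eseriesr => l _; apply: eq_bigr => i _; rewrite unlock.
by congr (_ * _); apply: eq_integral => w _; rewrite EFinM.
Qed.

Let mVf (f : R -> \bar R) l (i : 'I_l) : measurable_fun setT f ->
  measurable_fun setT (fun w => (V i w)%:E * f (V i w)).
Proof.
move=> mf; apply: emeasurable_funM.
  by apply/measurable_EFinP; exact: mV.
exact: (measurableT_comp mf (mV i)).
Qed.

Let J_series (f : nat -> R -> \bar R) : (forall n, measurable_fun setT (f n)) ->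
  (forall n x, 0 <= f n x) ->
  J (fun x => \sum_(n <oo) f n x) = \sum_(n <oo) J (f n).
Proof.
move=> mf f0.
transitivity (\sum_(l <oo | (2 <= l)%N) \sum_(n <oo)
    (if (2 <= l)%N then \sum_(i < l)
      p l * \int[P]_w ((V i w)%:E * f n (V i w)) else 0)).
  apply: eq_eseriesr => l l2; rewrite l2 nneseries_sum; last first.
    by move=> i n _; exact: term_ge0.
  apply: eq_bigr => i _; rewrite p_fin nneseriesZl; last first.
    move=> n _; apply: integral_ge0 => w _.
    by rewrite mule_ge0// lee_fin V_ge0.
  congr (_ * _); rewrite -integral_nneseries//.
  - by apply: eq_integral => w _; rewrite nneseriesZl.
  - by move=> n; exact: mVf.
  - by move=> n w _; rewrite mule_ge0// lee_fin V_ge0.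
rewrite nneseries_interchange; last first.
  by move=> l n; case: ifPn => // l2; exact: inner_ge0.
by apply: eq_eseriesr => n _; apply: eq_eseriesr => l ->.
Qed.

Let J_add (f g : R -> \bar R) :
  measurable_fun setT f -> measurable_fun setT g ->
  (forall x, 0 <= f x) -> (forall x, 0 <= g x) ->
  J (fun x => f x + g x) = J f + J g.
Proof.
move=> mf mg f0 g0; rewrite /J -nneseriesD; last 2 first.
  by move=> l _ l2; exact: inner_ge0.
  by move=> l _ l2; exact: inner_ge0.
apply: eq_eseriesr => l l2; rewrite -big_split/=; apply: eq_bigr => i _.
rewrite -ge0_muleDr//; last 2 first.
  by apply: integral_ge0 => w _; rewrite mule_ge0// lee_fin V_ge0.
  by apply: integral_ge0 => w _; rewrite mule_ge0// lee_fin V_ge0.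
congr (_ * _); rewrite -ge0_integralD//; last 4 first.
- by move=> w _; rewrite mule_ge0// lee_fin V_ge0.
- exact: mVf.
- by move=> w _; rewrite mule_ge0// lee_fin V_ge0.
- exact: mVf.
by apply: eq_integral => w _; rewrite ge0_muleDr.
Qed.

Let J0 : J (cst 0) = 0.
Proof.
apply: eseries0 => l _ _; apply: big1 => i _.
by rewrite integral0_eq ?mule0// => w _; rewrite mule0.
Qed.

Let J_scale (c : R) (f : R -> \bar R) : (0 <= c)%R ->
  measurable_fun setT f -> (forall x, 0 <= f x) ->
  J (fun x => c%:E * f x) = c%:E * J f.
Proof.
move=> c0 mf f0; rewrite -nneseriesZl; last by move=> l l2; exact: inner_ge0.
apply: eq_eseriesr => l l2; rewrite ge0_sume_distrr; last first.
  by move=> i _; exact: term_ge0.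
apply: eq_bigr => i _; rewrite muleCA; congr (_ * _).
rewrite -ge0_integralZl//; last 2 first.
- exact: mVf.
- by move=> w _; rewrite mule_ge0// lee_fin V_ge0.
by apply: eq_integral => w _; rewrite muleCA.
Qed.

Let J_sum (I : Type) (s : seq I) (f : I -> R -> \bar R) :
  (forall i, measurable_fun setT (f i)) -> (forall i x, 0 <= f i x) ->
  J (fun x => \sum_(i <- s) f i x) = \sum_(i <- s) J (f i).
Proof.
move=> mf f0; elim: s => [|i s ih].
  rewrite big_nil -[RHS]J0; congr J; apply/funext => x; exact: big_nil.
rewrite big_cons -ih -J_add//; last 2 first.
- exact: emeasurable_sum.
- by move=> x; apply: sume_ge0.
by congr J; apply/funext => x; rewrite big_cons.
Qed.

Let W0 : splitting_measure set0 = 0.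
Proof.
rewrite splitting_measureE -[RHS]J0; congr J; apply/funext => x.
by rewrite indic0.
Qed.

Let W_ge0 A : 0 <= splitting_measure A.
Proof. by rewrite splitting_measureE J_ge0// => x; rewrite lee_fin. Qed.

Let W_sigma_additive : semi_sigma_additive splitting_measure.
Proof.
move=> F mF tF _; apply: cvg_toP.
  by apply: ereal_nondecreasing_is_cvgn => m n mn; apply: lee_sum_nneg_natr.
rewrite splitting_measureE.
transitivity (\sum_(n <oo) J (fun x => (\1_(F n) x)%:E)).
  by apply: eq_eseriesr => n _; rewrite splitting_measureE.
rewrite -J_series; last 2 first.
- by move=> n; apply/measurable_EFinP; exact: measurable_indic.
- by move=> n x; rewrite lee_fin.
congr J; apply/funext => x; rewrite indicE.
have [[n _ Fnx]|nFx] := pselect ((\bigcup_n F n) x).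
  rewrite mem_set; last by exists n.
  rewrite (@nneseriesD1 _ _ n xpredT)//.
  rewrite (eseries0 (P := fun k => k != n)) => [|k _ kn].
    by rewrite adde0 indicE mem_set.
  rewrite indicE memNset// => Fkx; move/eqP: kn; apply.
  by apply: (tF k n) => //; exists x.
rewrite memNset// eseries0// => n _ _; rewrite indicE memNset// => Fnx.
by apply: nFx; exists n.
Qed.

HB.instance Definition _ := isMeasure.Build _ _ _ splitting_measure
  W0 W_ge0 W_sigma_additive.

Let W_setT : splitting_measure setT = 1.
Proof.
rewrite splitting_measureE.
transitivity (\sum_(l <oo | (2 <= l)%N) p l).
  apply: eq_eseriesr => l l2.
  rewrite -ge0_sume_distrr; last first.
    by move=> i _; apply: integral_ge0 => w _; rewrite mule_ge0// ?lee_fin ?V_ge0.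
  rewrite -ge0_integral_sum//; last 2 first.
  - by move=> i; apply: (@mVf (fun x => (\1_setT x)%:E)); apply/measurable_EFinP.
  - by move=> i w _; rewrite mule_ge0// ?lee_fin ?V_ge0.
  rewrite (_ : \int[P]_w _ = 1) ?mule1//.
  rewrite -[RHS](@probability_setT _ _ _ P) -[RHS]mul1e -integral_cst//.
  apply: eq_integral => w _; have [_ <-] := weights_simplex X w l2.
  by rewrite -sumEFin; apply: eq_bigr => i _; rewrite indicT mule1.
transitivity (P (\bigcup_l (degree X @^-1` [set l]))).
  rewrite measure_bigcup//; last first.
    move=> i j _ _ [w [wi wj]].
    by rewrite -(_ : degree X w = i)// -(_ : degree X w = j).
  rewrite [LHS]eseries_mkcond [RHS]eseries_mkcond.
  apply: eq_eseriesr => l _; rewrite in_setT.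
  case: ifPn => // l2; rewrite (_ : _ @^-1` _ = set0) ?measure0//.
  by rewrite -subset0 => w /= wl; have := degree_ge2 X w; rewrite wl (negbTE l2).
rewrite -(@probability_setT _ _ _ P); congr (P _).
by rewrite -subTset => w _; exists (degree X w).
Qed.

HB.instance Definition _ := Measure_isProbability.Build _ _ _ splitting_measure
  W_setT.

Let integral_indicW (A : set R) : measurable A ->
  \int[splitting_measure]_x (\1_A x)%:E = J (fun x => (\1_A x)%:E).
Proof. by move=> mA; rewrite integral_indic// setIT -splitting_measureE. Qed.

Import HBNNSimple.

Let integral_nnsfunW (f : {nnsfun R >-> R}) :
  \int[splitting_measure]_x (f x)%:E = J (fun x => (f x)%:E).
Proof.
have fE x : (f x)%:E = \sum_(y <- fset_set (range f))
    `|y|%:E * (\1_(f @^-1` [set y]) x)%:E.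
  rewrite fimfunE -fsumEFin// fsbig_finite//=; apply: eq_big_seq => y.
  rewrite in_fset_set// inE => -[z _ <-]; rewrite EFinM.
  by rewrite ger0_norm.
have mI y : measurable_fun setT
    (fun x : R => (\1_(f @^-1` [set y]) x)%:E : \bar R).
  by apply/measurable_EFinP; exact: measurable_indic.
have mT y : measurable_fun setT
    (fun x : R => `|y|%:E * (\1_(f @^-1` [set y]) x)%:E : \bar R).
  exact: measurable_funeM.
have T0 y x : 0 <= `|y|%:E * (\1_(f @^-1` [set y]) x)%:E :> \bar R.
  by rewrite mule_ge0// lee_fin.
rewrite (_ : J _ = J (fun x => \sum_(y <- fset_set (range f))
    `|y|%:E * (\1_(f @^-1` [set y]) x)%:E)); last first.
  by congr J; apply/funext.
rewrite J_sum// (eq_integral (fun x => \sum_(y <- fset_set (range f))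
    `|y|%:E * (\1_(f @^-1` [set y]) x)%:E)); last by move=> x _; exact: fE.
rewrite ge0_integral_sum//; apply: eq_bigr => y _.
rewrite ge0_integralZl//.
by rewrite integral_indicW// J_scale// => x; rewrite lee_fin.
Qed.

Lemma ge0_integral_splitting_measure (f : R -> \bar R) :
  measurable_fun setT f -> (forall x, 0 <= f x) ->
  \int[splitting_measure]_x f x =
  \sum_(l <oo | (2 <= l)%N) \sum_(i < l)
    P (degree X @^-1` [set l]) *
    \int[P]_w ((tnth (weights X l w) i)%:E * f (tnth (weights X l w) i)).
Proof.
move=> mf f0; rewrite -/(J f).
pose h := nnsfun_approx measurableT mf.
have nd x m n : (m <= n)%N -> (h m x <= h n x)%R.
  by move=> mn; exact/lefP/nd_nnsfun_approx.
have mh n : measurable_fun setT (fun x => (h n x)%:E) by exact/measurable_EFinP.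
pose g n x := (if n is k.+1 then h n x - h k x else h 0%N x)%R%:E : \bar R.
have g0 n x : 0 <= g n x by case: n => [|n]; rewrite lee_fin// subr_ge0 nd.
have mg n : measurable_fun setT (g n).
  apply/measurable_EFinP; case: n => [|n]; first exact: measurable_funPT.
  by apply: measurable_funB; exact: measurable_funPT.
have gE n x : \sum_(0 <= k < n.+1) g k x = (h n x)%:E.
  elim: n => [|n ih]; first by rewrite big_nat1.
  by rewrite big_nat_recr//= ih -EFinD addrC subrK.
have fE x : f x = \sum_(n <oo) g n x.
  apply/esym/cvg_lim => //; rewrite -(cvg_shiftS _).
  under eq_fun do rewrite gE.
  exact: (cvg_nnsfun_approx measurableT mf (fun x _ => f0 x) (I : setT x)).
transitivity (limn (fun n => J (fun x => (h n x)%:E))).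
  transitivity (limn (fun n => \int[splitting_measure]_x (h n x)%:E)); last first.
    by congr (limn _); apply/funext => n; exact: integral_nnsfunW.
  rewrite -monotone_convergence//; last 2 first.
  - by move=> n x _; rewrite lee_fin.
  - by move=> x _ m n mn; rewrite lee_fin nd.
  apply: eq_integral => x _; apply/esym/cvg_lim => //.
  exact: (cvg_nnsfun_approx measurableT mf (fun x _ => f0 x) (I : setT x)).
rewrite [RHS](_ : _ = J (fun x => \sum_(n <oo) g n x)); last first.
  by congr J; apply/funext.
rewrite J_series//; apply/cvg_lim => //.
rewrite (_ : (fun n => J _) =
    (fun n => \sum_(0 <= k < n.+1) J (g k))); last first.
  apply/funext => n; rewrite -J_sum//; congr J; apply/funext => x.
  by rewrite gE.
rewrite (cvg_shiftS (fun n => \sum_(0 <= k < n) J (g k))).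
by apply: is_cvg_nneseries => n _ _; exact: J_ge0.
Qed.
End splitting_measure.

Definition bounded_weights d (T : measurableType d) (R : realType)
    (P : probability T R) (X : splitting_data P) (delta : R) : Prop :=
  0 < delta < 1 /\
  {ae P, forall w, forall l, (2 <= l)%N ->
    forall i : 'I_l, tnth (weights X l w) i <= delta}.

Definition mutually_independent d (T : measurableType d) (R : realType)
    (P : probability T R) (I : eqType) (E : I -> set (set T)) : Prop :=
  forall (s : seq I) (A : I -> set T), uniq s ->
    (forall i, i \in s -> E i (A i)) ->
    P (\big[setI/setT]_(i <- s) A i) = (\prod_(i <- s) P (A i))%E.

Definition multinomial_pmf (R : realType) (l m : nat) (v : l.-tuple R)
    (k : l.-tuple nat) : R :=
  if (\sum_(i < l) tnth k i == m)%N then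
    m`!%:R / (\prod_(i < l) (tnth k i)`!)%:R * \prod_(i < l) tnth v i ^+ tnth k i
  else 0.

(* A node is given by its address: [::] is the root and [rcons u i] is the i-th
   child of u (children are numbered from 0). *)
Definition node := seq nat.

(* The randomness used by the algorithm, on a probability space (T', Q). Node u
   carries a degree, weight vectors and, for every possible number m of items,
   the vector of the numbers of items sent to the children if u receives m
   items and has degree l. For fixed u and m, these are a copy of G, then, given
   G = l, a copy of V_l, then, given both, a multinomial vector of parameters m
   and V_l. The blocks attached to distinct nodes are independent; nothing is
   assumed on the joint law, at a given node, for distinct m, as a node uses
   a single m, which is a function of the blocks of its strict ancestors. *)
Record splitting_algorithm d (T : measurableType d) (R : realType)
    (P : probability T R) (X : splitting_data P) (D : nat)
    d' (T' : measurableType d') (Q : probability T' R) := SplittingAlgorithm {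
  node_degree : node -> {RV Q >-> nat} ;
  node_weights : node -> forall l, {RV Q >-> l.-tuple R} ;
  node_counts : node -> nat -> forall l, {RV Q >-> l.-tuple nat} ;
  node_law : forall (u : node) (m l : nat) (B : set (l.-tuple R))
      (k : l.-tuple nat),
    (D <= m)%N -> (2 <= l)%N -> measurable B ->
    Q [set w | [/\ node_degree u w = l, B (node_weights u l w) &
                   node_counts u m l w = k]] =
    (P (degree X @^-1` [set l]) *
     \int[P]_(w in weights X l @^-1` B)
        (multinomial_pmf m (weights X l w) k)%:E)%E ;
  node_independence : mutually_independent Q (fun u : node =>
    <<s preimage_set_system setT (node_degree u) measurable `|`
        \bigcup_l preimage_set_system setT (node_weights u l) measurable `|`
        \bigcup_m \bigcup_l
          preimage_set_system setT (node_counts u m l) measurable >>)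
}.

Section cost.
Context d (T : measurableType d) (R : realType) (P : probability T R).
Context (X : splitting_data P) (D : nat).
Context d' (T' : measurableType d') (Q : probability T' R).
Variable S : splitting_algorithm X D Q.

(* Number of items at the node reached from u by following the path p, if u has
   m items; [None] if the tree has no such node. *)
Fixpoint items_along (w : T') (u : node) (m : nat) (p : seq nat) : option nat :=
  if p is i :: p' then
    let l := node_degree S u w in
    if (D <= m)%N && (i < l)%N then
      items_along w (rcons u i) (nth 0%N (node_counts S u m l w) i) p'
    else None
  else Some m.

Definition splitting_tree (n : nat) (w : T') : set node :=
  [set u | items_along w [::] n u != None].

(* +oo if the algorithm does not terminate *)
Definition cost (n : nat) (w : T') : \bar R := counting (splitting_tree n w).

Definition expected_cost (n : nat) : \bar R := (\int[Q]_w cost n w)%E.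

End cost.

Definition exponentially_arithmetic_with (R : realType) (W : probability R R)
    (lambda : R) : Prop :=
  0 < lambda /\
  W [set expR (- (n%:R * lambda)) | n in [set n : nat | (1 <= n)%N]] = 1%E.

Definition exponentially_arithmetic (R : realType) (W : probability R R) : Prop :=
  exists lambda, exponentially_arithmetic_with W lambda.

Definition exponential_span (R : realType) (W : probability R R) (lambda : R)
    : Prop :=
  exponentially_arithmetic_with W lambda /\
  forall lambda', exponentially_arithmetic_with W lambda' -> lambda' <= lambda.

Definition fractional_part (R : realType) (z : R) : R := z - (Num.floor z)%:~R.

Section asymptotic_constants.
Context d (T : measurableType d) (R : realType) (P : probability T R).
Variable X : splitting_data P.
Local Open Scope ereal_scope.

Definition mean_degree : \bar R := 'E_P[fun w => ((degree X w)%:R : R)%R].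

(* [ln 0 = 0] in the library; this is harmless, as the splitting measure does
   not charge 0. *)
Definition mean_abs_log : \bar R :=
  \int[splitting_measure X]_(y in `[0%R, 1%R]) `|ln y|%:E.

Definition limit_constant (D : nat) : \bar R :=
  mean_degree / ((D.-1)%:R%:E * mean_abs_log).

Definition periodic_profile (D : nat) (lambda x : R) : \bar R :=
  mean_degree / mean_abs_log * (lambda / (1 - expR (- lambda)))%:E *
  \int[lebesgue_measure]_(y in `]0%R, +oo[)
    (expR (- (lambda * fractional_part (x - ln y / lambda))) *
     (y ^+ (D - 2) / ((D.-1)`!)%:R) * expR (- y))%:E.

End asymptotic_constants.

(* Main.v *)
(* The expected number of nodes at depth k + 1 is E(G) times the expected number
   I_k(n) of internal nodes at depth k. Splitting n items according to the
   splitting measure W acts on the functions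
     b_n(v) = D C(n, D) v^(D-2) (1 - v)^(n-D)   (0 < v <= 1)
   by rescaling: thinning b_j with a binomial(n, y) number of items j gives
   y^2 b_n(y v). As I_0(n) = 1_{n >= D} is the integral of b_n(v) v, induction
   on k expresses I_k(n) as the integral of b_n(v) U_k(- ln v), where
   U_k(t) = E(e^{-(t - S_k)}; S_k <= t) for the random walk S_k whose steps are
   distributed as - ln y under W. Summing over k,
     E(R_n) = 1 + E(G) int b_n(v) U(- ln v) dv,
   where U solves the renewal equation with kernel e^{-t}.
   The substitution v = u / n turns b_n(v) dv / n into a density converging to
   u^(D-2) e^{-u} / (D-1)!, with U evaluated at ln n - ln u, and the renewal
   theorem gives the limit of U(t), or its periodic equivalent.

   The renewal theorem itself: near the points where U almost attains its upper
   limit, the renewal equation forces U to be almost maximal as well after a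
   shift by minus any element of the semigroup generated by the support of the
   steps, and this semigroup is eventually dense in the half line (or contains
   all large multiples of the span). Hence U is almost constant on long
   intervals, and the identity saying that the average of U against the tail
   of the step distribution is that of the kernel identifies the upper limit;
   the lower limit is treated in the same way. *)

Require Import Defs.
From HB Require Import structures.
From mathcomp Require Import all_boot all_order all_algebra.
From mathcomp Require Import finmap.
From mathcomp Require Import all_classical all_reals all_analysis.
From mathcomp Require Import measurable_realfun ring lra zify.

Set Implicit Arguments.
Unset Strict Implicit.
Unset Printing Implicit Defensive.

Import Order.TTheory GRing.Theory Num.Theory.
Import numFieldNormedType.Exports.

Local Open Scope classical_set_scope.
Local Open Scope ring_scope.

(** * The renewal theorem *)

(** The renewal theorem is proved over an abstract reference measure, with weights [k o] at the
    points [r o] and times running through a set [L] stable under the steps. Lebesgue measure on the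
    half line, with [L] the whole line, and counting measure on the multiples of the span are its
    two instances, so one argument serves both. The obstacle is that [U] need not be continuous, as
    the kernel jumps at 0. What survives is that [expR t * U t] is nondecreasing: [U] can only fall
    slowly, but it may jump up. This one-sided control suffices, at the price of two density
    hypotheses, one for each side from which a point must be approached. Assumption (A) makes the
    steps at least [- ln delta], which bounds [U]. In the periodic case there is no limit to compare
    with, so the cost is compared additively with an explicit profile: the difference tends to 0 by
    dominated convergence, and a positive lower bound on the profile turns this into a statement on
    the ratio. An infinite E(G) is settled by the first level of the tree alone. *)

Lemma integral_cst_probability d (T : measurableType d) (R : realType)
    (P : probability T R) (x : \bar R) : (\int[P]_w x = x)%E.
Proof.
transitivity (x * P setT)%E; first exact: integral_cst.
by rewrite probability_setT mule1.
Qed.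

(** * Renewal function of a walk with steps bounded away from 0 *)

Section renewal_function.
Context (R : realType) dY (Y : measurableType dY) (W : probability Y R).
Variables (X : Y -> R) (c : R).
Hypotheses (mX : measurable_fun setT X) (c_gt0 : 0 < c) (X_ge : forall y, c <= X y).
Local Open Scope ereal_scope.

Definition renewal_kernel (t : R) : R := if (0 <= t)%R then expR (- t) else 0%R.

Fixpoint renewal_term (k : nat) (t : R) : \bar R :=
  if k is k'.+1 then \int[W]_y renewal_term k' (t - X y)%R
  else (renewal_kernel t)%:E.

Definition renewal_fun (t : R) : \bar R := \sum_(k <oo) renewal_term k t.

Lemma measurable_renewal_kernel : measurable_fun setT renewal_kernel.
Proof.
apply: measurable_fun_ifT => //; first exact: measurable_fun_ler.
exact: measurableT_comp.
Qed.

Lemma renewal_kernel_ge0 t : (0 <= renewal_kernel t)%R.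
Proof. by rewrite /renewal_kernel; case: ifPn => // _; exact: expR_ge0. Qed.

Lemma renewal_term_ge0 k t : 0 <= renewal_term k t.
Proof.
elim: k t => [|k ih] t /=; first by rewrite lee_fin renewal_kernel_ge0.
exact: integral_ge0.
Qed.

Lemma measurable_shift_step (f : R -> \bar R) : measurable_fun setT f ->
  measurable_fun setT (fun p : R * Y => f (p.1 - X p.2)%R).
Proof.
move=> mf; apply: (measurableT_comp mf); apply: measurable_funB => //.
exact: measurableT_comp.
Qed.

Lemma measurable_renewal_term k : measurable_fun setT (renewal_term k).
Proof.
elim: k => [|k ih] /=.
  by apply/measurable_EFinP; exact: measurable_renewal_kernel.
apply: (@measurable_fun_fubini_tonelli_F _ _ _ _ _ W
  (fun p : R * Y => renewal_term k (p.1 - X p.2)%R)).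
  exact: measurable_shift_step.
by move=> p; exact: renewal_term_ge0.
Qed.

Lemma measurable_step (f : R -> \bar R) t : measurable_fun setT f ->
  measurable_fun setT (fun y => f (t - X y)%R).
Proof. by move=> mf; apply: (measurableT_comp mf); exact: measurable_funB. Qed.

Lemma renewal_fun_ge0 t : 0 <= renewal_fun t.
Proof. by apply: nneseries_ge0 => k _ _; exact: renewal_term_ge0. Qed.

Lemma measurable_renewal_fun : measurable_fun setT renewal_fun.
Proof.
apply: ge0_emeasurable_sum => [k t _ _|k _].
  exact: renewal_term_ge0.
exact: measurable_renewal_term.
Qed.

Lemma renewal_equation t :
  renewal_fun t = (renewal_kernel t)%:E + \int[W]_y renewal_fun (t - X y)%R.
Proof.
rewrite {1}/renewal_fun nneseries_recl//; last by move=> k _; exact: renewal_term_ge0.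
congr (_ + _); rewrite integral_nneseries//; last 2 first.
- by move=> k; apply: measurable_step; exact: measurable_renewal_term.
- by move=> k y _; exact: renewal_term_ge0.
rewrite -(@nneseries_addn _ (fun k => renewal_term k t) 1)//; last first.
  by move=> k; exact: renewal_term_ge0.
by apply: eq_eseriesr => k _; rewrite addn1.
Qed.

Lemma renewal_term_lt0 k t : (t < 0)%R -> renewal_term k t = 0.
Proof.
elim: k t => [|k ih] t t0 /=; first by rewrite /renewal_kernel leNgt t0.
apply: integral0_eq => y _; apply: ih.
by rewrite subr_lt0 (lt_le_trans t0)// ltW// (lt_le_trans c_gt0).
Qed.

Lemma renewal_fun_lt0 t : (t < 0)%R -> renewal_fun t = 0.
Proof. by move=> t0; apply: eseries0 => k _ _; exact: renewal_term_lt0. Qed.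

(** Sum of the geometric series of ratio [expR (- c)]: the walk visits points at least [c] apart,
    and each one below [t] is weighted by the exponential of minus its distance to [t]. *)
Definition renewal_bound : R := ((1 - expR (- c))^-1)%R.

Lemma expRNc_lt1 : (expR (- c) < 1)%R.
Proof. by rewrite expR_lt1 oppr_lt0. Qed.

Lemma renewal_bound_gt0 : (0 < renewal_bound)%R.
Proof. by rewrite invr_gt0 subr_gt0 expRNc_lt1. Qed.

Lemma renewal_bound_ge1 : (1 <= renewal_bound)%R.
Proof.
rewrite /renewal_bound invf_ge1 ?subr_gt0 ?expRNc_lt1//.
Qed.

(* [barrier] is a supersolution of the renewal equation: for [t >= c],
   [barrier t - barrier (t - c)] is exactly [expR (- t)]. *)
Let barrier (t : R) : R :=
  if (0 <= t)%R then (renewal_bound - (renewal_bound - 1) * expR (- t))%R else 0%R.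

Let barrier_le t : (barrier t <= renewal_bound)%R.
Proof.
rewrite /barrier; case: ifPn => _; last exact: ltW renewal_bound_gt0.
by rewrite gerBl mulr_ge0 ?expR_ge0// subr_ge0 renewal_bound_ge1.
Qed.

Let barrier_ge0 t : (0 <= barrier t)%R.
Proof.
rewrite /barrier; case: ifPn => // t0; rewrite subr_ge0.
apply: (@le_trans _ _ (renewal_bound - 1)%R); last by rewrite gerBl.
by rewrite ler_piMr ?expR_le1 ?oppr_le0// subr_ge0 renewal_bound_ge1.
Qed.

Let barrier_super t s : (c <= s)%R ->
  (renewal_kernel t + barrier (t - s) <= barrier t)%R.
Proof.
move=> cs; rewrite /barrier /renewal_kernel.
have b1 : (1 <= renewal_bound)%R.
  exact: renewal_bound_ge1.
case: (ltP t 0%R) => t0.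
  by rewrite [in X in (_ + X)%R]ifF ?addr0// subr_ge0 leNgt (lt_trans t0)// (lt_le_trans c_gt0).
have et : (expR (- t) <= 1)%R by rewrite expR_le1 oppr_le0.
case: ifPn => [ts|_].
  have : (expR (- t + c) <= expR (- (t - s)))%R by rewrite ler_expR; lra.
  rewrite expRD => ets.
  have bE : (renewal_bound * (1 - expR (- c)) = 1)%R.
    by rewrite mulVf// subr_eq0 gt_eqF// expRNc_lt1.
  have cE : (expR c * expR (- c) = 1)%R by rewrite -expRD subrr expR0.
  have : ((renewal_bound - 1) * (expR (- t) * expR c) <= (renewal_bound - 1) * expR (- (t - s)))%R.
    by rewrite ler_wpM2l// subr_ge0.
  have -> : ((renewal_bound - 1) * (expR (- t) * expR c) =
            expR (- t) * (renewal_bound * (expR c * expR (- c)) +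
             (renewal_bound * (1 - expR (- c)) - 1) * expR c))%R by ring.
  rewrite cE bE; lra.
by rewrite addr0; have := ler_wpM2l (le_trans ler01 b1) et; rewrite mulr1 mulrBl mul1r; lra.
Qed.

Let measurable_barrier : measurable_fun setT barrier.
Proof.
apply: measurable_fun_ifT => //; first exact: measurable_fun_ler.
by apply: measurable_funB => //; apply: measurable_funM => //; exact: measurableT_comp.
Qed.

(** Induction on the partial sums: adding a term at the front is one application of the renewal
    equation, under which [barrier] does not increase. A constant could not absorb the kernel. *)
Lemma renewal_fun_le t : renewal_fun t <= renewal_bound%:E.
Proof.
apply: (@le_trans _ _ (barrier t)%:E); last by rewrite lee_fin.
apply: lime_le; first by apply: is_cvg_nneseries => k _ _; exact: renewal_term_ge0.
apply: nearW => n; elim: n t => [|n ih] t.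
  by rewrite big_nil lee_fin barrier_ge0.
rewrite big_nat_recl//=.
apply: (@le_trans _ _ (\int[W]_y (renewal_kernel t + barrier (t - X y))%:E)).
  under [leRHS]eq_integral do rewrite EFinD.
  rewrite ge0_integralD//; last 3 first.
  - by move=> y _; rewrite lee_fin renewal_kernel_ge0.
  - by move=> y _; rewrite lee_fin.
  - apply/measurable_EFinP; apply: (measurableT_comp measurable_barrier).
    exact: measurable_funB.
  rewrite integral_cst_probability leeD2l//.
  rewrite -ge0_integral_sum//; last 2 first.
  - by move=> k; apply: measurable_step; exact: measurable_renewal_term.
  - by move=> k y _; exact: renewal_term_ge0.
  apply: ge0_le_integral => //.
  - by move=> y _; apply: sume_ge0 => k _; exact: renewal_term_ge0.
  - by apply: emeasurable_sum => k; apply: measurable_step; exact: measurable_renewal_term.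
  - apply/measurable_EFinP; apply: (measurableT_comp measurable_barrier).
    exact: measurable_funB.
apply: (@le_trans _ _ (\int[W]_y (barrier t)%:E)); last first.
  by rewrite integral_cst_probability.
apply: ge0_le_integral => //.
- by move=> y _; rewrite lee_fin addr_ge0 ?renewal_kernel_ge0.
- apply/measurable_EFinP; apply: measurable_funD => //.
  by apply: (measurableT_comp measurable_barrier); exact: measurable_funB.
- by move=> y _; rewrite lee_fin; exact: barrier_super.
Qed.

(** Multiplied by [expR t], the [k]-th term is the expectation of the exponential of S_k on the
    event S_k <= t, which grows with [t]. This one-sided regularity is used later in place of
    continuity. *)
Lemma renewal_fun_mono s t : (s <= t)%R ->
  (expR s)%:E * renewal_fun s <= (expR t)%:E * renewal_fun t.
Proof.
move=> st; rewrite -!nneseriesZl; try by move=> k _; exact: renewal_term_ge0.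
apply: lee_nneseries => [k _ _|k _].
  by rewrite mule_ge0// ?renewal_term_ge0// lee_fin expR_ge0.
elim: k s t st => [|k ih] s t st /=.
  rewrite -!EFinM lee_fin /renewal_kernel; case: ifPn => s0.
    by rewrite (le_trans s0 st) -!expRD !subrr.
  by rewrite mulr0 mulr_ge0 ?expR_ge0//; case: ifPn; rewrite ?expR_ge0.
have Z u : (expR u)%:E * \int[W]_y renewal_term k (u - X y)%R =
    \int[W]_y ((expR u)%:E * renewal_term k (u - X y)%R).
  rewrite ge0_integralZl//.
  - by apply: measurable_step; exact: measurable_renewal_term.
  - by move=> y _; exact: renewal_term_ge0.
rewrite !Z.
have E u y : (expR u)%:E = (expR (X y))%:E * (expR (u - X y))%:E.
  by rewrite -EFinM -expRD; congr (_%:E); congr expR; lra.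
apply: ge0_le_integral => //.
- by move=> y _; rewrite mule_ge0// ?renewal_term_ge0// lee_fin expR_ge0.
- by apply: measurable_funeM; apply: measurable_step; exact: measurable_renewal_term.
- by apply: measurable_funeM; apply: measurable_step; exact: measurable_renewal_term.
- move=> y _; rewrite (E s y) (E t y) -!muleA lee_pmul2l//.
    by apply: ih; rewrite lerB.
  by rewrite lte_fin expR_gt0.
Qed.

End renewal_function.

Lemma limn_einf_ge (R : realType) (u : nat -> \bar R) a :
  (\forall n \near \oo, a <= u n)%E -> (a <= limn_einf u)%E.
Proof.
move=> [N _ au]; rewrite limn_einf_lim; apply: lime_ge; first exact: is_cvg_einfs.
exists N => // n /= Nn; apply: le_ereal_inf_tmp => _ [k /= nk <-].
by apply: au => /=; exact: leq_trans nk.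
Qed.

Lemma limn_einf_le (R : realType) (u : nat -> \bar R) a :
  (\forall n \near \oo, u n <= a)%E -> (limn_einf u <= a)%E.
Proof.
move=> ua; rewrite limn_einf_lim; apply: lime_le; first exact: is_cvg_einfs.
apply: filterS ua => n una; apply: le_trans una; apply: ereal_inf_lbound.
by exists n => /=.
Qed.

(** The upper limit is taken along [L], which will be the whole line or the lattice of multiples of
    the span. *)
Lemma limsup_exists (R : realType) (L : set R) (y : R -> R) (C : R) :
  (forall T, exists t, L t /\ T <= t) -> (forall t, 0 <= y t <= C) ->
  exists M : R,
    (forall e : R, 0 < e -> exists T, forall t, L t -> T <= t -> y t <= M + e) /\
    (forall e T : R, 0 < e -> exists t, [/\ L t, T <= t & M - e < y t]).
Proof.
move=> Lub yC; pose S := [set b | exists T, forall t, L t -> T <= t -> y t <= b].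
have SC : S C by exists 0 => t _ _; case/andP: (yC t).
have lbS : has_lbound S.
  exists 0 => b [T bT]; have [t [Lt Tt]] := Lub T.
  by apply: le_trans (bT t Lt Tt); case/andP: (yC t).
exists (inf S); split=> [e e0|e T e0].
  have [|b [T bT] be] := @inf_adherent _ S e e0; first by split=> //; exists C.
  by exists T => t Lt Tt; rewrite (le_trans (bT _ Lt Tt))// ltW.
apply: contrapT => nex; have : inf S <= inf S - e.
  apply: ge_inf => //; exists T => t Lt Tt; rewrite leNgt; apply/negP => yt.
  by apply: nex; exists t.
by rewrite leNgt gtrBl e0.
Qed.

(** * Propagation of near-maximal values along the steps *)

Section maximal_approach.
Context (R : realType) dY (Y : measurableType dY) (W : probability Y R).
Variables (X : Y -> R) (L : set R) (y : R -> R) (C M : R).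
Hypotheses (mX : measurable_fun setT X) (my : measurable_fun setT y).
Hypothesis y_bd : forall t, 0 <= y t <= C.
Hypothesis y_sub : forall e : R, 0 < e -> exists T, forall t, L t -> T <= t ->
  ((y t)%:E <= e%:E + \int[W]_w (y (t - X w))%:E)%E.
Hypothesis L_step : forall t, L t -> {ae W, forall w, L (t - X w)}.
Hypothesis y_le : forall e : R, 0 < e -> exists T, forall t, L t -> T <= t -> y t <= M + e.

(* Whenever [y t] is nearly maximal, [y] is also nearly maximal at some point
   of [L] within distance [rho] of [t - s]. *)
Definition reachable (s rho : R) := forall e : R, 0 < e -> exists e' T : R, 0 < e' /\
  forall t, L t -> T <= t -> M - e' <= y t ->
    exists u, [/\ `|u - s| <= rho, L (t - u) & M - e <= y (t - u)].

Lemma reachableD s s' rho rho' :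
  reachable s rho -> reachable s' rho' -> reachable (s + s') (rho + rho').
Proof.
move=> rs rs' e /rs'[e1 [T1 [e1_gt0 H1]]].
have [e2 [T2 [e2_gt0 H2]]] := rs e1 e1_gt0.
(* The first shift is at most [s + rho], so [t - u] still exceeds [T1]. *)
exists e2, (Num.max T2 (T1 + s + rho)); split=> // t Lt; rewrite ge_max => /andP[T2t T1t] yt.
have [u [us Lu yu]] := H2 t Lt T2t yt.
have [|u' [us' Lu' yu']] := H1 (t - u) Lu _ yu.
  by move: us; rewrite ler_norml; lra.
exists (u + u'); have -> : t - (u + u') = t - u - u' by ring.
split=> //; by rewrite (_ : _ - _ = (u - s) + (u' - s')) ?(le_trans (ler_normD _ _)) ?lerD//; ring.
Qed.

Lemma probability_tail e : 0 < e -> exists N, (W [set w | (N < X w)%R] <= e%:E)%E.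
Proof.
move=> e0; pose A (n : nat) := [set w | n%:R < X w].
have mA n : measurable (A n).
  by rewrite -[A n]setTI; exact: measurable_fun_ltr.
have /= : W \o A @ \oo --> W (\bigcap_n A n).
  apply: nonincreasing_cvg_mu => //.
  - by rewrite -ge0_fin_numE// fin_num_measure.
  - by apply: bigcapT_measurable.
  - move=> m n mn; apply/subsetPset => w /=; apply: le_lt_trans.
    by rewrite ler_nat.
have -> : \bigcap_n A n = set0.
  rewrite -subset0 => w Aw; have := Aw (Num.truncn (X w)).+1 I.
  by move=> /(lt_trans (truncnS_gt _)); rewrite ltxx.
rewrite measure0 => /fine_cvgP[_ /cvgrPdist_le /(_ _ e0)[N _ /(_ N (leqnn _))]] /=.
rewrite sub0r normrN ger0_norm ?fine_ge0// => WN; exists N%:R.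
by rewrite -lee_fin fineK// in WN; rewrite fin_num_measure.
Qed.

(** If all the points reached through [I], an event of positive probability, had values below
    [M - e], the average would fall below the near-maximal [y t]: elsewhere the values are at most
    [M + e'], except on a tail event of probability at most [e']. *)
Lemma reachable_support s rho :
  (0 < W [set w | (`|X w - s| <= rho)%R])%E -> reachable s rho.
Proof.
set I := [set w | _] => WI e e0.
have mI : measurable I.
  rewrite -[I]setTI; apply: measurable_fun_ler => //.
  by apply: measurableT_comp => //; exact: measurable_funB.
have C0 : 0 <= C by have /andP[] := y_bd 0; exact: le_trans.
pose q := fine (W I).
have WIq : W I = q%:E by rewrite fineK// fin_num_measure.
have q0 : 0 < q by rewrite -lte_fin -WIq.
have q1 : q <= 1 by rewrite -lee_fin -WIq probability_le1.
have den0 : 0 < C + e + 4 by lra.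
(* The gain on [I] is [(e + e') * q]. The losses are [3 * e'], plus [(C + e + e') * e'] from the
   tail; as [e' <= 1], they add up to at most [(C + e + 4) * e' = e * q]. *)
pose e' := e * q / (C + e + 4).
have e'0 : 0 < e' by rewrite divr_gt0// mulr_gt0.
have e'E : e' * (C + e + 4) = e * q by rewrite divfK// gt_eqF.
have e'1 : e' <= 1.
  rewrite ler_pdivrMr// mul1r (@le_trans _ _ e)//; last lra.
  by rewrite ler_piMr// ltW.
have [T0 HT0] := y_le e'0.
have [T1 HT1] := y_sub e'0.
have [N HN] := probability_tail e'0.
(* The bound [T0 + N] keeps [t - X w] above [T0] off the tail event. *)
exists e', (Num.max T1 (Num.max T0 (T0 + N))); split=> // t Lt.
rewrite !ge_max => /and3P[T1t T0t T0Nt] yt.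
apply: contrapT => nex.
pose J := [set w | N < X w].
have mJ : measurable J by rewrite -[J]setTI; exact: measurable_fun_ltr.
have myt : measurable_fun setT (fun w => y (t - X w)).
  by apply: (measurableT_comp my); exact: measurable_funB.
have M0 : 0 <= M + e' by apply: le_trans (HT0 _ Lt T0t); case/andP: (y_bd t).
have le_ae : (\int[W]_w (y (t - X w) + (e + e') * \1_I w)%:E <=
    \int[W]_w ((M + e') + (C + e + e') * \1_J w)%:E)%E.
  apply: ae_ge0_le_integral => //.
  - by move=> w _; rewrite lee_fin addr_ge0 ?mulr_ge0//; [case/andP: (y_bd (t - X w))|lra].
  - apply/measurable_EFinP; apply: measurable_funD => //.
    by apply: measurable_funM => //; exact: measurable_indic.
  - by move=> w _; rewrite lee_fin addr_ge0// mulr_ge0//; lra.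
  - apply/measurable_EFinP; apply: measurable_funD => //.
    by apply: measurable_funM => //; exact: measurable_indic.
  apply: filterS (L_step Lt) => w Lw _; rewrite lee_fin !indicE.
  have /andP[y0 yC] := y_bd (t - X w).
  have [wJ|wJ] := pselect (J w).
    rewrite (mem_set wJ) mulr1; case: (w \in I); rewrite ?mulr1 ?mulr0 ?mulr1n ?mulr0n; lra.
  rewrite (memNset wJ) mulr0 addr0.
  have T0w : T0 <= t - X w by move/negP: wJ; rewrite -leNgt; lra.
  have yM := HT0 _ Lw T0w.
  have [wI|wI] := pselect (I w); last by rewrite (memNset wI) mulr0 addr0.
  rewrite (mem_set wI) mulr1; have [ye|] := ltP (y (t - X w)) (M - e); first lra.
  by move=> ye; exfalso; apply: nex; exists (X w).
have intI (K : set Y) (a : R) : measurable K -> 0 <= a ->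
    (\int[W]_w (a * \1_K w)%:E = a%:E * W K)%E.
  move=> mK a0; under eq_integral do rewrite EFinM.
  by rewrite ge0_integralZl_EFin ?integral_indic ?setIT//; apply/measurable_EFinP; exact: measurable_indic.
have mE (K : set Y) (a : R) : measurable K -> measurable_fun setT (fun w => (a * \1_K w)%:E).
  by move=> mK; apply/measurable_EFinP; apply: measurable_funM => //; exact: measurable_indic.
have lhsE : (\int[W]_w (y (t - X w) + (e + e') * \1_I w)%:E =
    \int[W]_w (y (t - X w))%:E + ((e + e') * q)%:E)%E.
  under eq_integral do rewrite EFinD.
  rewrite ge0_integralD//; last 4 first.
  - by move=> w _; rewrite lee_fin; case/andP: (y_bd (t - X w)).
  - exact/measurable_EFinP.
  - by move=> w _; rewrite lee_fin mulr_ge0//; lra.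
  - exact: mE.
  by rewrite intI//; [rewrite WIq|lra].
have rhsE : (\int[W]_w ((M + e') + (C + e + e') * \1_J w)%:E =
    (M + e')%:E + (C + e + e')%:E * W J)%E.
  under eq_integral do rewrite EFinD.
  rewrite ge0_integralD//; last 2 first.
  - by move=> w _; rewrite lee_fin mulr_ge0//; lra.
  - exact: mE.
  by rewrite integral_cst_probability intI//; lra.
have := HT1 t Lt T1t.
move: le_ae; rewrite {}lhsE {}rhsE.
have : (\int[W]_w (y (t - X w))%:E \is a fin_num)%E.
  rewrite ge0_fin_numE; last by apply: integral_ge0 => w _; rewrite lee_fin; case/andP: (y_bd (t - X w)).
  apply: (@le_lt_trans _ _ (\int[W]_w C%:E)%E); last by rewrite integral_cst_probability ltry.
  apply: ge0_le_integral => //.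
  - by move=> w _; rewrite lee_fin; case/andP: (y_bd (t - X w)).
  - exact/measurable_EFinP.
  - by move=> w _; rewrite lee_fin; case/andP: (y_bd (t - X w)).
case: (\int[W]_w _)%E => // a _; rewrite -EFinD => le1; rewrite -EFinD lee_fin => le2.
have {le1} : a + (e + e') * q <= M + e' + (C + e + e') * e'.
  rewrite -lee_fin; apply: (le_trans le1); rewrite [leRHS]EFinD leeD2l// [leRHS]EFinM lee_pmul2l//.
  by rewrite lte_fin; lra.
have : e' * e' <= e' * 1 by rewrite ler_wpM2l// ltW.
have : 0 < e' * q by rewrite mulr_gt0.
move: e'E le2 yt; rewrite !mulrDr !mulrDl; lra.
Qed.

End maximal_approach.

(** * Averages around near-maximal times *)

Section maximal_limit.
Context (R : realType) dO (O : measurableType dO) (m : {measure set O -> \bar R}).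
Variables (r k : O -> R) (L : set R) (y : R -> R) (M h nu : R).
Hypotheses (mr : measurable_fun setT r) (mk : measurable_fun setT k).
Hypothesis k_ge0 : forall o, 0 <= k o.
Hypothesis k_int : (\int[m]_o (k o)%:E = nu%:E)%E.
Hypotheses (my : measurable_fun setT y) (y_ge0 : forall t, 0 <= y t).
Hypothesis y_near : forall e T : R, 0 < e -> exists t, [/\ L t, T <= t & M - e < y t].
Hypothesis y_avg : forall e : R, 0 < e -> exists T, forall t, L t -> T <= t ->
  (\int[m]_o (y (t - r o) * k o)%:E <= (h + e)%:E)%E.
Hypothesis y_close : forall eta : R, 0 < eta -> exists A,
  (forall t, L t -> L (t - A)) /\
  forall o, 0 < k o -> exists e T : R, 0 < e /\
    forall t, L t -> T <= t -> M - e <= y t -> M - eta <= y (t - A - r o).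

(** Along times [t_ n] in [L] where [y] comes ever closer to [M], each [y (t_ n - A - r o)] with
    [0 < k o] is eventually at least [M - eta]. The rank from which this holds depends on [o], hence
    Fatou's lemma instead of a uniform estimate. *)
Lemma maximal_average : M * nu <= h.
Proof.
have nu0 : 0 <= nu by rewrite -lee_fin -k_int integral_ge0// => o _; rewrite lee_fin.
have mf t : measurable_fun setT (fun o => (y (t - r o) * k o)%:E).
  apply/measurable_EFinP; apply: measurable_funM => //.
  by apply: (measurableT_comp my); exact: measurable_funB.
have f0 t o : (0 <= (y (t - r o) * k o)%:E)%E by rewrite lee_fin mulr_ge0.
have h0 : 0 <= h.
  apply/ler_addgt0Pr => e e0; have [T HT] := y_avg e0.
  have [t [Lt Tt _]] := y_near T ltr01.
  by rewrite -lee_fin; apply: le_trans (HT t Lt Tt); exact: integral_ge0.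
suff H eta : 0 < eta -> (M - eta) * nu <= h.
  apply/ler_addgt0Pr => e e0; have nu1 : 0 < nu + 1 by lra.
  (* The denominator [nu + 1] also covers [nu = 0]. *)
  have := H (e / (nu + 1)); rewrite divr_gt0// => /(_ isT).
  have : e / (nu + 1) * nu <= e.
    by rewrite mulrAC ler_pdivrMr// ler_pM2l//; lra.
  rewrite mulrBl; lra.
move=> eta0; have [Meta|Meta] := leP 0 (M - eta); last first.
  by apply: le_trans h0; rewrite mulr_le0_ge0// ltW.
have [A [LA HA]] := y_close eta0.
have /choice[t_ Ht] : forall n : nat, exists t, [/\ L t, n%:R <= t & M - n.+1%:R^-1 < y t].
  by move=> n; apply: y_near; rewrite invr_gt0.
have tlarge T : \forall n \near \oo, T <= t_ n.
  exists (Num.truncn T).+1 => // n /= Tn; have [_ + _] := Ht n; apply: le_trans.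
  by apply: (le_trans (ltW (truncnS_gt T))); rewrite ler_nat.
have tmax e : 0 < e -> \forall n \near \oo, M - e <= y (t_ n).
  move=> e0; exists (Num.truncn e^-1) => // n /= en; have [_ _ yn] := Ht n.
  apply/ltW/(le_lt_trans _ yn); rewrite lerD2l lerN2.
  rewrite invf_ple ?posrE//; apply: (le_trans (ltW (truncnS_gt _))).
  by rewrite ler_nat.
rewrite -lee_fin EFinM -k_int -ge0_integralZl_EFin//; last 2 first.
- by move=> o _; rewrite lee_fin.
- exact/measurable_EFinP.
apply: le_trans (_ : (_ <= \int[m]_o
    limn_einf (fun n => (y (t_ n - A - r o) * k o)%:E))%E) _.
  apply: ge0_le_integral => //.
  - by move=> o _; rewrite -EFinM lee_fin mulr_ge0.
  - by apply/measurable_EFinP; exact: measurable_funM.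
  - rewrite /limn_einf; apply: measurableT_comp => //.
    apply: measurable_fun_limn_esup => n.
    apply: measurableT_comp => //.
  move=> o _; apply: limn_einf_ge.
  have [ko|] := ltP 0 (k o); last first.
    move=> ko; have -> : k o = 0 by apply/le_anti; rewrite ko k_ge0.
    by apply: nearW => n; rewrite !mulr0 mule0.
  have [e [T [e0 HT]]] := HA o ko.
  near=> n; rewrite -EFinM lee_fin ler_wpM2r//; apply: HT.
  - by have [] := Ht n.
  - by near: n; exact: tlarge.
  - by near: n; exact: tmax.
apply: (le_trans (fatou _ measurableT (fun n => mf _) (fun n o _ => f0 _ _))).
apply/lee_addgt0Pr => e e0; rewrite -EFinD; apply: limn_einf_le.
have [T HT] := y_avg e0.
near=> n; apply: HT; first by apply: LA; have [] := Ht n.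
by rewrite lerBrDr; near: n; exact: tlarge.
Unshelve. all: by end_near. Qed.
End maximal_limit.

(** * Additive semigroups of the real line *)

Section additive_semigroup.
Context (R : realType).
Variable G : set R.
Hypothesis G_add : forall s t, G s -> G t -> G (s + t).

Let G_mul n t : G t -> G (n.+1%:R * t).
Proof.
move=> Gt; elim: n => [|n ih]; first by rewrite mul1r.
by rewrite -natr1 mulrDl mul1r; exact: G_add.
Qed.

(* The combinations [(n - j) t + j s] with [j < n] are [h]-spaced and the
   blocks for consecutive [n] overlap as soon as [n h >= t]. *)
Lemma semigroup_eventually_dense s t : G s -> G t -> 0 < t -> 0 < s - t ->
  exists A, forall a, A <= a -> exists u, [/\ G u, a - (s - t) < u & u <= a].
Proof.
set h := s - t => Gs Gt t0 h0.
pose N := (Num.truncn (t / h)).+1.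
have Nh : t < N%:R * h by rewrite -ltr_pdivrMr//; exact: truncnS_gt.
exists (N%:R * t) => a Na.
have a0 : 0 <= a / t by rewrite divr_ge0 ?(ltW t0)//; apply: le_trans Na; rewrite mulr_ge0// ltW.
pose n := Num.truncn (a / t).
have na : n%:R * t <= a by rewrite -ler_pdivlMr// truncn_le.
have an : a < n.+1%:R * t by rewrite -ltr_pdivrMr//; exact: truncnS_gt.
have Nn : (N <= n)%N.
  by have := le_lt_trans Na an; rewrite ltr_pM2r// ltr_nat.
pose b := a - n%:R * t.
have b0 : 0 <= b / h by rewrite divr_ge0 ?(ltW h0)// /b subr_ge0.
pose j := Num.truncn (b / h).
have jb : j%:R * h <= b by rewrite -ler_pdivlMr// truncn_le.
have bj : b < j.+1%:R * h by rewrite -ltr_pdivrMr//; exact: truncnS_gt.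
have jn : (j < n)%N.
  apply: leq_trans Nn; rewrite -(ltr_nat R) -(ltr_pM2r h0).
  apply: (le_lt_trans jb); apply: le_lt_trans Nh.
  by move: an; rewrite -natr1 mulrDl mul1r /b; lra.
exists (n%:R * t + j%:R * h); split.
- have -> : n%:R * t + j%:R * h = (n - j)%:R * t + j%:R * s.
    by rewrite natrB 1?ltnW// /h; ring.
  have : G ((n - j)%:R * t) by rewrite -(@prednK (n - j)) ?subn_gt0//; exact: G_mul.
  case: j {jb bj jn} => [|j]; first by rewrite mul0r addr0.
  by move=> Gnj; apply: G_add => //; exact: G_mul.
- by move: bj; rewrite -natr1 mulrDl mul1r /b -/h; lra.
- by move: jb; rewrite /b; lra.
Qed.

Hypothesis G_gt0 : forall t, G t -> 0 < t.

(** Euclid's algorithm on the set [D] of positive differences, which contains [G] and is stable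
    under positive subtraction: its infimum is 0, or it is attained and divides every element of
    [G]. *)
Lemma semigroup_dichotomy : G !=set0 ->
  (forall eta : R, 0 < eta -> exists s t, [/\ G s, G t, 0 < s - t & s - t < eta]) \/
  exists lambda, [/\ 0 < lambda, exists s t, [/\ G s, G t & s - t = lambda] &
    forall u, G u -> exists n : nat, (0 < n)%N /\ u = n%:R * lambda].
Proof.
move=> [u0 Gu0]; pose D := [set d | 0 < d /\ exists s t, [/\ G s, G t & s - t = d]].
have GD u : G u -> D u.
  move=> Gu; split; first exact: G_gt0.
  by exists (u + u), u; split=> //; [exact: G_add|rewrite addrK].
have DB d d' : D d -> D d' -> d' < d -> D (d - d').
  move=> [_ [s [t [Gs Gt <-]]]] [_ [s' [t' [Gs' Gt' <-]]]] dd'.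
  split; first by rewrite subr_gt0.
  by exists (s + t'), (t + s'); split; [exact: G_add|exact: G_add|ring].
have lbD : lbound D 0 by move=> d [/ltW].
have hasD : has_inf D by split; [exists u0; exact: GD|exists 0].
have iD0 : 0 <= inf D by apply: lb_le_inf => //; exists u0; exact: GD.
have iD d : D d -> inf D <= d by move=> Dd; apply: ge_inf => //; exists 0.
have [i0|i0] := eqVneq (inf D) 0.
  left=> eta eta0; have [d [d0 [s [t [Gs Gt st]]]] dlt] := inf_adherent eta0 hasD.
  by exists s, t; rewrite st d0 -[eta]add0r -i0.
have {i0}i0 : 0 < inf D by rewrite lt_neqAle eq_sym i0.
right; exists (inf D); have DiD : D (inf D).
  (* If the infimum were not attained, two elements of [D] would lie between [inf D] and twice
     [inf D], and their difference would be an element of [D] below the infimum. *)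
  have [d Dd dlt] := inf_adherent i0 hasD.
  have [->//|id'] := eqVneq (inf D) d.
  have {id'}lt_id : inf D < d by rewrite lt_neqAle id' iD.
  have [|d' Dd' dlt'] := @inf_adherent _ D (d - inf D) _ hasD; first by rewrite subr_gt0.
  have d'd : d' < d by move: dlt'; rewrite addrC subrK.
  have := iD _ (DB _ _ Dd Dd' d'd); have := iD _ Dd'; lra.
split=> // [|u Gu]; first by case: DiD.
pose n := Num.truncn (u / inf D).
have u_gt0 := G_gt0 Gu.
have u0' : 0 <= u / inf D by rewrite divr_ge0// ltW.
have nu : n%:R * inf D <= u by rewrite -ler_pdivlMr// truncn_le.
have un : u < n.+1%:R * inf D by rewrite -ltr_pdivrMr//; exact: truncnS_gt.
have sub k : (k%:R * inf D < u) -> D (u - k%:R * inf D).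
  elim: k => [|k ih]; first by rewrite mul0r subr0 => _; exact: GD.
  rewrite -natr1 mulrDl mul1r => ku.
  rewrite opprD addrA; apply: DB => //; last by lra.
  by apply: ih; lra.
have nE : u = n%:R * inf D.
  apply/eqP; rewrite eq_le nu andbT leNgt; apply/negP => /sub/iD.
  by move: un; rewrite -natr1 mulrDl mul1r; lra.
exists n; split=> //; rewrite lt0n; apply/eqP => n0.
by move: u_gt0; rewrite nE n0 mul0r ltxx.
Qed.

End additive_semigroup.

(** * Support of the step distribution and the semigroup it generates *)

Section support.
Context (R : realType) dY (Y : measurableType dY) (W : probability Y R).
Variable X : Y -> R.
Hypothesis mX : measurable_fun setT X.

Definition support : set R :=
  [set s | forall rho : R, 0 < rho -> (0 < W [set w | (`|X w - s| <= rho)%R])%E].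

(** A point outside the support has a null neighbourhood, hence lies in a null interval with
    rational ends; these are countably many. *)
Lemma ae_support : {ae W, forall w, support (X w)}.
Proof.
pose B (p : rat * rat) := [set w | ratr p.1 <= X w <= ratr p.2].
have mB p : measurable (B p).
  rewrite (_ : B p = X @^-1` `[ratr p.1, ratr p.2]).
    by rewrite -[_ @^-1` _]setTI; exact: mX.
  by apply/seteqP; split => w /=; rewrite in_itv.
pose N (n : nat) := if (choice.unpickle n : option (rat * rat)) is Some p then
   if W (B p) == 0%E then B p else set0 else set0.
have Nnull n : W.-negligible (N n).
  rewrite /N; case: choice.unpickle => [p|]; last exact: negligible_set0.
  case: ifPn => [/eqP Wp|_]; last exact: negligible_set0.
  by apply/negligibleP.
apply: negligibleS (negligible_bigcup Nnull) => w /= /existsNP[rho /not_implyP[rho0]].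
move=> /negP; rewrite lt0e measure_ge0 andbT negbK => /eqP W0.
have [p /andP[p1 p2]] : exists p : rat, X w - rho < ratr p < X w.
  by have [p] := @rat_in_itvoo _ (X w - rho) (X w) ltac:(lra); exists p.
have [q /andP[q1 q2]] : exists q : rat, X w < ratr q < X w + rho.
  by have [q] := @rat_in_itvoo _ (X w) (X w + rho) ltac:(lra); exists q.
have B0 : W (B (p, q)) = 0%E.
  apply/le_anti; rewrite measure_ge0 andbT -W0 le_measure ?inE//.
    rewrite -[X in measurable X]setTI; apply: measurable_fun_ler => //.
    by apply: measurableT_comp => //; exact: measurable_funB.
  by move=> v; rewrite /B /mkset ler_norml [(p, q).1]/fst [(p, q).2]/snd => /andP[]; lra.
exists (choice.pickle (p, q)); first exact: I.
by rewrite /N choice.pickleK B0 eqxx /B /mkset; apply/andP; split; apply: ltW.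
Qed.

Lemma ae_nonempty (A : set Y) : {ae W, forall w, A w} -> A !=set0.
Proof.
move=> aeA; apply/set0P/eqP => A0; move: aeA => [N [mN WN sub]].
have : W N = 1%E.
  rewrite -(@probability_setT _ _ _ W); congr (W _); apply/seteqP; split=> // w _.
  by apply: sub => /=; rewrite A0.
by rewrite WN => /esym/eqP; rewrite onee_eq0.
Qed.

End support.

Lemma indic_pred T (R : pzRingType) (p : pred T) (x : T) :
  \1_[set x | p x] x = (p x)%:R :> R.
Proof.
rewrite indicE; case: (boolP (p x)) => px; first by rewrite mem_set.
by rewrite memNset//; exact/negP.
Qed.

Section additive_closure.
Context (R : realType).
Variable S : set R.

(** The generated semigroup as an intersection: a property stable under addition is transferred to
    it by plain application. *)
Definition additive_closure : set R :=
  [set u | forall G : set R, (forall s t, G s -> G t -> G (s + t)) -> S `<=` G -> G u].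

Lemma additive_closureD s t :
  additive_closure s -> additive_closure t -> additive_closure (s + t).
Proof. by move=> Ss St G GD SG; apply: (GD); [exact: (Ss G)|exact: (St G)]. Qed.

Lemma sub_additive_closure : S `<=` additive_closure.
Proof. by move=> s Ss G _; apply. Qed.

End additive_closure.

(** * The renewal theorem over an abstract reference measure *)

Section renewal_theorem.
Context (R : realType) dY (Y : measurableType dY) (W : probability Y R).
Variables (X : Y -> R) (c : R).
Hypotheses (mX : measurable_fun setT X) (c_gt0 : 0 < c) (X_ge : forall y, c <= X y).
Context dO (O : measurableType dO) (m : {sigma_finite_measure set O -> \bar R}).
Variables (r k : O -> R) (L : set R) (nu gamma : R).
Hypotheses (mr : measurable_fun setT r) (mk : measurable_fun setT k).
Hypothesis k_ge0 : forall o, 0 <= k o.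
Hypothesis L_unbounded : forall T, exists t, L t /\ T <= t.
Hypothesis L_step : forall t, L t -> {ae W, forall w, L (t - X w)}.
(** Translation invariance of the reference measure on the half line: moved by a step, it becomes
    its own restriction to the points beyond that step. *)
Hypothesis k_shift : {ae W, forall w, forall f : R -> \bar R,
  measurable_fun setT f -> (forall x, 0 <= f x)%E ->
  (\int[m]_o (f (X w + r o)%R * (k o)%:E) =
   \int[m]_o (f (r o) * (k o * (X w <= r o)%R%:R)%:E))%E}.
Hypothesis k_finite : forall t,
  (\int[m]_o (k o * (r o <= t)%R%:R)%:E < +oo)%E.
Hypothesis k_mass : (\int[m]_o ((k o)%:E * W [set w | (r o < X w)%R]) = nu%:E)%E.
Hypothesis nu_gt0 : 0 < nu.
Hypothesis kernel_avg : forall e : R, 0 < e -> exists T, forall t, L t -> T <= t ->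
  ((gamma - e)%:E <= \int[m]_o (renewal_kernel (t - r o) * k o)%:E <= (gamma + e)%:E)%E.
Let Gamma := additive_closure (support W X).
Hypothesis dense_above : forall eta : R, 0 < eta -> exists A,
  (forall t, L t -> L (t - A)) /\ forall o, 0 < k o -> exists s rho : R,
    [/\ 0 < rho, Gamma s & forall t u, L t -> L (t - u) -> `|u - s| <= rho ->
      A + r o <= u <= A + r o + eta].
Hypothesis dense_below : forall eta : R, 0 < eta -> exists A,
  (forall t, L t -> L (t - A)) /\ forall o, 0 < k o -> exists s rho : R,
    [/\ 0 < rho, Gamma s & forall t u, L t -> L (t - u) -> `|u - s| <= rho ->
      A + r o - eta <= u <= A + r o].

Local Notation U := (renewal_fun W X).
Local Notation C := (renewal_bound c).
Let z t := fine (U t).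

Let zE t : U t = (z t)%:E.
Proof.
rewrite /z fineK// ge0_fin_numE ?renewal_fun_ge0//.
by apply: (le_lt_trans (renewal_fun_le W mX c_gt0 X_ge t)); rewrite ltry.
Qed.

Let z_ge0 t : 0 <= z t.
Proof. by rewrite -lee_fin -zE renewal_fun_ge0. Qed.

Let z_le t : z t <= C.
Proof. by rewrite -lee_fin -zE; exact: renewal_fun_le. Qed.

Let mz : measurable_fun setT z.
Proof. exact: (measurableT_comp (@fine_measurable _ setT measurableT) (measurable_renewal_fun W mX)). Qed.

Let mz_step t : measurable_fun setT (fun w => (z (t - X w))%:E).
Proof. by apply/measurable_EFinP; apply: (measurableT_comp mz); exact: measurable_funB. Qed.

Let z_mono s t : s <= t -> z s <= expR (t - s) * z t.
Proof.
move=> st; have := renewal_fun_mono W mX st.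
rewrite !zE -!EFinM lee_fin => H.
by rewrite -(ler_pM2l (expR_gt0 s)) mulrA -expRD addrC subrK.
Qed.

Let z_eq t : ((z t)%:E = (renewal_kernel t)%:E + \int[W]_w (z (t - X w))%:E)%E.
Proof.
rewrite -zE (renewal_equation W mX); congr (_ + _)%E.
by apply: eq_integral => w _; exact: zE.
Qed.

(** Reference weight times the tail of the step distribution: the weight of the averaging identity,
    of total mass [nu]. *)
Let kk o := k o * fine (W [set w | r o < X w]).

Let kkE o : ((k o)%:E * W [set w | (r o < X w)%R] = (kk o)%:E)%E.
Proof.
rewrite /kk EFinM fineK// fin_num_measure//.
by rewrite -[X in measurable X]setTI; exact: measurable_fun_ltr.
Qed.

Let kk_ge0 o : 0 <= kk o. Proof. by rewrite mulr_ge0// fine_ge0. Qed.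

Let mlt : measurable [set p : O * Y | r p.1 < X p.2].
Proof.
rewrite -[X in measurable X]setTI; apply: measurable_fun_ltr => //.
  exact: (measurableT_comp mr measurable_fst).
exact: (measurableT_comp mX measurable_snd).
Qed.

Let mkk : measurable_fun setT kk.
Proof.
apply: measurable_funM => //.
apply: (measurableT_comp (@fine_measurable _ setT measurableT)).
rewrite (_ : (fun o => _) = fubini_F W (fun p => (\1_[set p : O * Y | r p.1 < X p.2] p)%:E)).
  apply: measurable_fun_fubini_tonelli_F => //.
  by apply/measurable_EFinP; exact: measurable_indic.
apply/funext => o; rewrite /fubini_F.
transitivity (\int[W]_y (\1_[set w | r o < X w] y)%:E)%E.
  rewrite integral_indic ?setIT//.
  by rewrite -[X in measurable X]setTI; exact: measurable_fun_ltr.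
by apply: eq_integral => w _; rewrite !indicE.
Qed.

Let mkz t : measurable_fun setT (fun o => z (t - r o)).
Proof. by apply: (measurableT_comp mz); exact: measurable_funB. Qed.

(* Integrating the renewal equation for [z (t - r o)] against [k o dm]
   and cancelling the finite common part. *)
Lemma renewal_average t :
  (\int[m]_o (z (t - r o) * kk o)%:E =
   \int[m]_o (renewal_kernel (t - r o) * k o)%:E)%E.
Proof.
pose F1 (p : O * Y) := (z (t - (X p.2 + r p.1)) * k p.1)%:E.
pose F2 (p : O * Y) := (z (t - r p.1) * (k p.1 * (X p.2 <= r p.1)%R%:R))%:E.
have mr1 : measurable_fun setT (fun p : O * Y => r p.1) by exact: (measurableT_comp mr measurable_fst).
have mk1 : measurable_fun setT (fun p : O * Y => k p.1) by exact: (measurableT_comp mk measurable_fst).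
have mX2 : measurable_fun setT (fun p : O * Y => X p.2) by exact: (measurableT_comp mX measurable_snd).
have mF1 : measurable_fun setT F1.
  apply/measurable_EFinP; apply: measurable_funM => //.
  apply: (measurableT_comp mz); apply: measurable_funB => //; exact: measurable_funD.
have mF2 : measurable_fun setT F2.
  apply/measurable_EFinP; apply: measurable_funM.
    by apply: (measurableT_comp mz); exact: measurable_funB.
  apply: measurable_funM => //.
  rewrite (_ : (fun p => _) = \1_[set p : O * Y | X p.2 <= r p.1]).
    apply: measurable_indic; rewrite -[X in measurable X]setTI.
    exact: measurable_fun_ler.
  by apply/funext => p; rewrite (indic_pred R (fun p => _)).
have F1_ge0 p : (0 <= F1 p)%E by rewrite lee_fin mulr_ge0.
have F2_ge0 p : (0 <= F2 p)%E by rewrite lee_fin !mulr_ge0.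
have mle o : measurable [set w | X w <= r o].
  by rewrite -[X in measurable X]setTI; exact: measurable_fun_ler.
have mlt' o : measurable [set w | r o < X w].
  by rewrite -[X in measurable X]setTI; exact: measurable_fun_ltr.
have Wsplit o : (W [set w | (X w <= r o)%R] + W [set w | (r o < X w)%R] = 1)%E.
  rewrite -measureU//.
    rewrite -(@probability_setT _ _ _ W); congr (W _); apply/seteqP; split=> // w _.
    by rewrite /setU/=; case: leP; [left|right].
  by apply/seteqP; split=> // w /= []; case: leP.
have mzk : measurable_fun setT (fun o => (z (t - r o) * k o)%:E).
  by apply/measurable_EFinP; exact: measurable_funM.
have mzkk : measurable_fun setT (fun o => (z (t - r o) * kk o)%:E).
  by apply/measurable_EFinP; exact: measurable_funM.
have mgk : measurable_fun setT (fun o => (renewal_kernel (t - r o) * k o)%:E).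
  apply/measurable_EFinP; apply: measurable_funM => //.
  by apply: (measurableT_comp (@measurable_renewal_kernel R)); exact: measurable_funB.
have innerF1 o : (\int[W]_w F1 (o, w) =
    (\int[W]_w (z (t - r o - X w))%:E) * (k o)%:E)%E.
  rewrite -ge0_integralZr//.
  - by apply: eq_integral => w _; rewrite /F1/= EFinM; congr ((z _)%:E * _)%E; ring.
  - by move=> w _; rewrite lee_fin.
  - by rewrite lee_fin.
have innerF2 o : (\int[W]_w F2 (o, w) =
    (z (t - r o) * k o)%:E * W [set w | (X w <= r o)%R])%E.
  rewrite -[X in (_ * W X)%E]setIT -integral_indic// -ge0_integralZl_EFin//.
  - by apply: eq_integral => w _; rewrite /F2/= mulrA EFinM (indic_pred R (fun w => X w <= r o)).
  - by apply/measurable_EFinP; exact: measurable_indic.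
  - by rewrite mulr_ge0.
pose I1 := (\int[m]_o (z (t - r o) * k o)%:E)%E.
pose J := (\int[m]_o \int[W]_w F2 (o, w))%E.
(* After Tonelli, [k_shift] acts on the inner integral over [o], for almost every fixed step. *)
have swap : (\int[m]_o \int[W]_w F1 (o, w) = J)%E.
  rewrite /J (fubini_tonelli _ mF1)// (fubini_tonelli _ mF2)//.
  apply: ge0_ae_eq_integral => //.
  - exact: (measurable_fun_fubini_tonelli_G _ mF1).
  - exact: (measurable_fun_fubini_tonelli_G _ mF2).
  - by move=> w _; apply: integral_ge0.
  - by move=> w _; apply: integral_ge0.
  apply: filterS k_shift => w H _.
  have mzt : measurable_fun setT (fun x : R => (z (t - x))%:E).
    by apply/measurable_EFinP; apply: (measurableT_comp mz); exact: measurable_funB.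
  have z0 (x : R) : (0 <= (z (t - x))%:E)%E by rewrite lee_fin.
  have := H _ mzt z0; rewrite /fubini_G /F1 /F2 /=.
  by under eq_integral do rewrite -EFinM; under [RHS]eq_integral do rewrite -EFinM.
have I1_decomp1 : (I1 = \int[m]_o (renewal_kernel (t - r o) * k o)%:E + J)%E.
  rewrite -swap -ge0_integralD//; last 3 first.
  - by move=> o _; rewrite lee_fin mulr_ge0// renewal_kernel_ge0.
  - by move=> o _; apply: integral_ge0.
  - exact: (measurable_fun_fubini_tonelli_F _ mF1).
  apply: eq_integral => o _; rewrite innerF1 EFinM z_eq ge0_muleDl// ?lee_fin ?renewal_kernel_ge0//.
  by apply: integral_ge0 => w _; rewrite lee_fin.
have I1_decomp2 : (I1 = \int[m]_o (z (t - r o) * kk o)%:E + J)%E.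
  rewrite -ge0_integralD//; last 3 first.
  - by move=> o _; rewrite lee_fin mulr_ge0.
  - by move=> o _; apply: integral_ge0.
  - exact: (measurable_fun_fubini_tonelli_F _ mF2).
  apply: eq_integral => o _.
  rewrite innerF2 [X in _ = (X + _)%E]EFinM -kkE muleA -EFinM -ge0_muleDr// addeC Wsplit.
  by rewrite mule1.
(* [J] is at most [I1], in which [z] is bounded by [C] and vanishes at negative arguments, so that
   only the mass of [k] on [r o <= t] counts. Finiteness is what permits the cancellation. *)
have J_fin : J \is a fin_num.
  rewrite ge0_fin_numE; last by apply: integral_ge0 => o _; apply: integral_ge0.
  apply: (@le_lt_trans _ _ I1).
    by rewrite I1_decomp1 leeDr// integral_ge0// => o _; rewrite lee_fin mulr_ge0// renewal_kernel_ge0.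
  apply: (@le_lt_trans _ _ (C%:E * \int[m]_o (k o * (r o <= t)%R%:R)%:E)%E); last first.
    by rewrite lte_mul_pinfty// lee_fin ltW// renewal_bound_gt0.
  have mkt : measurable_fun setT (fun o => k o * (r o <= t)%R%:R).
    apply: measurable_funM => //.
    rewrite (_ : (fun o => _) = \1_[set o | r o <= t]).
      apply: measurable_indic; rewrite -[X in measurable X]setTI.
      exact: measurable_fun_ler.
    by apply/funext => p; rewrite (indic_pred R (fun p => _)).
  rewrite -ge0_integralZl_EFin//; last 3 first.
  - by move=> o _; rewrite lee_fin mulr_ge0.
  - exact/measurable_EFinP.
  - by rewrite ltW// renewal_bound_gt0.
  apply: ge0_le_integral => //.
  - by move=> o _; rewrite lee_fin mulr_ge0.
  - by apply: measurable_funeM; exact/measurable_EFinP.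
  move=> o _; rewrite -EFinM lee_fin; have [rt|rt] := leP (r o) t.
    by rewrite mulr1 ler_wpM2r.
  by rewrite /z (@renewal_fun_lt0 _ _ _ W _ _ c_gt0 X_ge) ?subr_lt0// mul0r !mulr0.
by rewrite -[LHS](addeK _ J_fin) -I1_decomp2 I1_decomp1 addeK.
Qed.

Let int_kk : (\int[m]_o (kk o)%:E = nu%:E)%E.
Proof. by rewrite -k_mass; apply: eq_integral => o _; rewrite kkE. Qed.

Let kk_gt0 o : 0 < kk o -> 0 < k o.
Proof.
rewrite lt_def => /andP[kk0 _]; rewrite lt_def k_ge0 andbT.
by apply: contra_neq kk0; rewrite /kk => ->; rewrite mul0r.
Qed.

Let z_sub (e : R) : 0 < e -> exists T, forall t, T <= t -> renewal_kernel t <= e.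
Proof.
move=> e0; exists (Num.max 0 (- ln e)) => t; rewrite ge_max => /andP[t0 te].
by rewrite /renewal_kernel t0 -(lnK e0) ler_expR; lra.
Qed.

(** Being reachable at every precision is stable under addition, since [rho] may be halved; it thus
    passes from the support to the semigroup. *)
Let Gamma_reachable (y : R -> R) M :
  (forall s rho, (0 < W [set w | (`|X w - s| <= rho)%R])%E -> reachable L y M s rho) ->
  forall s rho, Gamma s -> 0 < rho -> reachable L y M s rho.
Proof.
move=> H s rho Gs; move: rho.
apply: (Gs [set s | forall rho, 0 < rho -> reachable L y M s rho]) => /=.
  move=> s1 s2 H1 H2 rho rho0; rewrite (splitr rho).
  by apply: reachableD; [apply: H1|apply: H2]; rewrite divr_gt0.
by move=> s1 Ss1 rho rho0; apply: H; exact: Ss1.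
Qed.

Let int_z_fin t : (\int[W]_w (z (t - X w))%:E \is a fin_num)%E.
Proof.
rewrite ge0_fin_numE; last by apply: integral_ge0 => w _; rewrite lee_fin.
apply: (@le_lt_trans _ _ (z t)%:E); last exact: ltry.
by rewrite z_eq leeDr// lee_fin renewal_kernel_ge0.
Qed.

Let C_gt0 : 0 < C. Proof. exact: renewal_bound_gt0. Qed.

(** A high value persists to the right and a low value to the left. Hence, for the upper limit, the
    reached point [t - u] must lie just left of the target [t - A - r o], and for the lower limit
    just right of it: [dense_above] and [dense_below]. *)
Let z_close s t : s <= t -> z s - (t - s) * C <= z t.
Proof.
move=> st; have H := z_mono st.
have : expR (- (t - s)) * z s <= z t.
  by rewrite -(ler_pM2l (expR_gt0 (t - s))) mulrA -expRD subrr expR0 mul1r.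
have : (1 + - (t - s)) * z s <= expR (- (t - s)) * z s.
  by rewrite ler_wpM2r// expR_ge1Dx.
have : (t - s) * z s <= (t - s) * C by rewrite ler_wpM2l// subr_ge0.
rewrite [(1 + _) * _]mulrDl mul1r mulNr; lra.
Qed.

Let eta_scale (eta d : R) : 0 < eta -> d <= eta / (2 * C + 2) -> d * C <= eta / 2.
Proof.
move=> eta0 d_le; have C1 : 0 < 2 * C + 2 by move: C_gt0; lra.
apply: (@le_trans _ _ (eta / (2 * C + 2) * C)).
  by rewrite ler_wpM2r// ltW// C_gt0.
rewrite mulrAC ler_pdivrMr// -subr_ge0.
by rewrite (_ : _ - _ = eta) ?ltW//; field.
Qed.

Let z_upper (e : R) : 0 < e -> exists T, forall t, L t -> T <= t -> z t <= gamma / nu + e.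
Proof.
have z_bd t : 0 <= z t <= C by rewrite z_ge0 z_le.
have [M [Mle Mnear]] := limsup_exists L_unbounded z_bd.
suff MG : M <= gamma / nu.
  move=> e0; have [T HT] := Mle e e0; exists T => t Lt Tt.
  by rewrite (le_trans (HT t Lt Tt))// lerD2r.
rewrite ler_pdivlMr//.
have reach s rho : Gamma s -> 0 < rho -> reachable L z M s rho.
  apply: Gamma_reachable => {}s {}rho.
  apply: (reachable_support mX mz z_bd _ L_step Mle) => e' e'0.
  have [T HT] := z_sub e'0; exists T => t _ Tt.
  by rewrite z_eq leeD2r// lee_fin HT.
apply: (@maximal_average R dO O m r kk L z M gamma nu mr mkk kk_ge0 int_kk mz z_ge0 Mnear).
  move=> e' /kernel_avg[T HT]; exists T => t Lt Tt; rewrite renewal_average.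
  by have /andP[_] := HT t Lt Tt.
move=> eta eta0.
(* A window of this width costs at most [eta / 2] through [z_close]; the other half of [eta] is
   spent on reachability. *)
have eC : 0 < eta / (2 * C + 2) by rewrite divr_gt0//; move: C_gt0; lra.
have [A [LA HA]] := dense_above eC.
exists A; split=> // o /kk_gt0 ko; have [s [rho [rho0 Gs Hs]]] := HA o ko.
have [|e' [T [e'0 HT]]] := reach s rho Gs rho0 (eta / 2); first by rewrite divr_gt0.
exists e', T; split=> // t Lt Tt Mz; have [u [us Ltu zu]] := HT t Lt Tt Mz.
have /andP[u1 u2] := Hs t u Lt Ltu us.
have /z_close : t - u <= t - A - r o by lra.
have /(eta_scale eta0) : t - A - r o - (t - u) <= eta / (2 * C + 2) by lra.
lra.
Qed.

(** The argument for the upper limit is applied to [C - z], which is at most its own average over a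
    step because the kernel is subtracted from it, and whose averages against [kk] tend to
    [C * nu - gamma]. *)
Let z_lower (e : R) : 0 < e -> exists T, forall t, L t -> T <= t -> gamma / nu - e <= z t.
Proof.
pose y t := C - z t.
have y_bd t : 0 <= y t <= C by rewrite /y subr_ge0 z_le gerBl z_ge0.
have y_ge0 t : 0 <= y t by case/andP: (y_bd t).
have my : measurable_fun setT y by apply: measurable_funB.
have [M [Mle Mnear]] := limsup_exists L_unbounded y_bd.
suff MG : M <= C - gamma / nu.
  move=> e0; have [T HT] := Mle e e0; exists T => t Lt Tt.
  by have := HT t Lt Tt; rewrite /y; lra.
have -> : C - gamma / nu = (C * nu - gamma) / nu by rewrite mulrBl mulfK// gt_eqF.
rewrite ler_pdivlMr//.
have reach s rho : Gamma s -> 0 < rho -> reachable L y M s rho.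
  apply: Gamma_reachable => {}s {}rho.
  apply: (reachable_support mX my y_bd _ L_step Mle) => e' e'0.
  have [T HT] := z_sub e'0; exists T => t _ Tt.
  have : (\int[W]_w (y (t - X w))%:E + \int[W]_w (z (t - X w))%:E = C%:E)%E.
    rewrite -ge0_integralD//; last 3 first.
    - by move=> w _; rewrite lee_fin.
    - by apply/measurable_EFinP; apply: (measurableT_comp my); exact: measurable_funB.
    - by move=> w _; rewrite lee_fin.
    rewrite -[RHS](integral_cst_probability W); apply: eq_integral => w _.
    by rewrite -EFinD /y subrK.
  have := z_eq t; move: (int_z_fin t).
  case: (\int[W]_w (z (t - X w))%:E)%E => // a _ -[zt].
  case: (\int[W]_w (y (t - X w))%:E)%E => // b [ba].
  by rewrite -EFinD lee_fin /y zt -ba; have := renewal_kernel_ge0 t; lra.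
apply: (@maximal_average R dO O m r kk L y M _ nu mr mkk kk_ge0 int_kk my y_ge0 Mnear).
  move=> e' /kernel_avg[T HT]; exists T => t Lt Tt.
  have : (\int[m]_o (y (t - r o) * kk o)%:E + \int[m]_o (z (t - r o) * kk o)%:E = (C * nu)%:E)%E.
    rewrite -ge0_integralD//; last 4 first.
    - by move=> o _; rewrite lee_fin mulr_ge0.
    - apply/measurable_EFinP; apply: measurable_funM => //.
      by apply: (measurableT_comp my); exact: measurable_funB.
    - by move=> o _; rewrite lee_fin mulr_ge0.
    - by apply/measurable_EFinP; exact: measurable_funM.
    rewrite EFinM -int_kk -ge0_integralZl_EFin//; last 3 first.
    - by move=> o _; rewrite lee_fin.
    - exact/measurable_EFinP.
    - by rewrite ltW// C_gt0.
    by apply: eq_integral => o _; rewrite -EFinD -EFinM -mulrDl /y subrK.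
  rewrite renewal_average; have /andP[+ _] := HT t Lt Tt.
  have Iy0 : (0 <= \int[m]_o (y (t - r o) * kk o)%:E)%E.
    by apply: integral_ge0 => o _; rewrite lee_fin mulr_ge0.
  case: (\int[m]_o (renewal_kernel _ * _)%:E)%E => // [a|] /=; last first.
    by move=> _; move: Iy0; case: (\int[m]_o _)%E.
  move: Iy0; case: (\int[m]_o _)%E => // b _; rewrite !lee_fin => le_a [ba].
  by rewrite -ba; lra.
move=> eta eta0.
have eC : 0 < eta / (2 * C + 2) by rewrite divr_gt0//; move: C_gt0; lra.
have [A [LA HA]] := dense_below eC.
exists A; split=> // o /kk_gt0 ko; have [s [rho [rho0 Gs Hs]]] := HA o ko.
have [|e' [T [e'0 HT]]] := reach s rho Gs rho0 (eta / 2); first by rewrite divr_gt0.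
exists e', T; split=> // t Lt Tt Mz; have [u [us Ltu zu]] := HT t Lt Tt Mz.
have /andP[u1 u2] := Hs t u Lt Ltu us.
have /z_close : t - A - r o <= t - u by lra.
have /(eta_scale eta0) : t - u - (t - A - r o) <= eta / (2 * C + 2) by lra.
move: zu; rewrite /y; lra.
Qed.

Theorem renewal_limit (e : R) : 0 < e ->
  exists T, forall t, L t -> T <= t -> `|fine (U t) - gamma / nu| <= e.
Proof.
move=> e0; have [T1 H1] := z_upper e0; have [T2 H2] := z_lower e0.
exists (Num.max T1 T2) => t Lt; rewrite ge_max => /andP[T1t T2t].
by rewrite ler_distl H1 ?H2// addrC.
Qed.

End renewal_theorem.

(** * Affine change of variable for Lebesgue measure *)

Section affine_change_of_variable.
Context (R : realType).
Local Notation mu := (@lebesgue_measure R).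
Variables (a b : R).
Hypothesis a_gt0 : 0 < a.

Let phi : measurableTypeR R -> measurableTypeR R := fun x => a * x + b.

Let mphi : measurable_fun setT phi.
Proof. by apply: measurable_funD => //; exact: measurable_funM. Qed.

Let image_measure : {measure set (measurableTypeR R) -> \bar R}.
Proof. by refine (pushforward mu phi : {measure set _ -> \bar R}). Defined.

(** Both sides are measures that agree on half-open intervals. *)
Lemma lebesgue_measure_affine (A : set R) : measurable A ->
  (a%:E * pushforward mu phi A = mu A)%E.
Proof.
move=> mA; apply/esym.
pose m' : {measure set (measurableTypeR R) -> \bar R} :=
  mscale (NngNum (ltW a_gt0)) image_measure.
suff H : forall V, ocitv V -> mu V = m' V by exact: (lebesgue_measure_unique H mA).
have m'E V : m' V = (a%:E * mu (phi @^-1` V))%E by [].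
move=> _ [[u v]] _ <-; rewrite m'E /=.
have -> : phi @^-1` `]u, v] = `](u - b) / a, (v - b) / a]%classic.
  apply/seteqP; split => x; rewrite /phi /= !in_itv/= ltr_pdivrMr// ler_pdivlMr//;
  by rewrite (mulrC x) ltrBlDr lerBrDr.
rewrite !lebesgue_measure_itv/= !lte_fin ltr_pM2r ?invr_gt0// ltrD2r.
case: ifPn => // _; last by rewrite mule0.
rewrite -!EFinB -EFinM; congr (_%:E); field.
by rewrite gt_eqF.
Qed.

Lemma ge0_integral_affine (f : R -> \bar R) : measurable_fun setT f ->
  (forall x, 0 <= f x)%E ->
  (a%:E * \int[mu]_x f (a * x + b)%R = \int[mu]_x f x)%E.
Proof.
move=> mf f0.
rewrite -(ge0_integral_pushforward mphi mu measurableT mf); last by move=> x _; exact: f0.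
rewrite -(ge0_integral_mscale image_measure measurableT (NngNum (ltW a_gt0)) mf)//.
by apply: eq_measure_integral => A mA _; exact: lebesgue_measure_affine.
Qed.

End affine_change_of_variable.

HB.instance Definition _ (R : realType) :=
  @Measure_isSigmaFinite.Build _ nat R (@counting nat R) (@sigma_finite_counting R).

(** * The two instances: lattice and non-lattice steps *)

Section renewal_limits.
Context (R : realType) dY (Y : measurableType dY) (W : probability Y R).
Variables (X : Y -> R) (c mu1 : R).
Hypotheses (mX : measurable_fun setT X) (c_gt0 : 0 < c) (X_ge : forall y, c <= X y).
Hypothesis X_mean : (\int[W]_w (X w)%:E = mu1%:E)%E.

Local Notation leb := (@lebesgue_measure R).

Let Gamma := additive_closure (support W X).

Let Gamma_gt0 s : Gamma s -> 0 < s.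
Proof.
move=> Gs; apply: (Gs [set s | 0 < s]) => [u v /= u0 v0|u Su /=]; first exact: addr_gt0.
rewrite ltNge; apply/negP => u0; have := Su (c / 2); rewrite divr_gt0// => /(_ isT).
rewrite (_ : [set w | _] = set0) ?measure0 ?ltxx//.
rewrite -subset0 => w /=; apply/negP; rewrite -ltNge.
have := X_ge w; move: c_gt0 => c0 cX; rewrite ger0_norm; lra.
Qed.

Let ae_Gamma : {ae W, forall w, Gamma (X w)}.
Proof.
by apply: filterS (ae_support W mX) => w; exact: sub_additive_closure.
Qed.

Lemma mean_step_gt0 : 0 < mu1.
Proof.
rewrite -lte_fin -X_mean; apply: (@lt_le_trans _ _ c%:E); first by rewrite lte_fin.
rewrite -[leLHS](integral_cst_probability W); apply: ge0_le_integral => //.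
- by move=> w _; rewrite lee_fin ltW.
- exact/measurable_EFinP.
- by move=> w _; rewrite lee_fin.
Qed.


Lemma ae_pos_measure (A : set Y) (P : Y -> Prop) : measurable A -> (0 < W A)%E ->
  {ae W, forall w, P w} -> exists w, A w /\ P w.
Proof.
move=> mA WA [N [mN WN sub]]; apply: contrapT => H; move: WA.
rewrite lt_neqAle eq_sym => /andP[/negP + _]; apply; apply/eqP/le_anti.
rewrite measure_ge0 andbT -WN le_measure ?inE// => w Aw.
by apply: sub => Pw; apply: H; exists w.
Qed.

Section arithmetic.
Variable lambda : R.
Hypothesis lambda_gt0 : 0 < lambda.
Hypothesis X_lattice :
  {ae W, forall w, exists n : nat, (0 < n)%N /\ X w = n%:R * lambda}.
Hypothesis lambda_max : forall lambda' : R, 0 < lambda' ->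
  {ae W, forall w, exists n : nat, (0 < n)%N /\ X w = n%:R * lambda'} ->
  lambda' <= lambda.

Let L : set R := [set t | exists n : int, t = n%:~R * lambda].

Let L_eq t u : L t -> L u -> `|t - u| < lambda -> t = u.
Proof.
move=> [n ->] [n' ->]; rewrite -mulrBl -intrB normrM (gtr0_norm lambda_gt0).
rewrite -[X in _ < X]mul1r ltr_pM2r// -intr_norm -[1]/(1%:~R) ltr_int => nn.
have : n - n' = 0 by apply/eqP; rewrite -absz_eq0; lia.
by move/eqP; rewrite subr_eq0 => /eqP ->.
Qed.

Let LD t u : L t -> L u -> L (t + u).
Proof. by move=> [n ->] [n' ->]; exists (n + n'); rewrite intrD mulrDl. Qed.

Let LN t : L t -> L (- t).
Proof. by move=> [n ->]; exists (- n); rewrite rmorphN mulNr. Qed.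

Let L_nat (n : nat) : L (n%:R * lambda).
Proof. by exists n; rewrite pmulrn. Qed.

(** The lattice is discrete: lattice points arbitrarily close to a point of the support must be one
    and the same, hence equal to it. *)
Let Gamma_L u : Gamma u -> L u.
Proof.
move=> Gu; apply: (Gu L LD) => s Ss.
have near rho : 0 < rho -> exists n : nat, `|n%:R * lambda - s| <= rho.
  move=> rho0; have mB : measurable [set w | `|X w - s| <= rho].
    rewrite -[X in measurable X]setTI; apply: measurable_fun_ler => //.
    by apply: measurableT_comp => //; exact: measurable_funB.
  have [w [ws [n [_ Xw]]]] := ae_pos_measure mB (Ss rho rho0) X_lattice.
  by exists n; rewrite -Xw.
(* With radius [lambda / 3] here and at most half of that below, the two lattice points are less
   than [lambda] apart. *)
have [|n ns] := near (lambda / 3); first by rewrite divr_gt0.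
suff -> : s = n%:R * lambda by exact: L_nat.
apply/eqP; rewrite eq_sym -subr_eq0 -normr_eq0; apply: contrapT => /negP ns0.
have {}ns0 : 0 < `|n%:R * lambda - s| by rewrite lt_def ns0 normr_ge0.
have [|n' ns'] := near (`|n%:R * lambda - s| / 2); first by rewrite divr_gt0.
have nn' : n%:R * lambda = n'%:R * lambda.
  apply: L_eq => //; rewrite -(subrK s (n%:R * lambda)) -addrA.
  apply: (le_lt_trans (ler_normD _ _)); rewrite (distrC s); move: lambda_gt0 => l0.
  lra.
by move: ns'; rewrite -nn'; lra.
Qed.

(** Positive differences shorter than [lambda] are impossible in the lattice, so the dichotomy gives
    a common divisor [l'] that is itself a difference, and the maximality of the span gives
    [l' <= lambda]. Every late window of length [l'] ending at a lattice point then meets [Gamma],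
    necessarily at that point. *)
Let Gamma_eventually : exists A, forall a, L a -> A <= a -> Gamma a.
Proof.
have G0 : Gamma !=set0 by have [w Gw] := ae_nonempty ae_Gamma; exists (X w).
have [small|[l' [l0 [s [t [Gs Gt st]]] Gl]]] := semigroup_dichotomy (@additive_closureD _ _) Gamma_gt0 G0.
  have [s [t [Gs Gt st0 stl]]] := small lambda lambda_gt0.
  have := L_eq (Gamma_L Gs) (Gamma_L Gt); rewrite gtr0_norm// => /(_ stl) stE.
  by move: st0; rewrite stE subrr ltxx.
have ll : l' <= lambda.
  by apply: lambda_max => //; apply: filterS ae_Gamma => w; exact: Gl.
have st0 : 0 < s - t by rewrite st.
have [A HA] := semigroup_eventually_dense (@additive_closureD _ _) Gs Gt (Gamma_gt0 Gt) st0.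
exists A => a La /HA[u [Gu u1 u2]]; rewrite (L_eq La (Gamma_L Gu))//.
by rewrite ger0_norm ?subr_ge0//; lra.
Qed.

Let r (j : nat) : R := j%:R * lambda.
Let cnt := @counting nat R.
Let rho := expR (- lambda).

Let rho_lt1 : rho < 1. Proof. by rewrite expR_lt1 oppr_lt0. Qed.

Let L_step t : L t -> {ae W, forall w, L (t - X w)}.
Proof.
move=> Lt; apply: filterS X_lattice => w [n [_ ->]].
by apply: LD => //; apply: LN; exact: L_nat.
Qed.

Let k_shift : {ae W, forall w, forall f : R -> \bar R,
  measurable_fun setT f -> (forall x, 0 <= f x)%E ->
  (\int[cnt]_o (f (X w + r o)%R * (1 : R)%:E) =
   \int[cnt]_o (f (r o) * (1 * (X w <= r o)%R%:R)%:E))%E}.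
Proof.
apply: filterS X_lattice => w [n [_ ->]] f mf f0.
rewrite !ge0_integral_count; last 2 first.
- by move=> j; rewrite mule_ge0// lee_fin mul1r ler0n.
- by move=> j; rewrite mule1.
rewrite [RHS](nneseries_split 0 n); last first.
  by move=> j _; rewrite mule_ge0// lee_fin mul1r ler0n.
rewrite add0n big1_seq ?add0e; last first.
  move=> j /=; rewrite mem_index_iota => /andP[_ jn].
  by rewrite /r ler_pM2r// ler_nat leqNgt jn mulr0 mule0.
rewrite -(@nneseries_addn _ (fun j => (f (r j) * (1 * (n%:R * lambda <= r j)%R%:R)%:E)%E)); last first.
  by move=> j; rewrite mule_ge0// lee_fin mul1r ler0n.
apply: eq_eseriesr => j _; rewrite /r -mulrDl -natrD (addnC n).
by rewrite ler_pM2r// ler_nat leq_addl mulr1.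
Qed.

(** The inequality must be strict: it counts the indices 0 to [n - 1], so exactly [x / lambda]
    points, which makes the tail mass equal to [mu1 / lambda]. *)
Let sum_lattice_lt (x : R) (n : nat) : x = n%:R * lambda ->
  (\sum_(j <oo) ((r j < x)%R%:R : R)%:E = (n%:R : R)%:E)%E.
Proof.
move=> ->; rewrite (nneseries_split 0 n); last by move=> j _; rewrite lee_fin ler0n.
rewrite add0n [X in (_ + X)%E]eseries0 ?adde0; last first.
  by move=> j nj _; rewrite /r ltr_pM2r// ltr_nat ltnNge nj.
rewrite (eq_big_seq (fun=> 1%E)); last first.
  move=> j; rewrite mem_index_iota => /andP[_ jn].
  by rewrite /r ltr_pM2r// ltr_nat jn.
by rewrite sumEFin big_const_nat iter_addr addr0 subn0.
Qed.

Let k_finite t : (\int[cnt]_o (1 * (r o <= t)%R%:R)%:E < +oo)%E.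
Proof.
pose n := (Num.truncn (t / lambda)).+1.
rewrite ge0_integral_count; last by move=> j; rewrite lee_fin mul1r ler0n.
apply: (@le_lt_trans _ _ (n%:R : R)%:E); last exact: ltry.
rewrite -(sum_lattice_lt (erefl (n%:R * lambda))); apply: lee_nneseries => j _.
  by rewrite lee_fin mul1r ler0n.
rewrite mul1r lee_fin ler_nat; case: (leP (r j) t) => // rt.
have -> // : r j < n%:R * lambda.
by apply: (le_lt_trans rt); rewrite -ltr_pdivrMr//; exact: truncnS_gt.
Qed.

Let k_mass : (\int[cnt]_o ((1 : R)%:E * W [set w | (r o < X w)%R]) = (mu1 / lambda)%:E)%E.
Proof.
rewrite ge0_integral_count; last by move=> j; rewrite mul1e.
have mlt j : measurable [set w | r j < X w].
  by rewrite -[X in measurable X]setTI; exact: measurable_fun_ltr.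
transitivity (\int[W]_w \sum_(j <oo) ((r j < X w)%R%:R : R)%:E)%E.
  rewrite integral_nneseries//; last first.
    move=> j; apply/measurable_EFinP.
    rewrite (_ : (fun w => _) = \1_[set w | r j < X w]).
      exact: measurable_indic.
    by apply/funext => w; rewrite (indic_pred R (fun w => r j < X w)).
  apply: eq_eseriesr => j _; rewrite mul1e -[in LHS](setIT [set w | r j < X w]) -integral_indic//.
  by apply: eq_integral => w _; rewrite (indic_pred R (fun w => r j < X w)).
transitivity (\int[W]_w ((lambda^-1)%:E * (X w)%:E))%E.
  apply: ge0_ae_eq_integral => //.
  - apply: ge0_emeasurable_sum => [j w _ _|j _]; first by rewrite lee_fin ler0n.
    apply/measurable_EFinP.
    rewrite (_ : (fun w => _) = \1_[set w | r j < X w]).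
      exact: measurable_indic.
    by apply/funext => w; rewrite (indic_pred R (fun w => r j < X w)).
  - by apply: measurable_funeM; exact/measurable_EFinP.
  - by move=> w _; apply: nneseries_ge0 => j _ _; rewrite lee_fin ler0n.
  - by move=> w _; rewrite -EFinM lee_fin mulr_ge0//; [rewrite invr_ge0 ltW|rewrite (le_trans (ltW c_gt0))].
  apply: filterS X_lattice => w [n [_ Xn]] _; rewrite (sum_lattice_lt Xn) Xn -EFinM.
  by rewrite mulrC mulfK// gt_eqF.
rewrite ge0_integralZl_EFin//.
- by rewrite X_mean -EFinM mulrC.
- by move=> w _; rewrite lee_fin (le_trans (ltW c_gt0)).
- exact/measurable_EFinP.
- by rewrite invr_ge0 ltW.
Qed.

Let kernel_lattice (n : nat) :
  (\int[cnt]_o (renewal_kernel (n%:R * lambda - r o) * 1)%:E =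
   ((1 - rho ^+ n.+1) / (1 - rho))%:E)%E.
Proof.
rewrite ge0_integral_count; last by move=> j; rewrite lee_fin mulr1 renewal_kernel_ge0.
rewrite (nneseries_split 0 n.+1); last by move=> j _; rewrite lee_fin mulr1 renewal_kernel_ge0.
rewrite add0n [X in (_ + X)%E]eseries0 ?adde0; last first.
  move=> j nj _; rewrite /renewal_kernel /r -mulrBl pmulr_lge0// subr_ge0 ler_nat leqNgt nj.
  by rewrite mul0r.
rewrite sumEFin big_mkord; congr (_%:E).
rewrite (reindex_inj rev_ord_inj)/=.
rewrite (eq_bigr (fun i : 'I_n.+1 => rho ^+ i)); last first.
  move=> i _; rewrite mulr1 /renewal_kernel /r -mulrBl subSS natrB -1?ltnS//.
  rewrite subKr pmulr_lge0// ler0n /rho -expRM_natl.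
  by congr expR; ring.
have rho1 : 1 - rho != 0 by rewrite subr_eq0 gt_eqF.
apply: (mulIf rho1); rewrite divfK// mulrC -[LHS]opprK -mulNr opprB -subrX1.
by rewrite opprB.
Qed.

Lemma arithmetic_renewal_lattice (e : R) : 0 < e -> exists T, forall n : nat,
  T <= n%:R * lambda ->
  `|fine (renewal_fun W X (n%:R * lambda)) - lambda / (mu1 * (1 - rho))| <= e.
Proof.
move=> e0.
have unb (T : R) : exists t, L t /\ T <= t.
  exists ((Num.truncn (T / lambda)).+1%:R * lambda); split; first exact: L_nat.
  by rewrite -ler_pdivrMr// ltW// truncnS_gt.
have nu0 : 0 < mu1 / lambda by rewrite divr_gt0// mean_step_gt0.
have rho1 : 0 < 1 - rho by rewrite subr_gt0.
have mN (f : nat -> R) : measurable_fun setT f by [].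
have avg (e' : R) : 0 < e' -> exists T, forall t : R, L t -> T <= t ->
  (((1 - rho)^-1 - e')%:E <= \int[cnt]_o (renewal_kernel (t - r o) * 1)%:E <= ((1 - rho)^-1 + e')%:E)%E.
  (* The bound 0 excludes negative multiples of the span; the other one makes [rho ^+ n] at most
     [e' * (1 - rho)]. *)
  move=> e'0; exists (Num.max 0 (- ln (e' * (1 - rho)))) => t [n ->].
  rewrite ge_max pmulr_lge0// ler0z => /andP[n0 te].
  case: n n0 te => // n _; rewrite -pmulrn => te.
  rewrite kernel_lattice !lee_fin mulrBl mul1r.
  have rn : 0 <= rho ^+ n.+1 / (1 - rho) by rewrite divr_ge0 ?exprn_ge0 ?expR_ge0// ltW.
  suff : rho ^+ n.+1 / (1 - rho) <= e' by lra.
  rewrite ler_pdivrMr// exprSr -[leRHS]mulr1 ler_pM ?exprn_ge0 ?expR_ge0//; last exact: ltW.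
  have e1 : 0 < e' * (1 - rho) by rewrite mulr_gt0.
  by rewrite /rho -expRM_natl -(lnK e1) ler_expR; lra.
have [A HA] := Gamma_eventually.
pose N := (Num.truncn (A / lambda)).+1.
have AN : A <= N%:R * lambda by rewrite -ler_pdivrMr// ltW// truncnS_gt.
(* Closeness on the lattice is equality: the radius [lambda / 2] pins [u] to a single point, which
   serves from above and from below alike. *)
have dense (h : R) (j : nat) : 0 < h -> exists s rho' : R,
    [/\ 0 < rho', Gamma s & forall t u, L t -> L (t - u) -> `|u - s| <= rho' ->
      u = N%:R * lambda + r j].
  move=> h0; exists (N%:R * lambda + r j), (lambda / 2); split.
  - by rewrite divr_gt0.
  - apply: HA; first by apply: LD; exact: L_nat.
    by rewrite (le_trans AN)// lerDl mulr_ge0// ltW.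
  - move=> t u Lt Ltu us; apply: L_eq.
    + have -> : u = t - (t - u) by ring.
      by apply: LD => //; exact: LN.
    + by apply: LD; exact: L_nat.
    + by apply: (le_lt_trans us); rewrite ltr_pdivrMr// ltr_pMr// ltr1n.
have LAN t : L t -> L (t - N%:R * lambda) by move=> Lt; apply: LD => //; apply: LN; exact: L_nat.
have above (h : R) : 0 < h -> exists A,
  (forall t : R, L t -> L (t - A)) /\ forall o, 0 < (1 : R) -> exists s rho : R,
    [/\ 0 < rho, Gamma s & forall t u, L t -> L (t - u) -> `|u - s| <= rho ->
      A + r o <= u <= A + r o + h].
  move=> h0; exists (N%:R * lambda); split=> // o _.
  have [s [rho' [rho'0 Gs Hs]]] := dense h o h0; exists s, rho'; split=> // t u Lt Ltu us.
  by rewrite (Hs t u) //; lra.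
have below (h : R) : 0 < h -> exists A,
  (forall t : R, L t -> L (t - A)) /\ forall o, 0 < (1 : R) -> exists s rho : R,
    [/\ 0 < rho, Gamma s & forall t u, L t -> L (t - u) -> `|u - s| <= rho ->
      A + r o - h <= u <= A + r o].
  move=> h0; exists (N%:R * lambda); split=> // o _.
  have [s [rho' [rho'0 Gs Hs]]] := dense h o h0; exists s, rho'; split=> // t u Lt Ltu us.
  by rewrite (Hs t u) //; lra.
have [T HT] := @renewal_limit R _ Y W X c mX c_gt0 X_ge _
  nat (@counting nat R) r (fun=> 1) L (mu1 / lambda) (1 - rho)^-1 (mN _) (mN _) (fun=> ler01) unb L_step
  k_shift k_finite k_mass nu0 avg above below e e0.
exists T => n Tn; have := HT _ (L_nat n) Tn.
by rewrite [lambda / _](_ : _ = (1 - rho)^-1 / (mu1 / lambda))//; field; rewrite !gt_eqF ?mean_step_gt0.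
Qed.

(** The expectation of the exponential of S_k on S_k <= t depends only on the last lattice point
    before [t], since S_k lies in the lattice. *)
Lemma renewal_term_lattice k t t' : Num.floor (t / lambda) = Num.floor (t' / lambda) ->
  ((expR t)%:E * renewal_term W X k t = (expR t')%:E * renewal_term W X k t')%E.
Proof.
elim: k t t' => [|k ih] t t' ft /=.
  rewrite -!EFinM /renewal_kernel.
  have ge0 u : (0 <= u) = (0 <= Num.floor (u / lambda)).
    by rewrite floor_ge0 pmulr_lge0// invr_gt0.
  rewrite !ge0 ft.
  by case: ifPn; rewrite ?mulr0// -!expRD !subrr.
have Z u : ((expR u)%:E * \int[W]_y renewal_term W X k (u - X y)%R =
    \int[W]_y ((expR u)%:E * renewal_term W X k (u - X y)%R))%E.
  rewrite ge0_integralZl//.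
  - by apply: measurable_step => //; exact: measurable_renewal_term.
  - by move=> y _; exact: renewal_term_ge0.
rewrite !Z; apply: ge0_ae_eq_integral => //.
- by apply: measurable_funeM; apply: measurable_step => //; exact: measurable_renewal_term.
- by apply: measurable_funeM; apply: measurable_step => //; exact: measurable_renewal_term.
- by move=> y _; rewrite mule_ge0// ?renewal_term_ge0// lee_fin expR_ge0.
- by move=> y _; rewrite mule_ge0// ?renewal_term_ge0// lee_fin expR_ge0.
apply: filterS X_lattice => y [n [_ Xn]] _.
have E u : (expR u)%:E = ((expR (X y))%:E * (expR (u - X y))%:E)%E.
  by rewrite -EFinM -expRD; congr (_%:E); congr expR; lra.
rewrite (E t) (E t') -!muleA; congr (_ * _)%E; apply: ih.
have nint : - (n%:R : R) \is a Num.int by rewrite rpredN rpred_nat.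
by rewrite Xn !mulrBl mulfK ?gt_eqF// !floorDrz// ft.
Qed.

(** Between lattice points [U] decays exactly exponentially from its value at the point below; this
    factor is at most 1, so the error on the lattice is not amplified. *)
Theorem arithmetic_renewal (e : R) : 0 < e -> exists T, forall t, T <= t ->
  `|fine (renewal_fun W X t) -
    lambda / (mu1 * (1 - rho)) * expR (- (lambda * fractional_part (t / lambda)))| <= e.
Proof.
move=> e0; have [T HT] := arithmetic_renewal_lattice e0.
(* The extra [lambda] keeps the lattice point below [t] above [T]. *)
exists (Num.max 0 (T + lambda)) => t; rewrite ge_max => /andP[t0 tT].
have tl0 : 0 <= t / lambda by rewrite divr_ge0// ltW.
pose n := Num.truncn (t / lambda).
have tn : t < n.+1%:R * lambda by rewrite -ltr_pdivrMr//; exact: truncnS_gt.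
have fE : Num.floor (t / lambda) = n by apply: floor_def; rewrite -PoszD addn1 -!pmulrn trunc_itv.
have Tn : T <= n%:R * lambda by move: tn; rewrite -natr1 mulrDl mul1r; lra.
have fracE : lambda * fractional_part (t / lambda) = t - n%:R * lambda.
  by rewrite /fractional_part fE mulrBr mulrCA divff ?gt_eqF// mulr1 mulrC pmulrn.
have UE : fine (renewal_fun W X t) =
    expR (- (t - n%:R * lambda)) * fine (renewal_fun W X (n%:R * lambda)).
  have : ((expR t)%:E * renewal_fun W X t =
    (expR (n%:R * lambda))%:E * renewal_fun W X (n%:R * lambda))%E.
    rewrite -!nneseriesZl; try by move=> k _; exact: renewal_term_ge0.
    apply: eq_eseriesr => k _; apply: renewal_term_lattice.
    by rewrite fE mulfK ?gt_eqF// pmulrn intrKfloor.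
  have fin u : renewal_fun W X u \is a fin_num.
    rewrite ge0_fin_numE ?renewal_fun_ge0//.
    by apply: (le_lt_trans (renewal_fun_le W mX c_gt0 X_ge u)); rewrite ltry.
  move/(congr1 fine); rewrite !fineM//= => H.
  by rewrite opprB expRD mulrAC -H mulrAC -expRD subrr expR0 mul1r.
rewrite UE fracE [X in _ - X]mulrC -mulrBr normrM ger0_norm ?expR_ge0//.
apply: le_trans (HT n Tn); rewrite ler_piMl// expR_le1 oppr_le0 -fracE mulr_ge0 ?(ltW lambda_gt0)//.
by rewrite /fractional_part subr_ge0 floor_le.
Qed.
End arithmetic.

Let k (o : R) : R := (0 <= o)%R%:R.

Let mk : measurable_fun setT k.
Proof.
rewrite (_ : k = \1_[set o : R | 0 <= o]); last by apply/funext => o; rewrite indic_pred.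
by apply: measurable_indic; rewrite -[X in measurable X]setTI; exact: measurable_fun_ler.
Qed.

Lemma nonarithmetic_kernel_average (t : R) : 0 < t ->
  (\int[leb]_o (renewal_kernel (t - o) * k o)%:E = (1 - expR (- t))%:E)%E.
Proof.
move=> t0.
transitivity (\int[leb]_(o in `[0%R, t]) (expR (o - t))%:E)%E.
  rewrite [RHS]integral_mkcond; apply: eq_integral => o _.
  rewrite /renewal_kernel /k patchE mem_setE in_itv/= subr_ge0 opprB.
  by case: (0 <= o)%R; case: (o <= t)%R; rewrite ?mulr1 ?mulr0 ?mul0r.
have dF x : is_derive (x : R) 1 (fun o => expR (o - t)) (expR (x - t)).
  by apply: is_derive_eq; rewrite subr0 mulr1.
rewrite (@continuous_FTC2 _ (fun o => expR (o - t)) (fun o => expR (o - t)) 0 t)//.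
- by rewrite subrr expR0 sub0r.
- apply: continuous_subspaceT => x; apply: continuous_comp; last exact: continuous_expR.
  by apply: continuousB => //; exact: cst_continuous.
- split.
  + move=> x _; exact: ex_derive.
  + apply: cvg_at_right_filter; apply: continuous_comp; last exact: continuous_expR.
    by apply: continuousB => //; exact: cst_continuous.
  + apply: cvg_at_left_filter; apply: continuous_comp; last exact: continuous_expR.
    by apply: continuousB => //; exact: cst_continuous.
- by move=> x _; rewrite derive1E (derive_val (df := expR (x - t))).
Qed.

Hypothesis nonarith : forall lambda : R, 0 < lambda ->
  ~ {ae W, forall w, exists n : nat, (0 < n)%N /\ X w = n%:R * lambda}.

(** The lattice alternative of the dichotomy would place almost every step in a lattice, against
    [nonarith]. *)
Let Gamma_dense (h : R) : 0 < h -> exists A, forall a, A <= a ->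
  exists u, [/\ Gamma u, a - h < u & u <= a].
Proof.
move=> h0.
have G0 : Gamma !=set0 by have [w Gw] := ae_nonempty ae_Gamma; exists (X w).
have [small|[lambda [l0 _ Gl]]] := semigroup_dichotomy (@additive_closureD _ _) Gamma_gt0 G0.
  have [s [t [Gs Gt st0 sth]]] := small h h0.
  have [A HA] := semigroup_eventually_dense (@additive_closureD _ _) Gs Gt (Gamma_gt0 Gt) st0.
  exists A => a /HA[u [Gu u1 u2]]; exists u; split=> //; lra.
exfalso; apply: (nonarith l0); apply: filterS ae_Gamma => w; exact: Gl.
Qed.

(** The reference measure is Lebesgue measure on the half line and [L] is everything; the kernel has
    mass 1 and the step tail has mass [mu1]. *)
Theorem nonarithmetic_renewal (e : R) : 0 < e ->
  exists T, forall t, T <= t -> `|fine (renewal_fun W X t) - mu1^-1| <= e.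
Proof.
move=> e0.
have k_ge0 o : 0 <= k o by rewrite ler0n.
have unb (T : R) : exists t, setT t /\ T <= t by exists T.
have step (t : R) : setT t -> {ae W, forall w, setT (t - X w)} by move=> _; exact: aeW.
have shift : {ae W, forall w, forall f : R -> \bar R,
    measurable_fun setT f -> (forall x, 0 <= f x)%E ->
    (\int[leb]_o (f (X w + o)%R * (k o)%:E) =
     \int[leb]_o (f o * (k o * (X w <= o)%R%:R)%:E))%E}.
  apply: aeW => w f mf f0.
  have Xw0 : 0 <= X w by apply: le_trans (X_ge w); exact: ltW.
  rewrite -(ge0_integral_affine (X w) ltr01 (f := fun o => (f o * (k o * (X w <= o)%R%:R)%:E)%E)).
  - rewrite mul1e; apply: eq_integral => o _; rewrite mul1r addrC /k lerDr.
    by case: (leP 0 o) => o0; rewrite ?mulr0 ?mulr1// addr_ge0.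
  - apply: emeasurable_funM => //; apply/measurable_EFinP; apply: measurable_funM => //.
    rewrite (_ : (fun o => _) = \1_[set o : R | X w <= o]); last by apply/funext => o; rewrite indic_pred.
    by apply: measurable_indic; rewrite -[X in measurable X]setTI; exact: measurable_fun_ler.
  - by move=> o; rewrite mule_ge0// lee_fin mulr_ge0.
have fin (t : R) : (\int[leb]_o (k o * (o <= t)%R%:R)%:E < +oo)%E.
  apply: (@le_lt_trans _ _ (\int[leb]_o (\1_(`[0%R, t]%classic : set R) o)%:E)%E); last first.
    rewrite integral_indic ?setIT//.
    suff : (lebesgue_measure `[0%R, t]%classic < +oo)%E by [].
    by rewrite lebesgue_measure_itv/=; case: ifP => _; rewrite ?ltry.
  rewrite le_eqVlt; apply/orP; left; apply/eqP; apply: eq_integral.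
  move=> o _; rewrite indicE mem_setE in_itv/= /k.
  by case: (0 <= o); case: (o <= t); rewrite ?mulr1 ?mulr0.
have mass : (\int[leb]_o ((k o)%:E * W [set w | (o < X w)%R]) = mu1%:E)%E.
  pose F (p : R * Y) := (k p.1 * (p.1 < X p.2)%R%:R)%:E.
  have mF : measurable_fun setT F.
    apply/measurable_EFinP; apply: measurable_funM.
      exact: (measurableT_comp mk measurable_fst).
    rewrite (_ : (fun p => _) = \1_[set p : R * Y | p.1 < X p.2]); last by apply/funext => o; rewrite (indic_pred R (fun p => p.1 < X p.2)).
    apply: measurable_indic; rewrite -[X in measurable X]setTI; apply: measurable_fun_ltr => //.
    exact: (measurableT_comp mX measurable_snd).
  have F0 p : (0 <= F p)%E by rewrite lee_fin mulr_ge0.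
  transitivity (\int[leb]_o \int[W]_w F (o, w))%E.
    apply: eq_integral => o _; rewrite /F/=.
    under [RHS]eq_integral do rewrite EFinM -(indic_pred R (fun w => o < X w)).
    have mo : measurable [set w | o < X w].
      by rewrite -[X in measurable X]setTI; exact: measurable_fun_ltr.
    rewrite ge0_integralZl_EFin ?integral_indic ?setIT//.
    by apply/measurable_EFinP; exact: measurable_indic.
  rewrite (fubini_tonelli (m1 := leb) (m2 := W) _ mF F0) -X_mean.
  apply: eq_integral => w _; rewrite /F/=.
  transitivity (\int[leb]_o (\1_(`[0%R, X w[%classic : set R) o)%:E)%E; last first.
    rewrite integral_indic ?setIT//.
    suff : lebesgue_measure `[0%R, X w[%classic = (X w)%:E by [].
    rewrite lebesgue_measure_itv/= lte_fin ifT ?sube0//.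
    exact: lt_le_trans (X_ge w).
  apply: eq_integral => o _; rewrite indicE mem_setE in_itv/= /k.
  by case: (0 <= o); case: (o < X w); rewrite ?mulr1 ?mulr0.
have avg (e' : R) : 0 < e' -> exists T, forall t : R, setT t -> T <= t ->
  ((1 - e')%:E <= \int[leb]_o (renewal_kernel (t - o) * k o)%:E <= (1 + e')%:E)%E.
  move=> e'0; exists (Num.max 1 (- ln e')) => t _; rewrite ge_max => /andP[t1 te].
  rewrite nonarithmetic_kernel_average ?(lt_le_trans ltr01)// !lee_fin.
  have : expR (- t) <= e' by rewrite -(lnK e'0) ler_expR; lra.
  have := expR_gt0 (- t); lra.
have dense_mid (a h : R) : 0 < h -> exists A, forall o, 0 < k o ->
    exists s rho : R, [/\ 0 < rho, Gamma s & forall u, `|u - s| <= rho ->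
      A + o + a <= u <= A + o + a + h].
  move=> h0; have [A HA] := @Gamma_dense (h / 2) ltac:(lra).
  exists (A - a) => o; rewrite /k; case: (leP 0 o) => o0; last by rewrite ltxx.
  move=> _.
  (* A window of length [h / 2] ending at [3 * h / 4] leaves [h / 4] on each side for the radius. *)
  have [|s [Gs s1 s2]] := HA (A + o + 3 * h / 4); first by lra.
  exists s, (h / 4); split => //; first by lra.
  by move=> u; rewrite ler_norml; lra.
have above (h : R) : 0 < h -> exists A,
  (forall t : R, setT t -> setT (t - A)) /\ forall o, 0 < k o -> exists s rho : R,
    [/\ 0 < rho, Gamma s & forall t u, setT t -> setT (t - u) -> `|u - s| <= rho ->
      A + o <= u <= A + o + h].
  move=> /(dense_mid 0 _)[A HA]; exists A; split=> // o /HA[s [rho [rho0 Gs HH]]].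
  by exists s, rho; split=> // t u _ _ /HH; rewrite addr0.
have below (h : R) : 0 < h -> exists A,
  (forall t : R, setT t -> setT (t - A)) /\ forall o, 0 < k o -> exists s rho : R,
    [/\ 0 < rho, Gamma s & forall t u, setT t -> setT (t - u) -> `|u - s| <= rho ->
      A + o - h <= u <= A + o].
  move=> h0; have [A HA] := dense_mid (- h) _ h0; exists A; split=> // o /HA[s [rho [rho0 Gs HH]]].
  by exists s, rho; split=> // t u _ _ /HH; rewrite subrK.
have [T HT] := @renewal_limit R _ Y W X c mX c_gt0 X_ge _
  (measurableTypeR R) leb idfun k setT mu1 1 (@measurable_id _ _ _) mk k_ge0 unb step
  shift fin mass mean_step_gt0 avg above below e e0.
by exists T => t Tt; have := HT t I Tt; rewrite div1r.
Qed.

End renewal_limits.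

(** * Expected level sizes of the splitting tree *)

Section multinomial_marginal.
Context (R : realType).

(** The exponential series, truncated so that generating functions stay polynomials; coefficients
    below [N] do not see the truncation. *)
Let exp_poly (N : nat) (a : R) : {poly R} := \poly_(k < N) (a ^+ k / k`!%:R).

Let coef_exp_poly N a k : (exp_poly N a)`_k = if (k < N)%N then a ^+ k / k`!%:R else 0.
Proof. by rewrite coef_poly. Qed.

Lemma exp_term_conv (a b : R) j :
  \sum_(i < j.+1) a ^+ i / i`!%:R * (b ^+ (j - i) / (j - i)`!%:R) = (a + b) ^+ j / j`!%:R.
Proof.
rewrite addrC exprDn big_distrl/=; apply: eq_bigr => i _.
have ij : (i <= j)%N by rewrite -ltnS.
have := bin_fact ij => /(congr1 (fun n => n%:R : R)); rewrite !natrM => <-.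
rewrite -mulr_natl; field.
by rewrite !pnatr_eq0 -!lt0n !fact_gt0 bin_gt0 ij.
Qed.

Let coef_prod_exp_poly (I : eqType) (s : seq I) (P : pred I) (v : I -> R) N j : (j < N)%N ->
  (\prod_(i <- s | P i) exp_poly N (v i))`_j = (\sum_(i <- s | P i) v i) ^+ j / j`!%:R.
Proof.
elim: s j => [|i s ih] j jN.
  by rewrite !big_nil coef1 expr0n; case: j jN => [|j] _ /=; rewrite ?divr1 ?mul0r.
rewrite !big_cons; case: ifPn => Pi; last exact: ih.
rewrite coefM -exp_term_conv; apply: eq_bigr => k _.
have kj : (k <= j)%N by rewrite -ltnS.
by rewrite coef_exp_poly (leq_ltn_trans kj jN) ih// (leq_ltn_trans (leq_subr _ _) jN).
Qed.

(** Up to [n!], the sum is the coefficient of ['X^n] in a product of exponential generating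
    functions. Prescribing the [i]-th count reduces the [i]-th factor to one monomial, while the
    others combine into the exponential series of [1 - tnth v i]. *)
Lemma multinomial_marginal l n (v : l.-tuple R) (i : 'I_l) j :
  \sum_(x < l) tnth v x = 1 ->
  \sum_(f : {ffun 'I_l -> 'I_n.+1} | f i == j :> nat)
    multinomial_pmf n v [tuple (f x : nat) | x < l] = binomial_pmf n (tnth v i) j.
Proof.
move=> v1.
pose c x (k : 'I_n.+1) : R := tnth v x ^+ k / k`!%:R * (if x == i then (k == j :> nat)%:R else 1).
pose p : {poly R} := \prod_x \sum_(k < n.+1) (c x k) *: 'X^k.
have pE : p`_n = \sum_(f : {ffun 'I_l -> 'I_n.+1}) (\sum_x (f x : nat) == n)%N%:R * \prod_x c x (f x).
  rewrite /p bigA_distr_bigA coef_sum; apply: eq_bigr => f _.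
  rewrite (eq_bigr (fun x => (c x (f x))%:P * 'X^(f x))); last by move=> x _; rewrite mul_polyC.
  rewrite big_split/= -rmorph_prod/= -expr_sum coefCM coefXn mulrC.
  by rewrite eq_sym.
transitivity (n`!%:R * p`_n).
  rewrite pE big_distrr/= big_mkcond/=; apply: eq_bigr => f _.
  have -> : multinomial_pmf n v [tuple (f x : nat) | x < l] =
      if (\sum_(x < l) (f x : nat) == n)%N then
        n`!%:R / (\prod_(x < l) (f x)`!)%:R * \prod_(x < l) tnth v x ^+ f x else 0.
    rewrite /multinomial_pmf; congr (if _ == _ then _ / (_)%:R * _ else _);
      by apply: eq_bigr => x _; rewrite tnth_mktuple.
  have -> : \prod_x c x (f x) = (\prod_(x < l) tnth v x ^+ f x) /
      (\prod_(x < l) (f x)`!)%:R * (f i == j :> nat)%:R.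
    rewrite /c big_split/= [X in _ * X](bigD1 i)//= eqxx.
    rewrite [X in _ * (_ * X)]big1 ?mulr1; last by move=> x /negbTE ->.
    by rewrite big_split/= natr_prod prodfV.
  case: (f i == j :> nat); case: (_ == n)%N; rewrite ?mul0r ?mulr0// mulr1 mul1r.
  by rewrite mulrCA mulrA mulrC mulrA.
have cE x : x != i -> \sum_(k < n.+1) c x k *: 'X^k = exp_poly n.+1 (tnth v x).
  by move=> /negbTE xi; rewrite /exp_poly poly_def; apply: eq_bigr => k _; rewrite /c xi mulr1.
have ci : \sum_(k < n.+1) c i k *: 'X^k =
    if (j <= n)%N then (tnth v i ^+ j / j`!%:R) *: 'X^j else 0.
  have c0 (k : 'I_n.+1) : k != j :> nat -> c i k *: 'X^k = 0.
    by move=> /negbTE kj; rewrite /c eqxx kj mulr0 scale0r.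
  case: leqP => [jn|nj].
    rewrite (bigD1 (Ordinal (jn : (j < n.+1)%N)))//= big1 ?addr0.
      by rewrite /c !eqxx/= mulr1.
    move=> k kj; apply: c0; apply: contra kj => /eqP kj.
    by apply/eqP/val_inj.
  rewrite big1// => k _; apply: c0.
  by rewrite neq_ltn (leq_trans _ nj)// ltnS -ltnS.
rewrite /p (bigD1 i)//= (eq_bigr _ cE) ci.
case: leqP => [jn|nj]; last by rewrite mul0r coef0 mulr0 /binomial_pmf bin_small.
rewrite -scalerAl coefZ coefXnM ltnNge jn /= coef_prod_exp_poly ?ltnS ?leq_subr//.
have -> : \sum_(x < l | x != i) tnth v x = 1 - tnth v i.
  by apply/eqP; rewrite eq_sym subr_eq -v1 [X in X == _](bigD1 i)//= addrC.
rewrite /binomial_pmf -(bin_fact jn) !natrM -mulr_natl /unstable.onem; field.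
by rewrite !pnatr_eq0 -!lt0n !fact_gt0.
Qed.

End multinomial_marginal.

Section measure_partition.
Context d (T : measurableType d) (R : realType) (mu : {measure set T -> \bar R}).
Local Open Scope ereal_scope.

Lemma measure_partition_nat (g : T -> nat) (B : set T) : measurable B ->
  (forall n, measurable [set w | g w = n]) ->
  mu B = \sum_(n <oo) mu (B `&` [set w | g w = n]).
Proof.
move=> mB mg; rewrite {1}(_ : B = \bigcup_n (B `&` [set w | g w = n])); last first.
  apply/seteqP; split=> [w Bw|w [n _ []//]]; by exists (g w).
rewrite measure_bigcup//.
- by apply: eq_eseriesl => n; rewrite in_setT.
- by move=> n _; exact: measurableI.
- by move=> i j _ _ [w [[_ wi] [_ wj]]]; rewrite -wi -wj.
Qed.

Lemma sum_measure_le (I : choiceType) (s : seq I) (B : I -> set T) (E : set T) :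
  uniq s -> (forall i, measurable (B i)) -> trivIset setT B -> measurable E ->
  (forall i, i \in s -> B i `<=` E) -> \sum_(i <- s) mu (B i) <= mu E.
Proof.
move=> us mB tB mE BE; rewrite (fsbig_seq _ _ us) -measure_fin_bigcup//.
- apply: le_measure; rewrite ?inE//; last by move=> w [i /= si Bw]; exact: (BE i si).
  by apply: fin_bigcup_measurable => // i _.
- exact: sub_trivIset tB.
Qed.

End measure_partition.

(** Upgrades lower bounds on probabilities to equalities by comparing total masses. *)
Lemma nneseries_eq_le (R : realType) (x y : nat -> \bar R) (c : R) :
  (forall n, 0 <= y n)%E -> (forall n, y n <= x n)%E ->
  (\sum_(n <oo) x n = c%:E)%E -> (\sum_(n <oo) y n = c%:E)%E -> x =1 y.
Proof.
move=> y0 yx xc yc n.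
have x0 k : (0 <= x k)%E by exact: le_trans (yx k).
apply/eqP; rewrite eq_le yx andbT.
move: xc yc; rewrite (nneseriesD1 (n := n))// (nneseriesD1 (f := y) (n := n))//.
set sx := (\sum_(_ <oo | _) x _)%E; set sy := (\sum_(_ <oo | _) y _)%E.
have sxy : (sy <= sx)%E by apply: lee_nneseries.
have sy0 : (0 <= sy)%E by apply: nneseries_ge0.
move: (yx n) (y0 n) sxy sy0.
case: (x n) => [a| |]; case: sx => [a'| |] //=; case: (y n) => [b| |]; case: sy => [b'| |] //=.
by rewrite !lee_fin => ? ? ? ? [?] [?]; lra.
Qed.

(** * Law of one split *)

Section splitting_node.
Context d (T : measurableType d) (R : realType) (P : probability T R).
Context (X : splitting_data P) (D : nat).
Context d' (T' : measurableType d') (Q : probability T' R).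
Variable S : splitting_algorithm X D Q.
Local Open Scope ereal_scope.

Definition degree_prob l := P (degree X @^-1` [set l]).

(* Probability, for a node with [n] items, of having [l] children the [i]-th
   of which receives [j] items. *)
Definition transition_prob (l i n j : nat) : \bar R :=
  degree_prob l * \int[P]_w (binomial_pmf n (nth 0%R (weights X l w) i) j)%:E.

Definition node_sigma (u : node) := <<s preimage_set_system setT (node_degree S u) measurable `|`
        \bigcup_l preimage_set_system setT (node_weights S u l) measurable `|`
        \bigcup_m \bigcup_l
          preimage_set_system setT (node_counts S u m l) measurable >>.

Definition split_event (u : node) (n l i j : nat) : set T' :=
  [set w | node_degree S u w = l /\ nth 0%N (node_counts S u n l w) i = j].

Lemma node_sigma_degree u l : node_sigma u [set w | node_degree S u w = l].
Proof.
apply: sub_sigma_algebra; left; left; exists [set l] => //.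
by rewrite setTI.
Qed.

Lemma node_sigma_count u n l i j : (i < l)%N ->
  node_sigma u [set w | nth 0%N (node_counts S u n l w) i = j].
Proof.
move=> il; apply: sub_sigma_algebra; right; exists n => //; exists l => //.
exists ((@tnth l nat ^~ (Ordinal il)) @^-1` [set j]).
  by rewrite -[_ @^-1` _]setTI; exact: (measurable_tnth (T := nat)).
by rewrite setTI; apply/seteqP; split => w /=; rewrite (tnth_nth 0%N).
Qed.

Lemma node_sigma_measurable u A : node_sigma u A -> measurable A.
Proof.
apply: smallest_sub; first exact: sigma_algebra_measurable.
move=> B [[[C mC <-]|[l _ [C mC <-]]]|[m _ [l _ [C mC <-]]]];
  exact: measurable_funPT.
Qed.

Lemma node_sigma_split u n l i j : (i < l)%N -> node_sigma u (split_event u n l i j).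
Proof.
move=> il; have := @measurableI _ (g_sigma_algebraType (preimage_set_system setT (node_degree S u) measurable `|`
        \bigcup_l preimage_set_system setT (node_weights S u l) measurable `|`
        \bigcup_m \bigcup_l
          preimage_set_system setT (node_counts S u m l) measurable)).
move=> /(_ _ _ (@node_sigma_degree u l) (@node_sigma_count u n l i j il)); exact.
Qed.

Lemma measurable_degree_eq u l : measurable [set w | node_degree S u w = l].
Proof. exact: node_sigma_measurable (@node_sigma_degree u l). Qed.

Lemma measurable_count_eq u n l i j : (i < l)%N ->
  measurable [set w | nth 0%N (node_counts S u n l w) i = j].
Proof. by move=> il; exact: node_sigma_measurable (@node_sigma_count u n l i j il). Qed.

Lemma measurable_split u n l i j : (i < l)%N -> measurable (split_event u n l i j).
Proof. by move=> il; exact: node_sigma_measurable (@node_sigma_split u n l i j il). Qed.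

Lemma degree_prob_ge0 l : 0 <= degree_prob l. Proof. exact: measure_ge0. Qed.

Lemma degree_prob_fin l : degree_prob l \is a fin_num.
Proof. by rewrite fin_num_measure// -[_ @^-1` _]setTI; exact: measurable_funPT. Qed.

Lemma weight_itv l w i : (2 <= l)%N -> (0 <= nth 0%R (weights X l w) i <= 1)%R.
Proof.
move=> l2; have [v0 v1] := weights_simplex X w l2.
have [il|li] := ltnP i l; last by rewrite nth_default ?size_tuple// lexx ler01.
have := v0 (Ordinal il); rewrite (tnth_nth 0%R)/= => ->/=.
rewrite -v1 (bigD1 (Ordinal il))//= (tnth_nth 0%R)/= lerDl.
by apply: sumr_ge0 => x _.
Qed.

Lemma measurable_weight l i : measurable_fun setT (fun w => nth 0%R (weights X l w) i).
Proof.
have [il|li] := ltnP i l; last first.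
  rewrite (_ : (fun w => _) = cst 0%R)//.
  by apply/funext => w; rewrite nth_default ?size_tuple.
rewrite (_ : (fun w => _) = (fun w => tnth (weights X l w) (Ordinal il))).
  apply: (measurableT_comp (measurable_tnth (Ordinal il))).
  exact: measurable_funPT.
by apply/funext => w; rewrite (tnth_nth 0%R).
Qed.

Lemma transition_prob_ge0 l i n j : (2 <= l)%N -> 0 <= transition_prob l i n j.
Proof.
move=> l2; rewrite mule_ge0 ?degree_prob_ge0//; apply: integral_ge0 => w _.
by rewrite lee_fin binomial_pmf_ge0// weight_itv.
Qed.

Lemma binomial_pmf_gt n (p : R) j : (n < j)%N -> binomial_pmf n p j = 0%R.
Proof. by move=> nj; rewrite /binomial_pmf bin_small. Qed.

Lemma sum_binomial_pmf n (p : R) : (\sum_(j < n.+1) binomial_pmf n p j = 1)%R.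
Proof.
rewrite -(expr1n R n) -[in RHS](subrK p 1%R) exprDn.
by apply: eq_bigr => j _; rewrite /binomial_pmf mulrC.
Qed.

Lemma sum_transition_prob l i n : (2 <= l)%N ->
  \sum_(j <oo) transition_prob l i n j = degree_prob l.
Proof.
move=> l2; rewrite (nneseries_split 0 n.+1); last by move=> j _; exact: transition_prob_ge0.
rewrite add0n [X in _ + X]eseries0 ?adde0; last first.
  move=> j nj _; rewrite /transition_prob integral0_eq ?mule0// => w _.
  by rewrite binomial_pmf_gt.
rewrite big_mkord -ge0_sume_distrr; last first.
  by move=> j _; apply: integral_ge0 => w _; rewrite lee_fin binomial_pmf_ge0// weight_itv.
rewrite -ge0_integral_sum//; last 2 first.
- by move=> j; apply/measurable_EFinP;
    exact: (measurableT_comp (@measurable_binomial_pmf R setT n j) (@measurable_weight l i)).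
- by move=> j w _; rewrite lee_fin binomial_pmf_ge0// weight_itv.
rewrite (eq_integral (cst 1%E)); last by move=> w _; rewrite sumEFin sum_binomial_pmf.
by rewrite integral_cst_probability mule1.
Qed.

Lemma sum_degree_prob : \sum_(l <oo) degree_prob l = 1.
Proof.
rewrite -(@probability_setT _ _ _ P) (measure_partition_nat P (g := degree X))//.
  by apply: eq_eseriesr => l _; rewrite setTI.
move=> l; rewrite -[X in measurable X]setTI.
exact: (@measurable_funPT _ _ _ _ (degree X) measurableT [set l]).
Qed.

Lemma degree_prob_lt2 l : (l < 2)%N -> degree_prob l = 0.
Proof.
move=> l2; rewrite /degree_prob (_ : _ @^-1` _ = set0) ?measure0//.
rewrite -subset0 => w /= wl; have := degree_ge2 X w.
by rewrite wl leqNgt l2.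
Qed.

(** Only count vectors with entries at most [n] are summed, and no other vector has been excluded at
    this point; this gives a lower bound, which total masses later turn into an equality. *)
Lemma split_event_ge u n l i j : (D <= n)%N -> (2 <= l)%N -> (i < l)%N ->
  transition_prob l i n j <= Q (split_event u n l i j).
Proof.
move=> Dn l2 il.
pose F := {ffun 'I_l -> 'I_n.+1}.
pose tup (f : F) : l.-tuple nat := [tuple (f x : nat) | x < l].
pose B (f : F) := [set w | [/\ node_degree S u w = l, setT (node_weights S u l w) &
                   node_counts S u n l w = tup f]].
have BE f : B f = [set w | node_degree S u w = l] `&`
    \bigcap_(x in `I_l) [set w | nth 0%N (node_counts S u n l w) x = nth 0%N (tup f) x].
  apply/seteqP; split=> w /=.
    by move=> [wl _ wf]; split=> // x _ /=; rewrite wf.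
  move=> [wl H]; split=> //; apply/val_inj/(@eq_from_nth _ 0%N).
    by rewrite !size_tuple.
  by move=> x; rewrite size_tuple; exact: H.
have mB f : measurable (B f).
  rewrite BE; apply: measurableI; first exact: measurable_degree_eq.
  apply: fin_bigcap_measurable => // x xl; exact: measurable_count_eq.
have QB f : Q (B f) = degree_prob l * \int[P]_w (multinomial_pmf n (weights X l w) (tup f))%:E.
  by rewrite (node_law S u _ Dn l2 measurableT) preimage_setT.
have mf_ge0 f w : (0 <= multinomial_pmf n (weights X l w) (tup f))%R.
  have [v0 _] := weights_simplex X w l2.
  rewrite /multinomial_pmf; case: ifPn => // _.
  by apply: mulr_ge0; [rewrite divr_ge0|apply: prodr_ge0 => x _; rewrite exprn_ge0].
have mmf f : measurable_fun setT (fun w => (multinomial_pmf n (weights X l w) (tup f))%:E).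
  apply/measurable_EFinP; rewrite /multinomial_pmf.
  case: (\sum_(x < l) tnth (tup f) x == n)%N => //.
  apply: measurable_funM => //; apply: measurable_prod => x _.
  apply: measurable_funX; apply: (measurableT_comp (measurable_tnth x)).
  exact: measurable_funPT.
have sumB : \sum_(f <- seq.filter (fun f : F => f (Ordinal il) == j :> nat) (enum {: F})) Q (B f) <=
    Q (split_event u n l i j).
  apply: sum_measure_le => //.
  - by rewrite filter_uniq// enum_uniq.
  - move=> f g _ _ [w [[_ _ wf] [_ _ wg]]]; apply/ffunP => x; apply/val_inj => /=.
    have := congr1 (fun t => tnth t x) wf; rewrite wg /tup !tnth_mktuple; exact.
  - exact: measurable_split.
  - move=> f; rewrite mem_filter => /andP[/eqP fj _] w [wl _ wf]; split=> //.
    by rewrite wf -fj -(tnth_nth 0%N (tup f) (Ordinal il)) tnth_mktuple.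
apply: le_trans sumB.
rewrite (eq_bigr _ (fun f _ => QB f)) -ge0_sume_distrr; last first.
  by move=> f _; apply: integral_ge0 => w _; rewrite lee_fin.
rewrite -ge0_integral_sum//; last by move=> f w _; rewrite lee_fin.
rewrite lee_pmul// ?degree_prob_ge0//.
  by apply: integral_ge0 => w _; rewrite lee_fin binomial_pmf_ge0// weight_itv.
rewrite le_eqVlt; apply/orP; left; apply/eqP; apply: eq_integral => w _.
have [_ v1] := weights_simplex X w l2.
rewrite sumEFin big_filter big_enum_cond/=.
have := multinomial_marginal n (Ordinal il) j v1.
by rewrite (tnth_nth 0%R) => ->.
Qed.


Lemma sum_split_event_le u n l i : (i < l)%N ->
  \sum_(j <oo) Q (split_event u n l i j) = Q [set w | node_degree S u w = l].
Proof.
move=> il; rewrite (measure_partition_nat Q (g := fun w => nth 0%N (node_counts S u n l w) i))//.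
- exact: measurable_degree_eq.
- by move=> j; exact: measurable_count_eq.
Qed.

(** [node_law] never mentions the degree alone. Summing over the count of the first child bounds its
    law from below, and both laws have total mass 1. *)
Lemma node_degree_prob u l : Q [set w | node_degree S u w = l] = degree_prob l.
Proof.
move: l; apply: (@nneseries_eq_le R _ _ 1%R); first exact: degree_prob_ge0.
- move=> l; have [l2|l2] := ltnP l 2; first by rewrite degree_prob_lt2.
  have l0 : (0 < l)%N by exact: leq_trans l2.
  rewrite -(sum_split_event_le u D l0) -(sum_transition_prob 0 D l2).
  apply: lee_nneseries => [j _ _|j _]; first exact: transition_prob_ge0.
  exact: split_event_ge.
- rewrite -(@probability_setT _ _ _ Q) (measure_partition_nat Q (g := node_degree S u))//.
    by apply: eq_eseriesr => l _; rewrite setTI.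
  by move=> l; exact: measurable_degree_eq.
- exact: sum_degree_prob.
Qed.

Lemma split_event_prob u n l i j : (D <= n)%N -> (i < l)%N -> (2 <= l)%N ->
  Q (split_event u n l i j) = transition_prob l i n j.
Proof.
move=> Dn il l2; move: j; apply: (@nneseries_eq_le R _ _ (fine (degree_prob l))).
- by move=> j; exact: transition_prob_ge0.
- by move=> j; exact: split_event_ge.
- by rewrite sum_split_event_le// node_degree_prob fineK// degree_prob_fin.
- by rewrite sum_transition_prob// fineK// degree_prob_fin.
Qed.

Lemma split_event_prob_lt2 u n l i j : (i < l)%N -> (l < 2)%N ->
  Q (split_event u n l i j) = 0.
Proof.
move=> il l2; apply/le_anti; rewrite measure_ge0 andbT.
rewrite -(degree_prob_lt2 l2) -(node_degree_prob u) le_measure ?inE//.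
- exact: measurable_split.
- exact: measurable_degree_eq.
- by move=> w [].
Qed.

End splitting_node.

(** * Probability that an address belongs to the tree *)

Section path_probability.
Context d (T : measurableType d) (R : realType) (P : probability T R).
Context (X : splitting_data P) (D : nat).
Context d' (T' : measurableType d') (Q : probability T' R).
Variable S : splitting_algorithm X D Q.
Local Open Scope ereal_scope.

Fixpoint path_prob (p : seq nat) (n : nat) : \bar R :=
  if p is i :: p' then
    if (D <= n)%N then
      \sum_(l <oo | (2 <= l)%N && (i < l)%N)
        \sum_(j <oo) transition_prob X l i n j * path_prob p' j
    else 0
  else 1.

Definition reaches (u : node) (n : nat) (p : seq nat) : set T' :=
  [set w | items_along S w u n p != None].

Lemma path_prob_ge0 p n : 0 <= path_prob p n.
Proof.
elim: p n => [|i p ih] n //=; case: ifPn => // _.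
apply: nneseries_ge0 => l _ /andP[l2 _]; apply: nneseries_ge0 => j _ _.
by rewrite mule_ge0// transition_prob_ge0.
Qed.

Lemma reaches_small u n i p : (n < D)%N -> reaches u n (i :: p) = set0.
Proof.
by move=> nD; rewrite -subset0 => w; rewrite /reaches/= leqNgt nD.
Qed.

Lemma reaches_split u n i p l j : (D <= n)%N -> (i < l)%N ->
  reaches u n (i :: p) `&` split_event S u n l i j =
  split_event S u n l i j `&` reaches (rcons u i) j p.
Proof.
move=> Dn il; apply/seteqP; split=> w.
  by move=> [+ [wl wj]]; rewrite /reaches/= wl Dn il/= wj => H; split.
by move=> [[wl wj] H]; split=> //; rewrite /reaches/= wl Dn il/= wj.
Qed.

Lemma reaches_degree u n i p l : (l <= i)%N ->
  reaches u n (i :: p) `&` [set w | node_degree S u w = l] = set0.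
Proof.
move=> li; rewrite -subset0 => w [+ wl]; rewrite /reaches/= wl (ltnNge i) li andbF.
by rewrite eqxx.
Qed.

Lemma measurable_reaches u n p : measurable (reaches u n p).
Proof.
elim: p u n => [|i p ih] u n.
  by rewrite (_ : reaches _ _ _ = setT)//; apply/seteqP; split.
have [nD|Dn] := ltnP n D; first by rewrite reaches_small.
rewrite (_ : reaches _ _ _ = \bigcup_(l in [set l | (i < l)%N]) \bigcup_j
    (split_event S u n l i j `&` reaches (rcons u i) j p)).
  apply: bigcup_measurable => l /= il; apply: bigcup_measurable => j _.
  by apply: measurableI => //; exact: measurable_split.
apply/seteqP; split=> w.
  move=> H; have il : (i < node_degree S u w)%N.
    rewrite ltnNge; apply/negP => li.
    by have := reaches_degree u n p li; rewrite -subset0 => /(_ w (conj H erefl)).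
  exists (node_degree S u w) => //; exists (nth 0%N (node_counts S u n (node_degree S u w) w) i) => //.
  by rewrite -reaches_split//; split.
move=> [l /= il [j _]]; rewrite -reaches_split//.
by case.
Qed.

(* The ancestors' events are carried along so that the mutual independence of
   the blocks attached to distinct nodes applies at the end of the path. *)
Lemma ancestors_reaches p u n (s : seq node) (A : node -> set T') : uniq s ->
  (forall v, v \in s -> (size v < size u)%N) ->
  (forall v, v \in s -> node_sigma S v (A v)) ->
  Q (\big[setI/setT]_(v <- s) A v `&` reaches u n p) =
  (\prod_(v <- s) Q (A v)) * path_prob p n.
Proof.
elim: p u n s A => [|i p ih] u n s A us su sA.
  rewrite (_ : reaches _ _ _ = setT); last by apply/seteqP; split.
  by rewrite setIT mule1; exact: (@node_independence _ _ _ _ _ _ _ _ _ S s A us sA).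
rewrite /=; case: (leqP D n) => [Dn|nD]; last by rewrite reaches_small// setI0 measure0 mule0.
set B := \big[setI/setT]_(v <- s) A v.
have mB : measurable B.
  rewrite /B big_seq; apply: bigsetI_measurable => v vs.
  by apply: (@node_sigma_measurable _ _ _ _ _ _ _ _ _ S v); exact: sA.
have mr := measurable_reaches u n (i :: p).
have cE : exists2 c : R, (0 <= c)%R & \prod_(v <- s) Q (A v) = c%:E.
  rewrite big_seq; apply: (big_ind (fun x => exists2 c : R, (0 <= c)%R & x = c%:E)).
  - by exists 1%R.
  - by move=> _ _ [a a0 ->] [b b0 ->]; exists (a * b)%R; rewrite ?mulr_ge0.
  - move=> v vs; exists (fine (Q (A v))); first by rewrite fine_ge0.
    rewrite fineK// fin_num_measure//.
    by apply: (@node_sigma_measurable _ _ _ _ _ _ _ _ _ S v); exact: sA.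
have [c c0 cP] := cE; rewrite cP.
rewrite (measure_partition_nat Q (g := node_degree S u)); last 2 first.
- exact: measurableI.
- by move=> l; exact: measurable_degree_eq.
rewrite -nneseriesZl; last first.
  move=> l /andP[l2 _]; apply: nneseries_ge0 => j _ _.
  by rewrite mule_ge0 ?path_prob_ge0// transition_prob_ge0.
rewrite [RHS]eseries_mkcond; apply: eq_eseriesr => l _.
have [li|il] := leqP l i.
  by rewrite andbF -setIA reaches_degree// setI0 measure0.
rewrite andbT (measure_partition_nat Q (g := fun w => nth 0%N (node_counts S u n l w) i)); last 2 first.
- by apply: measurableI; [exact: measurableI|exact: measurable_degree_eq].
- by move=> j; exact: measurable_count_eq.
have step j : Q (B `&` reaches u n (i :: p) `&` [set w | node_degree S u w = l] `&`
      [set w | nth 0%N (node_counts S u n l w) i = j]) =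
    Q (split_event S u n l i j) * (c%:E * path_prob p j).
  (* The addresses in [s] are shorter than [u], so [u] is new, and its split event can join the
     independent family before the descent to the child. *)
  pose A' v := if v == u then split_event S u n l i j else A v.
  have sA' : {in s, A' =1 A}.
    by move=> v /su vu; rewrite /A'; case: eqP => // vE; rewrite vE ltnn in vu.
  have us' : uniq (u :: s).
    by rewrite /= us andbT; apply/negP => /su; rewrite ltnn.
  have := ih (rcons u i) j (u :: s) A' us' _ _.
  have A'u : A' u = split_event S u n l i j by rewrite /A' eqxx.
  rewrite !big_cons !A'u (eq_big_seq _ sA').
  rewrite (eq_big_seq (fun v => Q (A v))); last by move=> v vs; rewrite sA'.
  rewrite cP -muleA => <-.
  - congr (Q _); rewrite -/B.
    transitivity (B `&` (reaches u n (i :: p) `&` split_event S u n l i j)).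
      by rewrite -!setIA.
    by rewrite reaches_split// setIA (setIC B).
  - move=> v; rewrite in_cons size_rcons => /predU1P[->//|/su vu].
    exact: ltnW.
  - move=> v; rewrite in_cons /A' => /predU1P[->|vs].
      by rewrite eqxx; exact: node_sigma_split.
    by have := sA' v vs; rewrite /A' => ->; exact: sA.
rewrite (eq_eseriesr (fun j _ => step j)).
case: ifPn => l2; last first.
  by apply: eseries0 => j _ _; rewrite split_event_prob_lt2 ?mul0e// ltnNge.
rewrite -nneseriesZl; last first.
  by move=> j _; rewrite mule_ge0 ?path_prob_ge0// transition_prob_ge0.
by apply: eq_eseriesr => j _; rewrite split_event_prob// muleCA.
Qed.

Lemma reaches_prob n p : Q (reaches [::] n p) = path_prob p n.
Proof.
have := @ancestors_reaches p [::] n [::] (fun=> setT) isT.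
by rewrite !big_nil setTI mul1e; apply.
Qed.

End path_probability.


Lemma counting_esum (R : realType) (T : choiceType) (A : set T) :
  counting A = (\esum_(i in A) 1)%E :> \bar R.
Proof.
have e1 : (0 <= 1 :> \bar R)%E by [].
have cardE (B : {fset T}) : (\sum_(i <- B) 1 = (#|` B|%:R)%:E :> \bar R)%E.
  by rewrite card_fset_sum1// natr_sum -sumEFin.
rewrite /counting; case: ifPn => /asboolP finA.
  by rewrite esum_fset// fsbig_finite//= cardE.
apply/esym/eqyP => r r0.
have [B BA Br] := infinite_set_fset (Num.truncn r).+1 finA.
apply: esum_ge; exists [set` B] => //.
rewrite fsbig_finite//= set_fsetK cardE lee_fin.
by rewrite (le_trans (ltW (truncnS_gt r)))// ler_nat.
Qed.

(** * Sums over the addresses of a given length *)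

Section level_sum.
Context (R : realType).
Local Open Scope ereal_scope.

(** Nested series, one for each letter, so that the recursion on the first letter matches that of
    [path_prob]; [level_sumE] recovers the unordered sum. *)
Fixpoint level_sum (k : nat) (a : seq nat -> \bar R) : \bar R :=
  if k is k'.+1 then \sum_(i <oo) level_sum k' (fun p => a (i :: p)) else a [::].

Lemma level_sum_ge0 k a : (forall p, 0 <= a p) -> 0 <= level_sum k a.
Proof. by elim: k a => [|k ih] a a0 //=; apply: nneseries_ge0 => i _ _; exact: ih. Qed.

Lemma eq_level_sum k a b : a =1 b -> level_sum k a = level_sum k b.
Proof. by move=> /funext ->. Qed.

Lemma level_sum_nneseries k (a : nat -> seq nat -> \bar R) : (forall l p, 0 <= a l p) ->
  level_sum k (fun p => \sum_(l <oo) a l p) = \sum_(l <oo) level_sum k (a l).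
Proof.
elim: k a => [|k ih] a a0 //=.
under eq_eseriesr do rewrite ih//.
by rewrite nneseries_interchange// => i l; exact: level_sum_ge0.
Qed.

Lemma level_sumZ k (c : R) a : (0 <= c)%R -> (forall p, 0 <= a p) ->
  level_sum k (fun p => c%:E * a p) = c%:E * level_sum k a.
Proof.
move=> c0; elim: k a => [|k ih] a a0 //=.
rewrite -nneseriesZl; last by move=> i _; exact: level_sum_ge0.
by apply: eq_eseriesr => i _; rewrite ih.
Qed.

Lemma level_sumE k a : (forall p, 0 <= a p) ->
  level_sum k a = \esum_(p in [set p | size p = k]) a p.
Proof.
elim: k a => [|k ih] a a0 /=.
  rewrite (_ : [set p | size p = 0%N] = [set [::]]) ?esum_set1//.
  by apply/seteqP; split=> [[|//]//|_ ->].
rewrite nneseries_esumT; last by move=> i; exact: level_sum_ge0.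
rewrite (eq_esum (b := fun i => \esum_(p in [set p | size p = k]) a (i :: p))); last first.
  by move=> i _; rewrite ih.
rewrite esum_esum//; apply/esym.
apply: (@reindex_esum R (nat * seq nat)%type (seq nat) _ _ (fun x => x.1 :: x.2) a); split.
- by move=> [i p] /= [_ ->].
- by move=> [i p] [i' p'] _ _ /= [-> ->].
- by move=> [|i p]//= [pk]; exists (i, p).
Qed.

Lemma esum_level_sum a : (forall p, 0 <= a p) ->
  \esum_(p in setT) a p = \sum_(k <oo) level_sum k a.
Proof.
move=> a0; rewrite nneseries_esumT; last by move=> k; exact: level_sum_ge0.
rewrite (eq_esum (b := fun k => \esum_(p in [set p | size p = k]) a p)); last first.
  by move=> k _; rewrite level_sumE.
rewrite -esum_bigcupT//.
  by congr (esum _ _); apply/seteqP; split=> // p _; exists (size p).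
by move=> i j _ _ [p [/= <- <-]].
Qed.

End level_sum.

Lemma integral_esum_count d (T : measurableType d) (R : realType)
    (mu : {measure set T -> \bar R}) (I : countType) (f : I -> T -> \bar R) :
  (forall i, measurable_fun setT (f i)) -> (forall i x, 0 <= f i x)%E ->
  (\int[mu]_x (\esum_(i in setT) f i x) = \esum_(i in setT) \int[mu]_x f i x)%E.
Proof.
move=> mf f0.
have H (a : I -> \bar R) : (forall i, 0 <= a i)%E -> (\esum_(i in setT) a i =
    \sum_(n <oo) if pickle_inv n is Some i then a i else 0)%E.
  move=> a0; rewrite nneseries_esumT; last by move=> n; case: pickle_inv.
  rewrite (esumID (range (@choice.pickle I)))//; last first.
    by move=> n _; case: pickle_inv.
  rewrite setTI [X in (_ + X)%E]esum1 ?adde0; last first.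
    move=> n [_ /=] nr; have := @pickle_invK I n; case: pickle_inv => [i|]//= ni.
    by exfalso; apply: nr; exists i.
  rewrite (@reindex_esum R I nat setT (range (@choice.pickle I)) (@choice.pickle I)).
    by apply: eq_esum => i _; rewrite pickleK_inv.
  split.
  - by move=> i _; exists i.
  - by move=> i j _ _; exact: (pcan_inj pickleK_inv).
  - by [].
rewrite H; last by move=> i; exact: integral_ge0.
transitivity (\int[mu]_x \sum_(n <oo) if pickle_inv n is Some i then f i x else 0)%E.
  by apply: eq_integral => x _; exact: H.
rewrite integral_nneseries//.
- by apply: eq_eseriesr => n _; case: pickle_inv => // ; rewrite integral0.
- by move=> n; case: pickle_inv.
- by move=> n x _; case: pickle_inv.
Qed.

(** * Expected level sizes and the one-step operator *)

Section expected_cost_levels.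
Context d (T : measurableType d) (R : realType) (P : probability T R).
Context (X : splitting_data P) (D : nat).
Local Open Scope ereal_scope.

Lemma transition_prob_fin l i n j : (2 <= l)%N -> transition_prob X l i n j \is a fin_num.
Proof.
move=> l2; rewrite ge0_fin_numE ?transition_prob_ge0//.
apply: (@le_lt_trans _ _ (degree_prob X l)); last by rewrite ltey_eq degree_prob_fin.
rewrite -(sum_transition_prob X i n l2) (nneseriesD1 (n := j))//; last first.
  by move=> k _; exact: transition_prob_ge0.
by rewrite leeDl// nneseries_ge0// => k _ _; exact: transition_prob_ge0.
Qed.

Definition split_step (f : nat -> \bar R) (n : nat) : \bar R :=
  if (D <= n)%N then
    \sum_(l <oo | (2 <= l)%N) \sum_(i < l) \sum_(j <oo) transition_prob X l i n j * f j
  else 0.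

Lemma split_step_ge0 f n : (forall j, 0 <= f j) -> 0 <= split_step f n.
Proof.
move=> f0; rewrite /split_step; case: ifPn => // _.
apply: nneseries_ge0 => l _ l2; apply: sume_ge0 => i _; apply: nneseries_ge0 => j _ _.
by rewrite mule_ge0// transition_prob_ge0.
Qed.

Definition expected_level (k n : nat) : \bar R :=
  level_sum k (fun p => path_prob X D p n).

Lemma expected_level_ge0 k n : 0 <= expected_level k n.
Proof. by apply: level_sum_ge0 => p; exact: path_prob_ge0. Qed.

(** Path probabilities sum over child indices first and over degrees second; after the exchange a
    degree [l] retains its [l] children. *)
Lemma expected_levelS k n : expected_level k.+1 n = split_step (expected_level k) n.
Proof.
rewrite /expected_level /split_step /=; case: ifPn => Dn; last first.
  rewrite (eq_eseriesr (g := fun=> 0)) ?eseries0// => i _.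
  elim: k => //= k ih; exact: eseries0.
transitivity (\sum_(i <oo) \sum_(l <oo) if (2 <= l)%N && (i < l)%N then
    \sum_(j <oo) transition_prob X l i n j * expected_level k j else 0).
  apply: eq_eseriesr => i _.
  rewrite (@eq_level_sum _ k _ (fun p => \sum_(l <oo) if (2 <= l)%N && (i < l)%N then
    \sum_(j <oo) transition_prob X l i n j * path_prob X D p j else 0)); last first.
    by move=> p; rewrite -eseries_mkcond.
  have tp0 l p j : (2 <= l)%N -> 0 <= transition_prob X l i n j * path_prob X D p j.
    by move=> l2; rewrite mule_ge0 ?path_prob_ge0// transition_prob_ge0.
  rewrite level_sum_nneseries; last first.
    move=> l p; case: ifPn => // /andP[l2 _]; apply: nneseries_ge0 => j _ _; exact: tp0.
  apply: eq_eseriesr => l _; case: ifPn => [/andP[l2 _]|_]; last first.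
    by elim: k => //= k ih; exact: eseries0.
  rewrite (level_sum_nneseries k (a := fun j p => transition_prob X l i n j * path_prob X D p j)); last first.
    by move=> j p; exact: tp0.
  apply: eq_eseriesr => j _; rewrite -(fineK (transition_prob_fin i n j l2)).
  rewrite level_sumZ//; first by rewrite fine_ge0// transition_prob_ge0.
  by move=> p; exact: path_prob_ge0.
have term0 l i : (2 <= l)%N -> 0 <= \sum_(j <oo) transition_prob X l i n j * expected_level k j.
  move=> l2; apply: nneseries_ge0 => j _ _.
  by rewrite mule_ge0 ?expected_level_ge0// transition_prob_ge0.
rewrite nneseries_interchange; last by move=> i l; case: ifPn => // /andP[l2 _]; exact: term0.
rewrite [RHS]eseries_mkcond; apply: eq_eseriesr => l _; case: ifPn => l2; last first.
  by apply: eseries0 => i _ _.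
rewrite (nneseries_split 0 l); last by move=> i _; case: ifPn => // _; exact: term0.
rewrite add0n [X in _ + X]eseries0 ?adde0; last first.
  by move=> i li _; rewrite ltnNge li.
by rewrite big_mkord; apply: eq_bigr => i _; rewrite ltn_ord.
Qed.

Lemma mean_degreeE : mean_degree X = \sum_(l <oo) (l%:R : R)%:E * degree_prob X l.
Proof.
rewrite /mean_degree unlock.
have mdeg l : measurable [set w | degree X w = l].
  rewrite -[X in measurable X]setTI.
  exact: (@measurable_funPT _ _ _ _ (degree X) measurableT [set l]).
rewrite (_ : [set: T] = \bigcup_l [set w | degree X w = l]); last first.
  by apply/seteqP; split => // w _; exists (degree X w).
rewrite ge0_integral_bigcup//.
- apply: eq_eseriesr => l _.
  rewrite (eq_integral (cst (l%:R : R)%:E)); first by rewrite integral_cst.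
  by move=> w /set_mem/= ->.
- apply/measurable_EFinP; apply: measurable_funTS.
  apply: (measurableT_comp (f := fun k : nat => (k%:R : R)%R)) => //.
- by move=> i j _ _ [w [/= <- <-]].
Qed.

(* Expected number of nodes of depth [k] with at least [D] items. *)
Fixpoint internal_level (k n : nat) : \bar R :=
  if k is k'.+1 then split_step (internal_level k') n else (D <= n)%N%:R%:E.

Lemma internal_level_ge0 k n : 0 <= internal_level k n.
Proof.
by elim: k n => [|k ih] n /=; [rewrite lee_fin ler0n|exact: split_step_ge0].
Qed.

Lemma expected_level1 n : (D <= n)%N -> expected_level 1 n = mean_degree X.
Proof.
move=> Dn; rewrite expected_levelS /split_step Dn mean_degreeE.
rewrite [LHS]eseries_mkcond; apply: eq_eseriesr => l _.
case: ifPn => [l2|]; last first.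
  by rewrite -ltnNge => l2; rewrite degree_prob_lt2// mule0.
rewrite (eq_bigr (fun=> degree_prob X l)); last first.
  move=> i _; rewrite -(sum_transition_prob X i n l2).
  by apply: eq_eseriesr => j _; rewrite /expected_level/= mule1.
rewrite -(fineK (degree_prob_fin X l)) sumEFin sumr_const card_ord.
by rewrite -[in LHS]mulr_natl EFinM.
Qed.

Lemma expected_level_internal (m : R) k n : mean_degree X = m%:E ->
  expected_level k.+1 n = m%:E * internal_level k n.
Proof.
move=> mE; have m0 : (0 <= m)%R.
  rewrite -lee_fin -mE mean_degreeE; apply: nneseries_ge0 => l _ _.
  by rewrite mule_ge0 ?degree_prob_ge0// lee_fin.
elim: k n => [|k ih] n.
  have [Dn|nD] := leqP D n; first by rewrite expected_level1//= Dn mE mule1.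
  by rewrite expected_levelS /split_step/= leqNgt nD/= mule0.
rewrite expected_levelS/= /split_step; case: ifPn => _; last by rewrite mule0.
rewrite -nneseriesZl; last first.
  move=> l l2; apply: sume_ge0 => i _; apply: nneseries_ge0 => j _ _.
  by rewrite mule_ge0 ?internal_level_ge0// transition_prob_ge0.
apply: eq_eseriesr => l l2; rewrite ge0_sume_distrr; last first.
  move=> i _; apply: nneseries_ge0 => j _ _.
  by rewrite mule_ge0 ?internal_level_ge0// transition_prob_ge0.
apply: eq_bigr => i _; rewrite -nneseriesZl; last first.
  by move=> j _; rewrite mule_ge0 ?internal_level_ge0// transition_prob_ge0.
by apply: eq_eseriesr => j _; rewrite ih muleCA.
Qed.

Lemma measurable_size_biased_sum (f : nat -> R) n : measurable_fun setT
  (fun y : R => if (0 < y <= 1)%R then y^-1 * \sum_(j < n.+1) binomial_pmf n y j * f j else 0)%R.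
Proof.
have msum : measurable_fun setT (fun y : R => \sum_(j < n.+1) binomial_pmf n y j * f j)%R.
  by apply: measurable_sum => j; apply: measurable_funM => //; exact: measurable_binomial_pmf.
(* On positive [y] the inverse is [expR (- ln y)], a composition of measurable functions. *)
rewrite (_ : (fun y => _) = (fun y : R => if (0 < y <= 1)%R then
    expR (- ln y) * (\sum_(j < n.+1) binomial_pmf n y j * f j) else 0)%R); last first.
  by apply/funext => y; case: ifPn => // /andP[y0 _]; rewrite expRN lnK.
apply: measurable_fun_ifT => //.
  apply: measurable_and; first exact: measurable_fun_ltr.
  exact: measurable_fun_ler.
apply: measurable_funM => //.
by apply: measurableT_comp => //; apply: measurableT_comp => //; exact: measurable_ln.
Qed.

(** The splitting measure weights each child by its share, hence the factor [y^-1]. A child of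
    weight 0 is lost in this division, but it receives no item and [f 0 = 0]. *)
Lemma split_step_splitting_measure (f : nat -> R) n : (D <= n)%N ->
  (forall j, 0 <= f j)%R -> f 0%N = 0%R ->
  split_step (EFin \o f) n = \int[splitting_measure X]_y
    (if (0 < y <= 1)%R then y^-1 * \sum_(j < n.+1) binomial_pmf n y j * f j else 0)%:E.
Proof.
move=> Dn f0 f00; rewrite /split_step Dn.
have sum0 y : (0 <= y <= 1)%R -> (0 <= \sum_(j < n.+1) binomial_pmf n y j * f j)%R.
  by move=> y01; apply: sumr_ge0 => j _; rewrite mulr_ge0// binomial_pmf_ge0.
rewrite ge0_integral_splitting_measure; last 2 first.
- by apply/measurable_EFinP; exact: measurable_size_biased_sum.
- move=> y; rewrite lee_fin; case: ifPn => // /andP[y0 y1].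
  by rewrite mulr_ge0 ?invr_ge0 ?sum0 ?(ltW y0).
apply: eq_eseriesr => l l2; apply: eq_bigr => i _.
rewrite (nneseries_split 0 n.+1); last first.
  by move=> j _; rewrite mule_ge0 ?transition_prob_ge0 ?lee_fin.
rewrite add0n [X in _ + X]eseries0 ?adde0; last first.
  move=> j nj _; rewrite /transition_prob integral0_eq ?mule0 ?mul0e// => w _.
  by rewrite binomial_pmf_gt.
rewrite big_mkord.
transitivity (\sum_(j < n.+1) degree_prob X l *
   \int[P]_w (binomial_pmf n (nth 0%R (weights X l w) i) j * f j)%:E).
  apply: eq_bigr => j _; rewrite /transition_prob -muleA; congr (_ * _).
  rewrite [LHS]muleC -ge0_integralZl_EFin//.
  - by apply: eq_integral => w _; rewrite -EFinM mulrC.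
  - by move=> w _; rewrite lee_fin binomial_pmf_ge0// weight_itv.
  - by apply/measurable_EFinP;
    exact: (measurableT_comp (@measurable_binomial_pmf R setT n j) (@measurable_weight _ _ _ _ X l i)).
rewrite -ge0_sume_distrr; last first.
  by move=> j _; apply: integral_ge0 => w _; rewrite lee_fin mulr_ge0// binomial_pmf_ge0// weight_itv.
congr (_ * _); rewrite -ge0_integral_sum//; last 2 first.
- move=> j; apply/measurable_EFinP; apply: measurable_funM => //.
  exact: (measurableT_comp (@measurable_binomial_pmf R setT n j) (@measurable_weight _ _ _ _ X l i)).
- by move=> j w _; rewrite lee_fin mulr_ge0// binomial_pmf_ge0// weight_itv.
apply: eq_integral => w _; rewrite sumEFin (tnth_nth 0%R) -EFinM; congr (_%:E).
have /andP[v0 v1] := weight_itv X w i l2.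
move: v0; rewrite le_eqVlt => /predU1P[<-|v0]; last first.
  by rewrite v0 v1/= mulrA divff ?mul1r// gt_eqF.
rewrite mul0r big_ord_recl f00 mulr0 add0r big1// => j _.
by rewrite /binomial_pmf/= expr0n/= mul0r mul0rn mul0r.
Qed.

Context d' (T' : measurableType d') (Q : probability T' R).
Variable S : splitting_algorithm X D Q.

Lemma expected_cost_levels n : expected_cost S n = \sum_(k <oo) expected_level k n.
Proof.
rewrite -esum_level_sum; last by move=> p; exact: path_prob_ge0.
transitivity (\int[Q]_w \esum_(p in setT) (\1_(reaches S [::] n p) w)%:E).
  apply: eq_integral => w _; rewrite /cost counting_esum esum_mkcond.
  apply: eq_esum => p _; rewrite indicE.
  have -> : (p \in splitting_tree S n w) = (w \in reaches S [::] n p).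
    by apply/idP/idP => /set_mem H; apply/mem_set.
  by case: (_ \in _).
rewrite (@integral_esum_count _ _ _ Q (seq nat)); last 2 first.
- by move=> p; apply/measurable_EFinP; apply: measurable_indic; exact: measurable_reaches.
- by move=> p w; rewrite lee_fin.
apply: eq_esum => p _.
rewrite integral_indic ?setIT//; first exact: reaches_prob.
exact: measurable_reaches.
Qed.

End expected_cost_levels.

(** * Binomial thinning and beta integrals *)

Section thinning.
Context (R : realType).

Lemma bin_absorb n j m : (m <= j <= n)%N -> ('C(n, j) * 'C(j, m) = 'C(n, m) * 'C(n - m, j - m))%N.
Proof.
move=> /andP[mj jn]; have mn := leq_trans mj jn.
have h1 := bin_fact jn; have h2 := bin_fact mj; have h3 := bin_fact mn.
have h4 := bin_fact (leq_sub2r m jn).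
have nj : (n - m - (j - m) = n - j)%N by rewrite subnBA// subnK.
rewrite nj in h4.
have pos : (0 < m`! * (j - m)`! * (n - j)`!)%N by rewrite !muln_gt0 !fact_gt0.
apply/eqP; rewrite -(eqn_pmul2r pos); apply/eqP.
transitivity n`!.
  rewrite -h1 -h2; ring.
rewrite -h3 -h4; ring.
Qed.

(** This is the [m]-th derivative in [u], divided by [m!], of the binomial generating function
    [(1 - y + y * u) ^+ n]. *)
Lemma binomial_thinning (n m : nat) (y u : R) : (m <= n)%N ->
  \sum_(j < n.+1) binomial_pmf n y j * ('C(j, m)%:R * u ^+ (j - m)) =
  'C(n, m)%:R * y ^+ m * (1 - y + y * u) ^+ (n - m).
Proof.
move=> mn; rewrite -(big_mkord xpredT (fun j => binomial_pmf n y j * ('C(j, m)%:R * u ^+ (j - m)))).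
rewrite (big_cat_nat (n := m))//=; last exact: leqW.
rewrite big_nat big1 ?add0r; last first.
  by move=> j /andP[_ jm]; rewrite bin_small// mul0r mulr0.
rewrite -{1}[m]add0n big_addn big_mkord subSn// exprDn big_distrr/=.
apply: eq_bigr => i _; rewrite /binomial_pmf addnK /unstable.onem.
have im : (i <= n - m)%N by rewrite -ltnS.
have binE : 'C(n, i + m)%:R * 'C(i + m, m)%:R = 'C(n, m)%:R * 'C(n - m, i)%:R :> R.
  have imn : (i + m <= n)%N by rewrite addnC -leq_subRL.
  by rewrite -!natrM bin_absorb ?addnK// leq_addl.
have nE : (n - (i + m) = n - m - i)%N by rewrite addnC subnDA.
transitivity ('C(n, i + m)%:R * 'C(i + m, m)%:R * (y ^+ (i + m) * (1 - y) ^+ (n - m - i) * u ^+ i)).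
  by rewrite nE -[X in X * _ = _]mulr_natr; ring.
by rewrite binE -[X in _ = _ * X]mulr_natr exprMn exprD; ring.
Qed.

Let fact_pred k : (0 < k)%N -> (k * k.-1`! = k`!)%N.
Proof. by case: k => // k _; rewrite factS. Qed.

Variable D : nat.
Hypothesis D2 : (2 <= D)%N.

(* [v * beta_weight n v] is the density of the [D]-th smallest of [n]
   independent uniform points of [0, 1]. *)
Definition beta_weight (n : nat) (v : R) : R :=
  if 0 < v <= 1 then (D * 'C(n, D))%:R * (v ^+ (D - 2) * (1 - v) ^+ (n - D)) else 0.

Lemma beta_weight_ge0 n v : 0 <= beta_weight n v.
Proof.
rewrite /beta_weight; case: ifPn => // /andP[v0 v1].
by rewrite !mulr_ge0// exprn_ge0 ?subr_ge0// ltW.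
Qed.

Lemma measurable_beta_weight n : measurable_fun setT (beta_weight n).
Proof.
apply: measurable_fun_ifT => //.
  apply: measurable_and; first exact: measurable_fun_ltr.
  exact: measurable_fun_ler.
apply: measurable_funM => //; apply: measurable_funM; first exact: measurable_funX.
by apply: measurable_funX; exact: measurable_funB.
Qed.

Lemma beta_weight_small n v : (n < D)%N -> beta_weight n v = 0.
Proof. by move=> nD; rewrite /beta_weight bin_small// muln0 mul0r if_same. Qed.

Lemma beta_weight_thinning (n : nat) (y v : R) : (D <= n)%N -> 0 < y <= 1 -> 0 < v <= 1 ->
  \sum_(j < n.+1) binomial_pmf n y j * beta_weight j v = y ^+ 2 * beta_weight n (y * v).
Proof.
move=> Dn /andP[y0 y1] /andP[v0 v1].
have yv : 0 < y * v <= 1 by rewrite mulr_gt0//= mulr_ile1// ltW.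
rewrite /beta_weight v0 v1 yv /=.
transitivity (D%:R * v ^+ (D - 2) *
    \sum_(j < n.+1) binomial_pmf n y j * ('C(j, D)%:R * (1 - v) ^+ (j - D))).
  by rewrite big_distrr/=; apply: eq_bigr => j _; rewrite natrM; ring.
rewrite binomial_thinning// (_ : 1 - y + y * (1 - v) = 1 - y * v); last by ring.
rewrite -[in y ^+ D](subnKC D2) exprD exprMn natrM; ring.
Qed.

Local Notation leb := (@lebesgue_measure R).

Let integral_itv01 (f : R -> \bar R) : (\int[leb]_v (if (0 < (v : R) <= 1)%R then f v else 0) =
  \int[leb]_(v in `]0%R, 1%R]) f v)%E.
Proof.
rewrite [RHS]integral_mkcond; apply: eq_integral => v _.
by rewrite patchE mem_setE in_itv/=.
Qed.

Let integral_beta a b : (\int[leb]_v (if 0 < (v : R) <= 1 then v ^+ a * (1 - v) ^+ b else 0)%R%:E =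
  ((a`! * b`!)%:R / (a + b).+1`!%:R)%:E)%E.
Proof.
rewrite -beta_fun_fact EFin_beta_fun.
transitivity (\int[leb]_(v in `]0%R, 1%R]) (v ^+ a * (1 - v) ^+ b)%:E)%E.
  rewrite -integral_itv01; apply: eq_integral => v _.
  by case: ifP.
transitivity (\int[leb]_(v in `[0%R, 1%R]) (v ^+ a * (1 - v) ^+ b)%:E)%E.
  apply: integral_itv_obnd_cbnd; apply: measurable_funTS.
  apply/measurable_EFinP; apply: measurable_funM; first exact: measurable_funX.
  by apply: measurable_funX; exact: measurable_funB.
rewrite [LHS]integral_mkcond; apply: eq_integral => v _.
by rewrite !patchE; case: ifP.
Qed.

Let if_beta_ge0 a b (v : R) :
  (0 <= (if (0 < v <= 1)%R then v ^+ a * (1 - v) ^+ b else 0)%R%:E)%E.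
Proof.
rewrite lee_fin; case: ifPn => // /andP[v0 v1].
by rewrite mulr_ge0// exprn_ge0 ?subr_ge0// ltW.
Qed.

Let measurable_if_beta a b : measurable_fun setT
  (fun v : R => (if (0 < v <= 1)%R then v ^+ a * (1 - v) ^+ b else 0)%R%:E).
Proof.
apply/measurable_EFinP; apply: measurable_fun_ifT => //.
  apply: measurable_and; first exact: measurable_fun_ltr.
  exact: measurable_fun_ler.
by apply: measurable_funM => //; apply: measurable_funX => //; exact: measurable_funB.
Qed.

Lemma integral_beta_weight_mul n :
  (\int[leb]_v (beta_weight n v * v)%:E = (D <= n)%N%:R%:E)%E.
Proof.
case: leqP => Dn; last first.
  by rewrite integral0_eq// => v _; rewrite beta_weight_small// mul0r.
transitivity ((D * 'C(n, D))%:R%:E * \int[leb]_v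
    (if (0 < (v : R) <= 1)%R then v ^+ (D - 1) * (1 - v) ^+ (n - D) else 0)%R%:E)%E.
  rewrite -ge0_integralZl_EFin//.
  - apply: eq_integral => v _; rewrite -EFinM /beta_weight; congr (_%:E).
    case: ifP => _; last by rewrite mul0r mulr0.
    by rewrite (_ : (D - 1 = (D - 2).+1)%N) ?exprS; [ring|lia].
  - exact: measurable_if_beta.
rewrite integral_beta -EFinM; congr (_%:E).
have -> : ((D - 1 + (n - D)).+1 = n)%N by lia.
have DE : (D * (D - 1)`! = D`!)%N by rewrite subn1 fact_pred// ltnW.
have E : (D * 'C(n, D) * ((D - 1)`! * (n - D)`!) = n`!)%N.
  by rewrite -(bin_fact Dn) -DE; ring.
by rewrite mulrA -natrM E divff// pnatr_eq0 -lt0n fact_gt0.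
Qed.

(** The mean of the inverse of the [D]-th smallest uniform point; the factor [D - 1] of the limit
    originates here. *)
Lemma integral_beta_weight n : (D <= n)%N ->
  (\int[leb]_v (beta_weight n v)%:E = (n%:R / (D.-1)%:R)%:E)%E.
Proof.
move=> Dn.
transitivity ((D * 'C(n, D))%:R%:E * \int[leb]_v
    (if (0 < (v : R) <= 1)%R then v ^+ (D - 2) * (1 - v) ^+ (n - D) else 0)%R%:E)%E.
  rewrite -ge0_integralZl_EFin//.
  - apply: eq_integral => v _; rewrite -EFinM /beta_weight; congr (_%:E).
    by case: ifP => _; rewrite ?mulr0.
  - exact: measurable_if_beta.
rewrite integral_beta -EFinM; congr (_%:E).
have -> : ((D - 2 + (n - D)).+1 = n.-1)%N by lia.
have n0 : n.-1`!%:R != 0 :> R by rewrite pnatr_eq0 -lt0n fact_gt0.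
have D0 : (D.-1)%:R != 0 :> R by rewrite pnatr_eq0 -lt0n; lia.
apply/eqP; rewrite mulrA eqr_div//; apply/eqP; rewrite -!natrM; congr (_%:R).
have nE : (n * n.-1`! = n`!)%N by rewrite fact_pred//; lia.
have DE : (D * D.-1 * (D - 2)`! = D`!)%N.
  have -> : (D - 2 = D.-1.-1)%N by lia.
  by rewrite -mulnA !fact_pred//; lia.
rewrite nE -(bin_fact Dn) -DE; ring.
Qed.
End thinning.

(** * Levels of the tree as terms of the renewal series *)

Section levels_by_renewal.
Context d (T : measurableType d) (R : realType) (P : probability T R).
Context (X : splitting_data P) (delta : R) (D : nat).
Hypothesis hA : bounded_weights X delta.
Hypothesis D2 : (2 <= D)%N.
Local Open Scope ereal_scope.
Local Notation leb := (@lebesgue_measure R).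

Let measurable_0delta : measurable [set y : R | (0 < y <= delta)%R].
Proof.
have -> : [set y : R | (0 < y <= delta)%R] = `]0%R, delta]%classic.
  by apply/seteqP; split => y; rewrite /= in_itv.
exact: measurable_itv.
Qed.

(** The size bias kills the weights equal to 0, and Assumption (A) bounds the others almost
    surely. *)
Lemma splitting_measure_support :
  {ae splitting_measure X, forall y : R, (0 < y <= delta)%R}.
Proof.
exists (~` [set y : R | (0 < y <= delta)%R]); split => //.
  exact: measurableC.
apply: eseries0 => l _ l2; apply: big1 => i _; rewrite unlock.
have mV : measurable_fun setT (fun w => tnth (weights X l w) i).
  apply: (measurableT_comp (measurable_tnth i)).
  exact: measurable_funPT.
rewrite (ge0_ae_eq_integral (g := cst 0)) ?integral0 ?mule0//.
- apply/measurable_EFinP; apply: measurable_funM => //.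
  apply: measurableT_comp; last exact: mV.
  by apply: measurable_indic; exact: measurableC.
- move=> w _; rewrite lee_fin mulr_ge0//.
  by have [+ _] := weights_simplex X w l2; apply.
- have [_] := hA; apply: filterS => w Vd _ /=.
  have [V0 _] := weights_simplex X w l2.
  rewrite indicE; case: (eqVneq (tnth (weights X l w) i) 0%R) => [->|Vi]; first by rewrite mul0r.
  by rewrite memNset ?mulr0//= lt0r Vi V0/= Vd.
Qed.

(* Truncating [- ln y] below makes the step bounded away from 0 everywhere,
   whereas it changes nothing almost surely. *)
Definition log_step (y : R) : R := Num.max (- ln y)%R (- ln delta)%R.

Lemma measurable_log_step : measurable_fun setT log_step.
Proof.
apply: measurable_maxr => //; apply: measurableT_comp => //; exact: measurable_ln.
Qed.

Lemma log_step_ge y : (- ln delta <= log_step y)%R.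
Proof. by rewrite /log_step le_max lexx orbT. Qed.

Lemma Nln_delta_gt0 : (0 < - ln delta)%R.
Proof. by have [/andP[d0 d1] _] := hA; rewrite oppr_gt0 ln_lt0// d0. Qed.

Lemma log_stepE y : (0 < y <= delta)%R -> log_step y = (- ln y)%R.
Proof.
move=> /andP[y0 yd]; have [/andP[d0 _] _] := hA.
by apply/max_idPl; rewrite lerN2 ler_ln.
Qed.

(** Of the factor [y ^+ 2] left by thinning, one [y] cancels the size bias and the other is the
    Jacobian of the dilation by [y]. *)
Lemma thinned_beta_integral (f : R -> \bar R) (a : nat -> R) n y :
  measurable_fun setT f -> (forall t, 0 <= f t) -> (forall t, (t < 0)%R -> f t = 0) ->
  (forall j, (a j)%:E = \int[leb]_v ((beta_weight D j v)%:E * f (- ln v)%R)) ->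
  (D <= n)%N -> (0 < y <= 1)%R ->
  (y^-1 * \sum_(j < n.+1) binomial_pmf n y j * a j)%:E =
  \int[leb]_v ((beta_weight D n v)%:E * f (- ln v + ln y)%R).
Proof.
move=> mf f0 fN aE Dn y01; have /andP[y0 y1] := y01.
have mfln : measurable_fun setT (fun v : R => f (- ln v)%R).
  by apply: (measurableT_comp mf); apply: measurableT_comp => //; exact: measurable_ln.
have mb j : measurable_fun setT (fun v : R => (beta_weight D j v)%:E).
  by apply/measurable_EFinP; exact: measurable_beta_weight.
have b0 j (v : R) : 0 <= (beta_weight D j v)%:E by rewrite lee_fin beta_weight_ge0.
have p0 j : (0 <= binomial_pmf n y j)%R by rewrite binomial_pmf_ge0 ?(ltW y0).
rewrite EFinM -sumEFin.
under eq_bigr do rewrite EFinM aE.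
transitivity (y^-1%:E * \int[leb]_v
   (\sum_(j < n.+1) (binomial_pmf n y j * beta_weight D j v)%:E * f (- ln v)%R)).
  congr (_ * _); rewrite ge0_integral_sum//; last 2 first.
  - move=> j; apply: emeasurable_funM => //.
    by apply/measurable_EFinP; apply: measurable_funM => //; exact: measurable_beta_weight.
  - move=> j v _; by rewrite mule_ge0 ?f0// lee_fin mulr_ge0 ?p0 ?beta_weight_ge0.
  apply: eq_bigr => j _; rewrite -ge0_integralZl_EFin//.
  - by apply: eq_integral => v _; rewrite muleA -EFinM.
  - by move=> v _; rewrite mule_ge0.
  - exact: (emeasurable_funM (mb j) mfln).
transitivity (y^-1%:E * \int[leb]_v ((y ^+ 2)%:E *
    ((beta_weight D n (y * v))%:E * f (- ln v)%R))).
  congr (_ * _); apply: eq_integral => v _.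
  rewrite -ge0_sume_distrl; last first.
    by move=> j _; rewrite lee_fin mulr_ge0 ?p0 ?beta_weight_ge0.
  rewrite sumEFin; case: (boolP (0 < v <= 1)%R) => [v01|].
    by rewrite beta_weight_thinning// muleA -EFinM.
  rewrite negb_and -leNgt -ltNge => /orP[v0|v1].
    rewrite big1 ?mul0e; last first.
      by move=> j _; rewrite /beta_weight ltNge v0/= mulr0.
    by rewrite /beta_weight pmulr_rgt0// ltNge v0 mul0e mule0.
  (* For [v > 1] the weight at [y * v] need not vanish; [f] does, as its argument is negative. *)
  by rewrite fN ?mule0// oppr_lt0 ln_gt0.
rewrite ge0_integralZl_EFin//; last 3 first.
- by move=> v _; rewrite mule_ge0.
- apply: emeasurable_funM => //; apply: (measurableT_comp (mb n)).
  exact: measurable_funM.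
- by rewrite exprn_ge0 ?ltW.
rewrite muleA -EFinM (_ : (y^-1 * y ^+ 2 = y)%R); last by field; rewrite gt_eqF.
rewrite -[RHS](ge0_integral_affine 0 y0); last 2 first.
- apply: emeasurable_funM => //; apply: (measurableT_comp mf).
  by apply: measurable_funD => //; apply: measurableT_comp => //; exact: measurable_ln.
- by move=> v; rewrite mule_ge0.
congr (_ * _); apply: eq_integral => v _; rewrite addr0.
case: (ltP 0%R v) => v0.
  by congr (_ * f _); rewrite lnM ?posrE//; lra.
by rewrite /beta_weight pmulr_rgt0// ltNge v0 !mul0e.
Qed.

Let U := renewal_term (splitting_measure X) log_step.

Lemma internal_level_renewal k n :
  internal_level X D k n = \int[leb]_v ((beta_weight D n v)%:E * U k (- ln v)%R).
Proof.
have mU j : measurable_fun setT (U j).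
  exact: (measurable_renewal_term _ measurable_log_step).
have U0 j t : 0 <= U j t by exact: renewal_term_ge0.
have mln : measurable_fun setT (fun v : R => - ln v)%R.
  by apply: measurableT_comp => //; exact: measurable_ln.
have mb j : measurable_fun setT (fun v : R => (beta_weight D j v)%:E).
  by apply/measurable_EFinP; exact: measurable_beta_weight.
have b0 j (v : R) : 0 <= (beta_weight D j v)%:E by rewrite lee_fin beta_weight_ge0.
elim: k n => [|k ih] n.
  rewrite /= -(integral_beta_weight_mul _ D2); apply: eq_integral => v _.
  rewrite EFinM /beta_weight; case: ifP => [/andP[v0 v1]|_]; last by rewrite !mul0e.
  rewrite /U/= /renewal_kernel oppr_ge0 ln_le0// opprK lnK//.
have [nD|Dn] := ltnP n D.
  rewrite /= /split_step leqNgt nD/= integral0_eq// => v _.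
  by rewrite beta_weight_small// mul0e.
(* The renewal bound against a finite beta integral; the one-step formula is stated for real-valued
   functions. *)
have fin j : internal_level X D k j \is a fin_num.
  rewrite ge0_fin_numE ?internal_level_ge0// ih.
  have [jD|Dj] := ltnP j D.
    by rewrite integral0_eq ?ltry// => v _; rewrite beta_weight_small// mul0e.
  set B := renewal_bound (- ln delta).
  apply: (@le_lt_trans _ _ (\int[leb]_v ((beta_weight D j v)%:E * B%:E))).
    apply: ge0_le_integral => //.
    - by move=> v _; rewrite mule_ge0.
    - by apply: (emeasurable_funM (mb j)); exact: (measurableT_comp (mU k) mln).
    - by apply: (emeasurable_funM (mb j)).
    - move=> v _; rewrite lee_wpmul2l//.
      apply: le_trans (renewal_fun_le (splitting_measure X) measurable_log_step Nln_delta_gt0 log_step_ge (- ln v)).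
      rewrite /renewal_fun (nneseriesD1 (n := k))//.
      by apply: leeDl; apply: nneseries_ge0 => i _ _; exact: renewal_term_ge0.
  rewrite ge0_integralZr//; last first.
    by rewrite lee_fin ltW// renewal_bound_gt0// Nln_delta_gt0.
  - exact: mb.
  by rewrite integral_beta_weight// -EFinM ltry.
pose a j := fine (internal_level X D k j).
have aE j : (a j)%:E = \int[leb]_v ((beta_weight D j v)%:E * U k (- ln v)%R).
  by rewrite -ih fineK.
have Uk0 t : (t < 0)%R -> U k t = 0.
  by move=> t0; apply: renewal_term_lt0 t0; [exact: Nln_delta_gt0|exact: log_step_ge].
have mh : measurable_fun setT (fun p : R * R => (beta_weight D n p.2)%:E * U k (- ln p.2 - log_step p.1)%R).
  apply: emeasurable_funM; first by apply: (measurableT_comp (mb n)).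
  apply: (measurableT_comp (mU k)); apply: measurable_funB.
    by apply: (measurableT_comp mln).
  by apply: (measurableT_comp measurable_log_step).
rewrite [LHS]/=.
rewrite (_ : internal_level X D k = EFin \o a); last first.
  by apply/funext => j /=; rewrite fineK.
rewrite split_step_splitting_measure//; last 2 first.
- by move=> j; rewrite fine_ge0// internal_level_ge0.
- rewrite /a ih integral0_eq// => v _; rewrite beta_weight_small ?mul0e//.
  by rewrite (leq_trans _ D2).
transitivity (\int[splitting_measure X]_y \int[leb]_v
    ((beta_weight D n v)%:E * U k (- ln v - log_step y)%R)).
  have E y : (0 < y <= delta)%R ->
      (if (0 < y <= 1)%R then y^-1 * \sum_(j < n.+1) binomial_pmf n y j * a j else 0)%:E =
      \int[leb]_v ((beta_weight D n v)%:E * U k (- ln v - log_step y)%R).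
    move=> yd; have [/andP[d0 d1] _] := hA; have /andP[y0 yd'] := yd.
    have y01 : (0 < y <= 1)%R by rewrite y0 (le_trans yd')// ltW.
    rewrite y01 (thinned_beta_integral (mU k) (U0 k) Uk0 aE Dn y01).
    by apply: eq_integral => v _; rewrite log_stepE// opprK.
  apply: ge0_ae_eq_integral => //.
  - by apply/measurable_EFinP; exact: measurable_size_biased_sum.
  - apply: (@measurable_fun_fubini_tonelli_F _ _ _ _ _ leb _ mh) => p.
    by rewrite mule_ge0.
  - move=> y _; rewrite lee_fin; case: ifPn => // /andP[y0 y1].
    apply: mulr_ge0; first by rewrite invr_ge0 ltW.
    apply: sumr_ge0 => j _; apply: mulr_ge0; first by rewrite binomial_pmf_ge0// ltW.
    by rewrite fine_ge0// internal_level_ge0.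
  - by move=> y _; apply: integral_ge0 => v _; rewrite mule_ge0.
  - by apply: filterS splitting_measure_support => y yd _; exact: E.
(* The exchange lets the splitting measure act on [U k] alone, which is the recursion defining
   [U k.+1]. *)
rewrite (fubini_tonelli (m1 := splitting_measure X) (m2 := leb) _ mh); last first.
  by move=> p; rewrite mule_ge0.
apply: eq_integral => v _ /=; rewrite ge0_integralZl_EFin//.
- apply: measurable_step; [exact: measurable_log_step|exact: mU].
- exact: beta_weight_ge0.
Qed.

End levels_by_renewal.

(** * Expected cost through the renewal function *)

Section levels_to_cost.
Context d (T : measurableType d) (R : realType) (P : probability T R).
Context (X : splitting_data P) (delta : R) (D : nat).
Hypothesis hA : bounded_weights X delta.
Hypothesis D2 : (2 <= D)%N.
Context d' (T' : measurableType d') (Q : probability T' R).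
Variable S : splitting_algorithm X D Q.
Local Open Scope ereal_scope.
Local Notation leb := (@lebesgue_measure R).

Lemma expected_cost_renewal (m : R) n : mean_degree X = m%:E ->
  expected_cost S n = 1 + m%:E * \int[leb]_v ((beta_weight D n v)%:E *
    renewal_fun (splitting_measure X) (log_step delta) (- ln v)%R).
Proof.
move=> mE; have m0 : (0 <= m)%R.
  rewrite -lee_fin -mE mean_degreeE; apply: nneseries_ge0 => l _ _.
  by rewrite mule_ge0 ?degree_prob_ge0// lee_fin.
have mU := measurable_renewal_term (splitting_measure X) (measurable_log_step delta).
have mln : measurable_fun setT (fun v : R => - ln v)%R.
  by apply: measurableT_comp => //; exact: measurable_ln.
have mb : measurable_fun setT (fun v : R => (beta_weight D n v)%:E).
  by apply/measurable_EFinP; exact: measurable_beta_weight.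
rewrite expected_cost_levels nneseries_recl//; last first.
  by move=> k _; exact: expected_level_ge0.
congr (_ + _).
rewrite -(@nneseries_addn _ (fun k => expected_level X D k n) 1)//; last first.
  by move=> k; exact: expected_level_ge0.
under eq_eseriesr do rewrite addn1 (expected_level_internal D _ _ mE).
rewrite nneseriesZl; last by move=> k _; exact: internal_level_ge0.
congr (_ * _); under eq_eseriesr do rewrite (internal_level_renewal hA D2).
rewrite -integral_nneseries//; last 2 first.
- by move=> k; apply: (emeasurable_funM mb); exact: (measurableT_comp (mU k) mln).
- by move=> k v _; rewrite mule_ge0 ?renewal_term_ge0// lee_fin beta_weight_ge0.
apply: eq_integral => v _; rewrite -nneseriesZl// => k _; exact: renewal_term_ge0.
Qed.

Lemma log_step_mean : \int[splitting_measure X]_y (log_step delta y)%:E = mean_abs_log X.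
Proof.
rewrite /mean_abs_log [RHS]integral_mkcond; apply: ge0_ae_eq_integral => //.
- by apply/measurable_EFinP; exact: measurable_log_step.
- apply/(measurable_restrictT _ _).1 => //; apply: measurable_funTS.
  apply/measurable_EFinP; apply: measurableT_comp => //; exact: measurable_ln.
- move=> y _; rewrite lee_fin (le_trans (ltW (Nln_delta_gt0 hA)))//; exact: log_step_ge.
- by move=> y _; rewrite patchE; case: ifP.
- apply: filterS (splitting_measure_support hA) => y yd _.
  have [/andP[d0 d1] _] := hA; have /andP[y0 yd'] := yd.
  have y1 : (y <= 1)%R by rewrite (le_trans yd')// ltW.
  by rewrite patchE mem_setE in_itv/= y1 (ltW y0) (log_stepE hA yd) ler0_norm// ln_le0.
Qed.

(** Since [1 <= y^-1] on the unit interval, the integrability assumption makes the mean step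
    finite. *)
Lemma mean_abs_log_lty :
  \int[splitting_measure X]_(y in `[0%R, 1%R]) (`|ln y| / y)%:E < +oo ->
  mean_abs_log X < +oo.
Proof.
apply: le_lt_trans; apply: ge0_le_integral => //.
- apply: measurable_funTS; apply/measurable_EFinP.
  by apply: measurableT_comp => //; exact: measurable_ln.
(* At 0 the two expressions agree because the default value [ln 0 = 0] annihilates both. *)
- apply: (eq_measurable_fun (fun y : R => (`|ln y| * expR (- ln y))%:E)).
    move=> y /set_mem/=; rewrite in_itv/= => /andP[y0 _].
    move: y0; rewrite le_eqVlt => /predU1P[<-|y0]; last by rewrite expRN lnK.
    by rewrite ln0// normr0 !mul0r.
  apply: measurable_funTS; apply/measurable_EFinP; apply: measurable_funM.
    by apply: measurableT_comp => //; exact: measurable_ln.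
  by apply: measurableT_comp => //; apply: measurableT_comp => //; exact: measurable_ln.
- move=> y /=; rewrite in_itv/= => /andP[y0 y1].
  move: y0; rewrite le_eqVlt => /predU1P[<-|y0]; first by rewrite ln0// normr0 mul0r.
  by rewrite lee_fin ler_peMr// invf_ge1.
Qed.

End levels_to_cost.

(** * Asymptotics of the expected cost *)

Section poissonization.
Context (R : realType) (D : nat).
Hypothesis D2 : (2 <= D)%N.
Local Notation leb := (@lebesgue_measure R).

Definition gamma_weight (u : R) : R :=
  if 0 < u then u ^+ (D - 2) / (D.-1)`!%:R * expR (- u) else 0.

(** One inverse of [n] comes from the substitution [v = u / n], the other from dividing the cost by
    [n]. *)
Definition scaled_beta_weight (n : nat) (u : R) : R :=
  n%:R ^- 2 * beta_weight D n (u / n%:R).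

(** The halved rate dominates all the weights with [2 * D <= n] at once: [(1 - u / n) ^+ (n - D)] is
    at most the exponential of [- (n - D) * u / n], hence of [- u / 2]. *)
Definition gamma_majorant (u : R) : R :=
  if 0 < u then u ^+ (D - 2) / (D.-1)`!%:R * expR (- (u / 2)) else 0.

Lemma gamma_weight_ge0 u : 0 <= gamma_weight u.
Proof.
rewrite /gamma_weight; case: ifPn => // u0.
by rewrite mulr_ge0 ?expR_ge0// divr_ge0 ?exprn_ge0// ltW.
Qed.

Lemma gamma_weight_le u : gamma_weight u <= gamma_majorant u.
Proof.
rewrite /gamma_weight /gamma_majorant; case: ifPn => // u0.
rewrite ler_wpM2l ?divr_ge0 ?exprn_ge0 ?(ltW u0)// ler_expR; lra.
Qed.

Lemma measurable_gamma_weight : measurable_fun setT gamma_weight.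
Proof.
apply: measurable_fun_ifT => //; first exact: measurable_fun_ltr.
apply: measurable_funM; last exact: measurableT_comp.
by apply: measurable_funM => //; exact: measurable_funX.
Qed.

Lemma measurable_scaled_beta_weight n : measurable_fun setT (scaled_beta_weight n).
Proof.
apply: measurable_funM => //.
by apply: (measurableT_comp (measurable_beta_weight D n)); exact: measurable_funM.
Qed.

Lemma scaled_beta_weight_ge0 n u : 0 <= scaled_beta_weight n u.
Proof. by rewrite mulr_ge0 ?beta_weight_ge0// invr_ge0 exprn_ge0. Qed.

Lemma exprn_le_fact_expR (x : R) k : 0 <= x -> x ^+ k <= k`!%:R * expR x.
Proof.
move=> x0; case: k => [|k]; first by rewrite expr0 fact0 mul1r; apply: le_trans (expR_ge1Dx x); rewrite lerDl.
rewrite mulrC -ler_pdivrMr ?ltr0n ?fact_gt0//.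
by apply: le_trans (expR_ge1Dxn k x0); rewrite lerDr ler01.
Qed.

Lemma integrable_gamma_majorant : leb.-integrable setT (EFin \o gamma_majorant).
Proof.
(* The power [(u / 4) ^+ (D - 2)] is at most a factorial times [expR (u / 4)], which leaves the rate
   1/4; the last 4 undoes the normalisation of the exponential density. *)
pose C : R := (D - 2)`!%:R * 4 ^+ (D - 2) / (D.-1)`!%:R * 4.
apply: (@le_integrable _ _ _ leb setT measurableT _
  (fun u => C%:E * (exponential_pdf (4^-1) u)%:E)%E).
- apply/measurable_EFinP; apply: measurable_fun_ifT => //; first exact: measurable_fun_ltr.
  apply: measurable_funM; last first.
    by apply: measurableT_comp => //; apply: measurableT_comp => //; exact: measurable_funM.
  by apply: measurable_funM => //; exact: measurable_funX.
- move=> u _; rewrite /= lee_fin /gamma_majorant.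
  case: ifPn => u0; last by rewrite normr0 normr_ge0.
  have u4 : 0 <= u / 4 by rewrite divr_ge0 ?(ltW u0).
  rewrite !ger0_norm; last 2 first.
    by rewrite mulr_ge0 ?exponential_pdf_ge0// /C !mulr_ge0 ?invr_ge0// exprn_ge0.
    by rewrite mulr_ge0 ?expR_ge0// divr_ge0 ?exprn_ge0 ?(ltW u0).
  rewrite exponential_pdfE ?(ltW u0)//.
  have := exprn_le_fact_expR (D - 2) u4.
  rewrite exprMn exprVn ler_pdivrMr ?exprn_gt0// => h.
  apply: (@le_trans _ _ ((D - 2)`!%:R * expR (u / 4) * 4 ^+ (D - 2) / (D.-1)`!%:R * expR (- (u / 2)))).
    apply: ler_wpM2r; first exact: expR_ge0.
    by apply: ler_wpM2r; [rewrite invr_ge0 ltW|exact: h].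
  have -> : expR (- (u / 2)) = expR (- (u / 4)) * expR (- (u / 4)).
    by rewrite -expRD; congr expR; lra.
  have e1 : expR (u / 4) * expR (- (u / 4)) = 1 by rewrite -expRD subrr expR0.
  rewrite le_eqVlt; apply/orP; left; apply/eqP.
  transitivity ((D - 2)`!%:R * 4 ^+ (D - 2) / (D.-1)`!%:R * (expR (u / 4) * expR (- (u / 4))) * expR (- (u / 4))); first by ring.
  rewrite e1 /C (_ : - 4^-1 * u = - (u / 4)); last by rewrite mulNr mulrC.
  by field; rewrite gt_eqF.
- apply: integrableZl => //; apply: integrable_exponential_pdf; first by [].
Qed.

Lemma integrable_gamma_weight : leb.-integrable setT (EFin \o gamma_weight).
Proof.
apply: le_integrable integrable_gamma_majorant => //.
- by apply/measurable_EFinP; exact: measurable_gamma_weight.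
- move=> u _ /=; rewrite lee_fin ger0_norm ?gamma_weight_ge0//.
  exact: le_trans (gamma_weight_le u) (ler_norm _).
Qed.

Lemma ffact_ge n m : ((n - m) ^ m <= n ^_ m <= n ^ m)%N.
Proof.
rewrite ffact_prod -[X in (_ ^ X <= _)%N](card_ord m) -[X in (_ <= _ ^ X)%N](card_ord m).
rewrite -!prod_nat_const; apply/andP; split; apply: leq_prod => i _; last exact: leq_subr.
by rewrite leq_sub2l// ltnW.
Qed.

Lemma scaled_beta_weightE n u : 0 < u <= n%:R ->
  scaled_beta_weight n u = (n ^_ D)%:R / n%:R ^+ D *
    (u ^+ (D - 2) / (D.-1)`!%:R * (1 - u / n%:R) ^+ (n - D)).
Proof.
move=> /andP[u0 un]; have n0 : 0 < n%:R :> R by rewrite (lt_le_trans u0).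
rewrite /scaled_beta_weight /beta_weight divr_gt0//= ler_pdivrMr// mul1r un.
have E : (n ^_ D = D * 'C(n, D) * D.-1`!)%N.
  rewrite -bin_ffact -{2}(prednK (ltnW D2)) factS prednK ?(ltnW D2)//.
  by rewrite mulnCA mulnA.
have -> : n%:R ^+ D = n%:R ^+ 2 * n%:R ^+ (D - 2) :> R by rewrite -exprD subnKC.
rewrite E natrM exprMn exprVn; field.
by rewrite !expf_neq0 ?gt_eqF.
Qed.

Let exp_bound (x : R) k : 0 <= x <= 1 -> (1 - x) ^+ k <= expR (- (k%:R * x)).
Proof.
move=> /andP[x0 x1]; rewrite -mulrN expRM_natl lerXn2r ?nnegrE ?subr_ge0 ?expR_ge0//.
exact: expR_ge1Dx.
Qed.

(** The inverse of [1 - x] is [1 + x / (1 - x)], at most the exponential of [x / (1 - x)]. *)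
Let exp_bound_below (x : R) k : 0 <= x < 1 -> expR (- (k%:R * (x / (1 - x)))) <= (1 - x) ^+ k.
Proof.
move=> /andP[x0 x1]; have y0 : 0 < 1 - x by rewrite subr_gt0.
rewrite -mulrN expRM_natl lerXn2r ?nnegrE ?expR_ge0// ?(ltW y0)//.
rewrite expRN invf_ple ?posrE ?expR_gt0//.
apply: le_trans (expR_ge1Dx _).
by rewrite le_eqVlt; apply/orP; left; apply/eqP; field; rewrite gt_eqF.
Qed.

Lemma scaled_beta_weight_le n u : (2 * D <= n)%N -> scaled_beta_weight n u <= gamma_majorant u.
Proof.
move=> Dn; have n0 : 0 < n%:R :> R by rewrite ltr0n; lia.
rewrite /gamma_majorant; case: ifPn => [u0|]; last first.
  rewrite -leNgt => u0.
  by rewrite /scaled_beta_weight /beta_weight pmulr_lgt0 ?invr_gt0// ltNge u0 mulr0.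
have [un|nu] := lerP u n%:R; last first.
  rewrite /scaled_beta_weight /beta_weight [X in if X then _ else _](_ : _ = false).
    by rewrite mulr0 mulr_ge0 ?expR_ge0// divr_ge0 ?exprn_ge0 ?(ltW u0).
  by apply/negbTE; rewrite negb_and -!ltNge [1 < _]ltr_pdivlMr// mul1r nu orbT.
rewrite scaled_beta_weightE ?u0//.
have x01 : 0 <= u / n%:R <= 1 by rewrite divr_ge0 ?(ltW u0)//= ler_pdivrMr// mul1r.
have y01 : 0 <= 1 - u / n%:R by case/andP: x01 => _; rewrite subr_ge0.
apply: (@le_trans _ _ (1 * (u ^+ (D - 2) / (D.-1)`!%:R * (1 - u / n%:R) ^+ (n - D)))).
  rewrite ler_wpM2r//; first by rewrite mulr_ge0 ?exprn_ge0// divr_ge0 ?exprn_ge0 ?(ltW u0).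
  rewrite ler_pdivrMr ?exprn_gt0// mul1r -natrX ler_nat.
  by have /andP[] := ffact_ge n D.
rewrite mul1r ler_wpM2l ?divr_ge0 ?exprn_ge0 ?(ltW u0)//.
apply: le_trans (exp_bound _ x01) _; rewrite ler_expR lerN2.
have h : (2 * D)%:R <= n%:R :> R by rewrite ler_nat.
rewrite mulrA ler_pdivlMr// natrB; last lia.
by move: h; rewrite natrM; nra.
Qed.

Lemma scaled_beta_weight_cvg u : scaled_beta_weight n u @[n --> \oo] --> gamma_weight u.
Proof.
have [u0|u0] := leP u 0.
  rewrite /gamma_weight ltNge u0/=; apply: cvg_near_cst; near=> n.
  have n0 : 0 < n%:R :> R by rewrite ltr0n; near: n; exact: nbhs_infty_gt.
  by rewrite /scaled_beta_weight /beta_weight pmulr_lgt0 ?invr_gt0// ltNge u0 mulr0.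
rewrite /gamma_weight u0.
have inv0 : (n%:R : R)^-1 @[n --> \oo] --> (0 : R).
  rewrite gtr0_cvgV0; [exact: cvgr_idn|near=> n].
  by rewrite ltr0n; near: n; exact: nbhs_infty_gt.
pose c := u ^+ (D - 2) / (D.-1)`!%:R.
have c0 : 0 <= c by rewrite divr_ge0 ?exprn_ge0 ?(ltW u0).
have lim1 (a : R) : 1 - a * (n%:R : R)^-1 @[n --> \oo] --> (1 : R).
  rewrite -[X in _ --> X](subr0 1) -[X in _ --> _ - X](mulr0 a).
  apply: (@cvgB _ R^o); [exact: cvg_cst|apply: cvgM; [exact: cvg_cst|exact: inv0]].
have expN (f : nat -> R) l : f n @[n --> \oo] --> l -> expR (- f n) @[n --> \oo] --> expR (- l).
  move=> fl; have Nfl : - f n @[n --> \oo] --> - l by exact: cvgN.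
  exact: (cvg_comp _ _ Nfl (@continuous_expR R (- l))).
have r1 := lim1 D%:R; have s1 := lim1 u.
(* The falling factorial divided by [n ^ D] lies between [(1 - D / n) ^ D] and 1, and the exponent
   [(n - D) * (u / n)] equals [u * (1 - D / n)]. *)
apply: (@squeeze_cvgr _ _ _ _
  (fun n => (1 - D%:R * n%:R^-1) ^+ D * (c * expR (- (u * (1 - D%:R * n%:R^-1) / (1 - u * n%:R^-1)))))
  (fun n => c * expR (- (u * (1 - D%:R * n%:R^-1))))).
- near=> n.
  have Dn : (D <= n)%N by near: n; exact: nbhs_infty_ge.
  have un : u < n%:R by near: n; exact: nbhs_infty_gtr.
  have n0 : 0 < n%:R :> R by rewrite (lt_trans u0).
  have x01 : 0 <= u / n%:R < 1 by rewrite divr_ge0 ?(ltW u0)//= ltr_pdivrMr// mul1r.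
  have /andP[x0 x1] := x01.
  have x01' : 0 <= u / n%:R <= 1 by rewrite x0 ltW.
  have y0 : 0 < 1 - u / n%:R by rewrite subr_gt0.
  rewrite scaled_beta_weightE ?u0 ?(ltW un)// -/c.
  have E1 : (n - D)%:R * (u / n%:R) = u * (1 - D%:R / n%:R) :> R.
    by rewrite natrB//; field; rewrite gt_eqF.
  have /andP[f1 f2] := ffact_ge n D.
  apply/andP; split.
    apply: ler_pM.
    + by rewrite exprn_ge0// subr_ge0 ler_pdivrMr// mul1r ler_nat.
    + by rewrite mulr_ge0 ?expR_ge0.
    + rewrite ler_pdivlMr ?exprn_gt0// -exprMn mulrBl mul1r mulfVK ?gt_eqF//.
      by rewrite -natrB// -natrX ler_nat.
    + rewrite ler_wpM2l//; apply: le_trans (exp_bound_below (n - D) x01).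
      by rewrite -E1 (mulrA (n - D)%:R (u / n%:R)).
  apply: (@le_trans _ _ (1 * (c * (1 - u / n%:R) ^+ (n - D)))).
    rewrite ler_wpM2r//; first by rewrite mulr_ge0 ?exprn_ge0// ltW.
    by rewrite ler_pdivrMr ?exprn_gt0// mul1r -natrX ler_nat.
  by rewrite mul1r ler_wpM2l// -E1 exp_bound.
- rewrite (_ : c * expR (- u) = 1 ^+ D * (c * expR (- (u * 1 / 1)))); last first.
    by rewrite expr1n mul1r mulr1 divr1.
  apply: cvgM; first exact: (cvg_comp _ _ r1 (@exprn_continuous R D 1)).
  apply: cvgM; first exact: cvg_cst.
  apply: expN; apply: cvgM; first by apply: cvgM => //; exact: cvg_cst.
  by apply: cvgV => //; rewrite oner_neq0.
- rewrite -[X in _ --> c * expR (- X)]mulr1.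
  apply: cvgM; first exact: cvg_cst.
  by apply: expN; apply: cvgM => //; exact: cvg_cst.
Unshelve. all: by end_near. Qed.

End poissonization.

(** * Passing to the limit in the averages *)

Section poissonized_averages.
Context (R : realType) (D : nat).
Hypothesis D2 : (2 <= D)%N.
Local Notation leb := (@lebesgue_measure R).

Lemma scaled_beta_average (f : R -> \bar R) n : (0 < n)%N ->
  measurable_fun setT f -> (forall t, 0 <= f t)%E ->
  (n%:R^-1%:E * \int[leb]_v ((beta_weight D n v)%:E * f (- ln v)%R) =
   \int[leb]_u ((scaled_beta_weight D n u)%:E * f (ln n%:R - ln u)%R))%E.
Proof.
move=> n0 mf f0; have n0' : 0 < n%:R :> R by rewrite ltr0n.
have i0 : 0 < n%:R^-1 :> R by rewrite invr_gt0.
have mb j : measurable_fun setT (fun v : R => (beta_weight D j v)%:E).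
  by apply/measurable_EFinP; exact: measurable_beta_weight.
have mln : measurable_fun setT (fun v : R => - ln v).
  by apply: measurableT_comp => //; exact: measurable_ln.
rewrite -(ge0_integral_affine 0 i0); last 2 first.
- by apply: (emeasurable_funM (mb n)); exact: (measurableT_comp mf mln).
- by move=> v; rewrite mule_ge0// lee_fin beta_weight_ge0.
rewrite muleA -EFinM -ge0_integralZl_EFin//; last 2 first.
- by move=> v _; rewrite mule_ge0// lee_fin beta_weight_ge0.
- have mdil : measurable_fun setT (fun u : R => n%:R^-1 * u + 0).
    by apply: measurable_funD => //; exact: measurable_funM.
  apply: emeasurable_funM; first exact: (measurableT_comp (mb n) mdil).
  exact: (measurableT_comp (measurableT_comp mf mln) mdil).
apply: eq_integral => u _; rewrite addr0 (mulrC _ u) muleA -EFinM /scaled_beta_weight -exprVn expr2.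
case: (ltP 0 u) => u0.
  by congr (_ * f _)%E; rewrite ln_div ?posrE//; lra.
by rewrite /beta_weight pmulr_lgt0// ltNge u0 !mulr0 !mul0e.
Qed.

Variables (f p : R -> R) (B : R).
Hypotheses (mf : measurable_fun setT f) (mp : measurable_fun setT p).
Hypotheses (fB : forall t, 0 <= f t <= B) (pB : forall t, 0 <= p t <= B).
Hypothesis fp : forall e : R, 0 < e -> exists T : R, forall t, T <= t -> `|f t - p t| <= e.

Let msub (a : R) : measurable_fun setT (fun u : R => a - ln u).
Proof. by apply: measurable_funB => //; exact: measurable_ln. Qed.

Let integrable_product (w q : R -> R) (a : R) :
  measurable_fun setT w -> measurable_fun setT q ->
  (forall u, 0 <= w u <= gamma_majorant D u) -> (forall t, 0 <= q t <= B) ->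
  leb.-integrable setT (fun u => (w u * q (a - ln u))%:E).
Proof.
move=> mw mq wB qB; have B0 : 0 <= B by have /andP[+ +] := qB 0; exact: le_trans.
apply: (@le_integrable _ _ _ leb setT measurableT _ (fun u => (B%:E * (gamma_majorant D u)%:E)%E)).
- apply/measurable_EFinP; apply: measurable_funM => //.
  exact: (measurableT_comp mq (msub a)).
- move=> u _; rewrite /= lee_fin.
  have /andP[w0 w1] := wB u; have /andP[q0 q1] := qB (a - ln u).
  rewrite ger0_norm ?mulr_ge0// ger0_norm ?mulr_ge0 ?(le_trans w0 w1)//.
  by rewrite (mulrC B) ler_pM.
- exact: (integrableZl measurableT B (integrable_gamma_majorant R D)).

Qed.

Lemma integrable_gamma_profile a :
  leb.-integrable setT (fun u => (gamma_weight D u * p (a - ln u))%:E).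
Proof.
apply: integrable_product => //; first exact: measurable_gamma_weight.
by move=> u; rewrite gamma_weight_ge0 gamma_weight_le.
Qed.

Lemma integrable_scaled_beta n a : (2 * D <= n)%N ->
  leb.-integrable setT (fun u => (scaled_beta_weight D n u * f (a - ln u))%:E).
Proof.
move=> Dn; apply: integrable_product => //; first exact: measurable_scaled_beta_weight.
by move=> u; rewrite scaled_beta_weight_ge0 scaled_beta_weight_le.
Qed.

(** The index is shifted by [2 * D] so that the majorant holds for every term. *)
Let g (k : nat) (u : R) : R := let n := (k + 2 * D)%N in
  scaled_beta_weight D n u * f (ln n%:R - ln u) - gamma_weight D u * p (ln n%:R - ln u).

Let g_cvg u : g k u @[k --> \oo] --> 0.
Proof.
have B0 : 0 <= B by have /andP[+ +] := fB 0; exact: le_trans.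
have [u0|u0] := leP u 0.
  apply: cvg_near_cst; near=> n.
  rewrite /g /scaled_beta_weight /beta_weight /gamma_weight.
  rewrite (pmulr_lgt0 u) ?invr_gt0 ?ltr0n; last by lia.
  by rewrite ltNge u0/= mulr0 !mul0r subr0.
have bc : scaled_beta_weight D (k + 2 * D) u @[k --> \oo] --> gamma_weight D u.
  by have := @scaled_beta_weight_cvg R D D2 u; rewrite -(cvg_shiftn (2 * D)).
apply/cvgrPdist_le => e e0.
have e1 : 0 < e / 2 / (B + 1) by rewrite !divr_gt0// ltr_wpDl.
have e2 : 0 < e / 2 / (gamma_weight D u + 1) by rewrite !divr_gt0// ltr_wpDl// gamma_weight_ge0.
have [t0 Ht] := fp e2.
near=> k.
have kb : `|gamma_weight D u - scaled_beta_weight D (k + 2 * D) u| <= e / 2 / (B + 1).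
  by near: k; move/cvgrPdist_le : bc; apply.
have kt : t0 <= ln (k + 2 * D)%:R - ln u.
  have n0 : 0 < (k + 2 * D)%:R :> R by rewrite ltr0n; lia.
  rewrite lerBrDr -ler_expR lnK ?posrE//.
  apply: (@le_trans _ _ k%:R); last by rewrite ler_nat leq_addr.
  by near: k; exact: nbhs_infty_ger.
have := Ht _ kt; rewrite /g sub0r normrN.
set n := (k + 2 * D)%N; set x := ln n%:R - ln u; set b := scaled_beta_weight D n u.
set c := gamma_weight D u => h.
have c0 : 0 <= c by exact: gamma_weight_ge0.
have /andP[f0 f1] := fB x.
(* The convergence of the weights is paired with the bounded [f], and the closeness of [f] to [p]
   with the limit weight, which does not depend on [k]. *)
have -> : b * f x - c * p x = (b - c) * f x + c * (f x - p x) by ring.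
apply: le_trans (ler_normD _ _) _; rewrite !normrM (ger0_norm c0) (ger0_norm f0).
rewrite (_ : e = e / 2 + e / 2); last by lra.
apply: lerD.
  apply: (@le_trans _ _ (e / 2 / (B + 1) * (B + 1))); last by rewrite divfK// gt_eqF// ltr_wpDl.
  by apply: ler_pM => //; [rewrite distrC|lra].
apply: (@le_trans _ _ ((c + 1) * (e / 2 / (c + 1)))); last by rewrite mulrC divfK// gt_eqF// ltr_wpDl.
by apply: ler_pM => //; lra.
Unshelve. all: by end_near. Qed.

(** The profile [p] may oscillate, so neither average need converge; dominated convergence is
    applied to their difference. *)
Lemma poissonized_average :
  fine (\int[leb]_u (scaled_beta_weight D n u * f (ln n%:R - ln u))%:E) -
  fine (\int[leb]_u (gamma_weight D u * p (ln n%:R - ln u))%:E) @[n --> \oo] --> 0.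
Proof.
rewrite -(cvg_shiftn (2 * D)) /=.
have Dk k : (2 * D <= k + 2 * D)%N by exact: leq_addl.
have ib k := integrable_scaled_beta (ln (k + 2 * D)%:R) (Dk k).
have ig k := integrable_gamma_profile (ln (k + 2 * D)%:R).
have mg k : measurable_fun setT (EFin \o g k).
  apply/measurable_EFinP; apply: measurable_funB.
    by have /integrableP[/measurable_EFinP] := ib k.
  by have /integrableP[/measurable_EFinP] := ig k.
have [_ _] : [/\ leb.-integrable setT (cst 0%E : R -> \bar R),
    [sequence (\int[leb]_u `|(g k u)%:E - 0|)%E]_k @ \oo --> 0%E &
    [sequence (\int[leb]_u (g k u)%:E)%E]_k @ \oo --> (\int[leb]_(u in [set: R]) 0)%E].
  apply: (@dominated_convergence _ _ _ leb setT measurableT (fun k => EFin \o g k) (cst 0%E)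
    (fun u => (B%:E * (gamma_majorant D u)%:E)%E)) => //.
  - by apply: aeW => u _; apply: cvg_EFin; [exact: nearW|exact: g_cvg].
  - exact: (integrableZl measurableT B (integrable_gamma_majorant R D)).

  - apply: aeW => u k _; rewrite /= -EFinM lee_fin /g.
    have c0 := gamma_weight_ge0 D u; have c1 := gamma_weight_le D u.
    have b0 := scaled_beta_weight_ge0 D (k + 2 * D) u.
    have b1 := scaled_beta_weight_le D2 u (Dk k).
    set x := ln _ - ln u.
    have /andP[f0 f1] := fB x; have /andP[p0 p1] := pB x.
    have h1 := ler_pM b0 f0 b1 f1; have h2 := ler_pM c0 p0 c1 p1.
    have h3 := mulr_ge0 b0 f0; have h4 := mulr_ge0 c0 p0.
    by rewrite ler_norml mulrC; lra.
rewrite integral0 => /fine_cvg; apply: cvg_trans; apply: near_eq_cvg.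
apply: nearW => k /=; rewrite /g -fineB; last 2 first.
- exact: (integrable_fin_num measurableT (ib k)).
- exact: (integrable_fin_num measurableT (ig k)).
by rewrite -(integralB_EFin measurableT (ib k) (ig k)).
Qed.

End poissonized_averages.

(** * The limit density and the periodic profile *)

Section gamma_profiles.
Context (R : realType) (D : nat).
Hypothesis D2 : (2 <= D)%N.
Local Notation leb := (@lebesgue_measure R).

Lemma integral_scaled_beta_weight n : (D <= n)%N ->
  (\int[leb]_u (scaled_beta_weight D n u)%:E = ((D.-1)%:R^-1)%:E)%E.
Proof.
move=> Dn; have n0 : (0 < n)%N by rewrite (leq_trans _ Dn)// ltnW.
have := @scaled_beta_average R D (cst 1%E) n n0 (measurable_cst _) (fun=> lee01).
under eq_integral do rewrite mule1.
rewrite (integral_beta_weight R D2 Dn) -EFinM mulrA mulVf ?mul1r ?pnatr_eq0 ?gtn_eqF// => ->.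
by apply: eq_integral => u _; rewrite mule1.
Qed.

(** Obtained as the limit of the integrals of the scaled beta weights, constant for [D <= n], by
    taking [f] and [p] equal to 1 in [poissonized_average]. *)
Lemma integral_gamma_weight : (\int[leb]_u (gamma_weight D u)%:E = ((D.-1)%:R^-1)%:E)%E.
Proof.
have b1 (t : R) : 0 <= (fun=> 1 : R) t <= 1 by rewrite ler01 lexx.
have c1 (e : R) : 0 < e -> exists T : R, forall t, T <= t -> `|(fun=> 1 : R) t - (fun=> 1) t| <= e.
  by move=> e0; exists 0 => t _; rewrite subrr normr0 ltW.
have := poissonized_average D2 (measurable_cst (1 : R)) (measurable_cst (1 : R)) b1 b1 c1.
set G := fine (\int[leb]_u (gamma_weight D u)%:E).
have EG n : fine (\int[leb]_u (gamma_weight D u * cst 1 (ln n%:R - ln u))%:E) = G.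
  by congr fine; apply: eq_integral => u _; rewrite mulr1.
under eq_fun do rewrite EG.
move=> cG; have : (D.-1)%:R^-1 - G = 0.
  apply/esym/(cvg_unique _ cG) => //; apply: cvg_near_cst; near=> n.
  have Dn : (D <= n)%N by near: n; exact: nbhs_infty_ge.
  rewrite (_ : \int[leb]_u _ = (D.-1%:R^-1)%:E)%E// -(integral_scaled_beta_weight Dn).
  by apply: eq_integral => u _; rewrite mulr1.
move/eqP; rewrite subr_eq0 => /eqP ->; rewrite fineK//.
exact: (integrable_fin_num measurableT (integrable_gamma_weight R D)).
Unshelve. all: by end_near. Qed.

Lemma fractional_part_itv (z : R) : 0 <= fractional_part z < 1.
Proof.
rewrite /fractional_part subr_ge0 floor_le/= ltrBlDl.
by have := floorD1_gt z; rewrite intrD.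
Qed.

Lemma fractional_partD1 (z : R) : fractional_part (z + 1) = fractional_part z.
Proof. by rewrite /fractional_part floorDrz ?rpred1// floor1 intrD; ring. Qed.

Lemma measurable_fractional_part : measurable_fun setT (@fractional_part R).
Proof.
apply: measurable_funB => //; apply: nondecreasing_measurable => // x y xy.
by rewrite ler_int floor_ge_int (le_trans _ xy)// floor_le.
Qed.

Variable lambda : R.
Hypothesis lambda_gt0 : 0 < lambda.

Definition periodic_factor (t : R) : R := expR (- (lambda * fractional_part (t / lambda))).

Lemma measurable_periodic_factor : measurable_fun setT periodic_factor.
Proof.
apply: measurableT_comp => //; apply: measurableT_comp => //; apply: measurable_funM => //.
by apply: (measurableT_comp measurable_fractional_part); exact: measurable_funM.
Qed.

Lemma periodic_factor_itv t : expR (- lambda) <= periodic_factor t <= 1.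
Proof.
have /andP[f0 f1] := fractional_part_itv (t / lambda).
by rewrite /periodic_factor ler_expR expR_le1; apply/andP; split; move: lambda_gt0 => l0; nra.
Qed.

Definition profile_integral (x : R) : R :=
  fine (\int[leb]_u (gamma_weight D u * periodic_factor (x - ln u))%:E).

Let integrable_profile x :
  leb.-integrable setT (fun u => (gamma_weight D u * periodic_factor (x - ln u))%:E).
Proof.
have pB t : 0 <= periodic_factor t <= 1.
  by have /andP[p0 ->] := periodic_factor_itv t; rewrite (le_trans _ p0)// expR_ge0.
exact: (integrable_gamma_profile D measurable_periodic_factor pB x).
Qed.

Lemma profile_integral_fineK x :
  (\int[leb]_u (gamma_weight D u * periodic_factor (x - ln u))%:E = (profile_integral x)%:E)%E.
Proof.
by rewrite /profile_integral fineK//; exact: (integrable_fin_num measurableT (integrable_profile _)).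
Qed.

Lemma profile_integralE x :
  (\int[leb]_(y in `]0%R, +oo[)
    (expR (- (lambda * fractional_part (x - ln y / lambda))) *
     (y ^+ (D - 2) / ((D.-1)`!)%:R) * expR (- y))%:E = (profile_integral (lambda * x))%:E)%E.
Proof.
rewrite -profile_integral_fineK integral_mkcond; apply: eq_integral => u _.
rewrite patchE mem_setE in_itv/= andbT /gamma_weight; case: ifP => _; last by rewrite mul0r.
rewrite /periodic_factor mulrBl (mulrC lambda x) mulfK ?gt_eqF//.
by congr (_%:E); ring.
Qed.

(** Uniformity in [x] is the point: it allows an additive error to be divided by the profile. *)
Lemma profile_integral_ge x : expR (- lambda) / (D.-1)%:R <= profile_integral x.
Proof.
rewrite -lee_fin -profile_integral_fineK EFinM -integral_gamma_weight -ge0_integralZl_EFin//; last 2 first.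
- by move=> u _; rewrite lee_fin gamma_weight_ge0.
- by apply/measurable_EFinP; exact: measurable_gamma_weight.
apply: ge0_le_integral => //.
- by move=> u _; rewrite mule_ge0// lee_fin ?expR_ge0 ?gamma_weight_ge0.
- by apply: emeasurable_funM => //; apply/measurable_EFinP; exact: measurable_gamma_weight.
- by have /integrableP[] := integrable_profile x.
move=> u _; rewrite -EFinM lee_fin mulrC ler_wpM2l ?gamma_weight_ge0//.
by have /andP[] := periodic_factor_itv (x - ln u).
Qed.

End gamma_profiles.

(** * From the renewal limits to the cost *)

Section cost_asymptotics.
Context d (T : measurableType d) (R : realType) (P : probability T R).
Context (X : splitting_data P) (delta : R) (D : nat).
Hypothesis hA : bounded_weights X delta.
Hypothesis D2 : (2 <= D)%N.
Hypothesis hlog : (\int[splitting_measure X]_(y in `[0%R, 1%R]) (`|ln y| / y)%:E < +oo)%E.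
Context d' (T' : measurableType d') (Q : probability T' R).
Variable S : splitting_algorithm X D Q.
Local Notation leb := (@lebesgue_measure R).
Local Notation W := (splitting_measure X).

Let U := renewal_fun W (log_step delta).

Let mstep := measurable_log_step delta.
Let c_gt0 := Nln_delta_gt0 hA.
Let step_ge := @log_step_ge R delta.

Definition mean_log : R := fine (mean_abs_log X).

Lemma mean_abs_logE : mean_abs_log X = mean_log%:E.
Proof.
rewrite /mean_log fineK// ge0_fin_numE ?mean_abs_log_lty//.
by apply: integral_ge0 => y _; rewrite lee_fin.
Qed.

Lemma log_step_meanE : (\int[W]_y (log_step delta y)%:E = mean_log%:E)%E.
Proof. by rewrite (log_step_mean hA) mean_abs_logE. Qed.

Lemma mean_log_gt0 : 0 < mean_log.
Proof. exact: (mean_step_gt0 mstep c_gt0 step_ge log_step_meanE). Qed.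

Lemma mean_degree_ge2 : (2%:E <= mean_degree X)%E.
Proof.
rewrite /mean_degree unlock -[leLHS](integral_cst_probability P).
apply: ge0_le_integral => //.
- apply/measurable_EFinP; apply: (measurableT_comp (f := fun k : nat => (k%:R : R)%R)) => //.
- by move=> w _; rewrite lee_fin ler_nat degree_ge2.
Qed.

Lemma ae_log_step : {ae W, forall y : R, 0 < y /\ log_step delta y = - ln y}.
Proof.
apply: filterS (splitting_measure_support hA) => y yd; split; first by case/andP: yd.
exact: (log_stepE hA).
Qed.

(** Logarithms can be taken since almost every [y] is positive. The converse direction transfers the
    maximality of the span, and non-arithmeticity, to the steps. *)
Lemma exponentially_arithmetic_withP (lambda : R) : 0 < lambda ->
  exponentially_arithmetic_with W lambda <->
  {ae W, forall y, exists n : nat, (0 < n)%N /\ log_step delta y = n%:R * lambda}.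
Proof.
move=> l0; pose A := [set expR (- (n%:R * lambda)) | n in [set n : nat | (1 <= n)%N]].
have mA : measurable A.
  apply: countable_measurable; first by move=> y; exact: measurable_set1.
  exact: (card_le_trans (card_image_le _ _) (countableP _)).
split=> [[_ WA]|H].
  have AE : {ae W, forall y, A y}.
    exists (~` A); split => //; first exact: measurableC.
    by rewrite probability_setC// WA subee.
  apply: filterS2 AE ae_log_step => y [n n0 <-] [_ ->].
  by exists n; split => //; rewrite expRK opprK.
split=> //.
have AE : {ae W, forall y, A y}.
  apply: filterS2 H ae_log_step => y [n [n0 nE]] [y0 yE].
  by exists n => //; rewrite -nE yE opprK lnK.
have : W (~` A) = 0%E by apply: measure_negligible => //; exact: measurableC.
rewrite probability_setC// -(fineK (fin_num_measure W _ mA)) -EFinB => -[/eqP].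
by rewrite subr_eq0 => /eqP <-.
Qed.

Variable m : R.
Hypothesis mE : mean_degree X = m%:E.

Lemma m_gt0 : 0 < m.
Proof. by have := mean_degree_ge2; rewrite mE lee_fin; lra. Qed.

Let U_fin t : U t = (fine (U t))%:E.
Proof.
rewrite fineK// ge0_fin_numE ?renewal_fun_ge0//.
by rewrite (le_lt_trans (renewal_fun_le W mstep c_gt0 step_ge t))// ltry.
Qed.

Let average (n : nat) : R :=
  fine (\int[leb]_u (scaled_beta_weight D n u * fine (U (ln n%:R - ln u)))%:E).

Let mU : measurable_fun setT U := measurable_renewal_fun W mstep.

Let mfU : measurable_fun setT (fun t => fine (U t)).
Proof. exact: (measurableT_comp (fine_measurable measurableT) mU). Qed.

Let U_itv (B : R) : renewal_bound (- ln delta) <= B -> forall t, 0 <= fine (U t) <= B.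
Proof.
move=> hB t; rewrite fine_ge0 ?renewal_fun_ge0//= -lee_fin -U_fin.
exact: le_trans (renewal_fun_le W mstep c_gt0 step_ge t) _.
Qed.

Lemma expected_cost_average n : (2 * D <= n)%N ->
  (expected_cost S n / n%:R%:E = (n%:R^-1 + m * average n)%:E)%E.
Proof.
move=> Dn; have n0 : (0 < n)%N by lia.
rewrite (expected_cost_renewal hA D2 S n mE) inver pnatr_eq0 gtn_eqF//.
rewrite ge0_muleDl ?mul1e//; last first.
  apply: mule_ge0; first by rewrite lee_fin ltW// m_gt0.
  apply: integral_ge0 => v _.
  by rewrite mule_ge0 ?renewal_fun_ge0// lee_fin beta_weight_ge0.
rewrite EFinD EFinM -muleA; congr (_ + _ * _)%E.
rewrite muleC (scaled_beta_average D n0 mU); last by move=> t; exact: renewal_fun_ge0.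
rewrite /average fineK.
  by apply: eq_integral => u _; rewrite [RHS]EFinM -U_fin.
exact: (integrable_fin_num measurableT
  (integrable_scaled_beta D2 mfU (U_itv (lexx _)) (ln n%:R) Dn)).
Qed.

(** The root contributes [n%:R^-1], which vanishes; the rest is [m] times the average of [U],
    compared with that of its asymptotic profile [p]. *)
Lemma expected_cost_asymptotics (p : R -> R) (B : R) :
  measurable_fun setT p -> (forall t, 0 <= p t <= B) ->
  (forall e : R, 0 < e -> exists T : R, forall t, T <= t -> `|fine (U t) - p t| <= e) ->
  fine (expected_cost S n / n%:R%:E)%E -
    m * fine (\int[leb]_u (gamma_weight D u * p (ln n%:R - ln u))%:E) @[n --> \oo] --> 0.
Proof.
move=> mp pB Up; pose B' := Num.max B (renewal_bound (- ln delta)).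
have pB' t : 0 <= p t <= B' by have /andP[-> pt] := pB t; rewrite le_max pt.
have UB' : forall t, 0 <= fine (U t) <= B' by apply: U_itv; rewrite le_max lexx orbT.
have av := poissonized_average D2 mfU mp UB' pB' Up.
have inv0 : (n%:R : R)^-1 @[n --> \oo] --> (0 : R).
  rewrite gtr0_cvgV0; [exact: cvgr_idn|near=> n].
  by rewrite ltr0n; near: n; exact: nbhs_infty_gt.
have lim0 : n%:R^-1 + m * (average n -
    fine (\int[leb]_u (gamma_weight D u * p (ln n%:R - ln u))%:E)) @[n --> \oo] --> 0.
  rewrite -[X in _ --> X](addr0 0) -[X in _ --> _ + X](mulr0 m).
  by apply: (@cvgD _ R^o) => //; apply: cvgM => //; exact: cvg_cst.
apply: cvg_trans lim0; apply: near_eq_cvg; near=> n.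
rewrite expected_cost_average; last by near: n; exact: nbhs_infty_ge.
by rewrite /=; ring.
Unshelve. all: by end_near. Qed.

Lemma nonarithmetic_cost : ~ exponentially_arithmetic W ->
  (expected_cost S n / n%:R%:E @[n --> \oo] --> limit_constant X D)%E.
Proof.
move=> nar.
have nonarith (lambda : R) : 0 < lambda ->
    ~ {ae W, forall y, exists n : nat, (0 < n)%N /\ log_step delta y = n%:R * lambda}.
  by move=> l0 /(exponentially_arithmetic_withP l0) h; apply: nar; exists lambda.
have Up := nonarithmetic_renewal mstep c_gt0 step_ge log_step_meanE nonarith.
have i0 : 0 < mean_log^-1 by rewrite invr_gt0 mean_log_gt0.
have pB (t : R) : 0 <= (fun=> mean_log^-1) t <= mean_log^-1 by rewrite lexx ltW.
have := expected_cost_asymptotics (measurable_cst _) pB Up.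
set L := m * (mean_log^-1 / (D.-1)%:R).
have D1 : (D.-1)%:R != 0 :> R by rewrite pnatr_eq0; case: D D2 => [|[]].
have E n : m * fine (\int[leb]_u (gamma_weight D u * cst mean_log^-1 (ln n%:R - ln u))%:E) = L.
  under eq_integral do rewrite mulrC EFinM.
  rewrite ge0_integralZl_EFin//.
  - by rewrite (integral_gamma_weight R D2).
  - by move=> u _; rewrite lee_fin gamma_weight_ge0.
  - by apply/measurable_EFinP; exact: measurable_gamma_weight.
  - exact: ltW.
under eq_fun do rewrite E.
move=> /cvg_sub0 h; have {}h := h _ (cvg_cst L).
have -> : limit_constant X D = L%:E.
  rewrite /limit_constant mE mean_abs_logE -EFinM inver mulf_eq0 (negbTE D1)/=.
  rewrite gt_eqF ?mean_log_gt0//= -EFinM; congr (_%:E).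
  by rewrite /L; field; rewrite D1 gt_eqF ?mean_log_gt0.
apply/fine_cvgP; split; last exact: h.
by near=> n; rewrite expected_cost_average//; near: n; exact: nbhs_infty_ge.
Unshelve. all: by end_near. Qed.

Lemma arithmetic_cost (lambda : R) : exponential_span W lambda ->
  ((expected_cost S n / n%:R%:E) / periodic_profile X D lambda (ln n%:R / lambda)
    @[n --> \oo] --> 1)%E.
Proof.
move=> [lar lmax]; have [l0 _] := lar.
have lat := (exponentially_arithmetic_withP l0).1 lar.
have max_lat (lambda' : R) : 0 < lambda' ->
    {ae W, forall y, exists n : nat, (0 < n)%N /\ log_step delta y = n%:R * lambda'} ->
    lambda' <= lambda.
  by move=> l0' /(exponentially_arithmetic_withP l0').2; exact: lmax.
have Up := arithmetic_renewal mstep c_gt0 step_ge log_step_meanE l0 lat max_lat.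
have e1 : 0 < 1 - expR (- lambda) by rewrite subr_gt0 expR_lt1 oppr_lt0.
(* The limit of [U] along the lattice; the inverse of [1 - expR (- lambda)] is the sum of the kernel
   over the lattice. *)
pose C := lambda / (mean_log * (1 - expR (- lambda))).
have C0 : 0 < C by rewrite divr_gt0// mulr_gt0// mean_log_gt0.
have pB (t : R) : 0 <= C * periodic_factor lambda t <= C.
  have /andP[p0 p1] := periodic_factor_itv l0 t.
  rewrite mulr_ge0 ?(ltW C0) ?(le_trans _ p0) ?expR_ge0//=.
  by rewrite ler_piMr// ltW.
have mp : measurable_fun setT (fun t : R => C * periodic_factor lambda t).
  by apply: measurable_funM => //; exact: measurable_periodic_factor.
have := expected_cost_asymptotics mp pB Up.
pose I n := profile_integral D lambda (ln n%:R).
have E n : m * fine (\int[leb]_u (gamma_weight D u *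
    (C * periodic_factor lambda (ln n%:R - ln u)))%:E) = m * C * I n.
  rewrite -mulrA; congr (_ * _).
  rewrite (_ : \int[leb]_u _ = C%:E * (I n)%:E)%E// /I -profile_integral_fineK//.
  rewrite -ge0_integralZl_EFin ?(ltW C0)//.
  - by apply: eq_integral => u _; rewrite -EFinM mulrCA.
  - move=> u _; have /andP[p0 _] := periodic_factor_itv l0 (ln n%:R - ln u).
    by rewrite lee_fin mulr_ge0 ?gamma_weight_ge0// (le_trans _ p0)// expR_ge0.
  - apply/measurable_EFinP; apply: measurable_funM; first exact: measurable_gamma_weight.
    apply: (measurableT_comp (measurable_periodic_factor lambda)).
    by apply: measurable_funB => //; exact: measurable_ln.
under eq_fun do rewrite E.
move=> h.
have FE n : periodic_profile X D lambda (ln n%:R / lambda) = (m * C * I n)%:E.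
  rewrite /periodic_profile (profile_integralE D l0) (mulrC lambda (ln n%:R / lambda)) divfK ?gt_eqF// mE mean_abs_logE.
  rewrite inver gt_eqF ?mean_log_gt0//= -!EFinM; congr (_%:E); rewrite /C /I; field.
  by rewrite !gt_eqF ?mean_log_gt0.
(* Since [c] bounds the profile from below, an additive error [e * c] is a relative error [e]. *)
pose c := m * C * (expR (- lambda) / (D.-1)%:R).
have D1 : 0 < (D.-1)%:R :> R by rewrite ltr0n; case: D D2 => [|[]].
have c0 : 0 < c by apply: mulr_gt0; [rewrite mulr_gt0 ?m_gt0|rewrite divr_gt0 ?expR_gt0].
have Fc n : c <= m * C * I n.
  by rewrite ler_wpM2l ?profile_integral_ge// mulr_ge0 ?(ltW m_gt0) ?(ltW C0).
apply/fine_cvgP; split.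
  near=> n; rewrite expected_cost_average; last by near: n; exact: nbhs_infty_ge.
  by rewrite FE inver gt_eqF ?(lt_le_trans c0).
apply/cvgrPdist_le => e e0.
have ec : 0 < e * c by rewrite mulr_gt0.
move/cvgrPdist_le : h => /(_ _ ec) h.
near=> n.
have Dn : (2 * D <= n)%N by near: n; exact: nbhs_infty_ge.
have : `|0 - (fine (expected_cost S n / n%:R%:E)%E - m * C * I n)| <= e * c by near: n.
rewrite /= expected_cost_average// FE inver gt_eqF ?(lt_le_trans c0)//=.
set x := n%:R^-1 + m * average n; set y := m * C * I n => h1.
have cy : c <= y by exact: Fc.
have y0 : 0 < y by exact: lt_le_trans cy.
rewrite (_ : 1 - x / y = (0 - (x - y)) / y); last by field; rewrite gt_eqF.
rewrite normrM normfV (gtr0_norm y0) ler_pdivrMr//.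
by apply: le_trans h1 _; rewrite ler_wpM2l// ltW.
Unshelve. all: by end_near. Qed.

Lemma periodic_profileD1 (lambda x : R) :
  periodic_profile X D lambda (x + 1) = periodic_profile X D lambda x.
Proof.
rewrite /periodic_profile; congr (_ * _)%E; apply: eq_integral => y _.
by rewrite addrAC fractional_partD1.
Qed.

Hypothesis mean_infinite : mean_degree X = +oo%E.

(** The children of the root already have infinite expected number. *)
Lemma infinite_mean_cost n : (D <= n)%N -> (expected_cost S n / n%:R%:E = +oo)%E.
Proof.
move=> Dn; have n0 : (0 < n)%N by rewrite (leq_trans _ Dn)// ltnW.
have -> : expected_cost S n = +oo%E.
  apply/eqP; rewrite -leye_eq -mean_infinite -(expected_level1 X Dn) expected_cost_levels.
  rewrite (nneseriesD1 (n := 1%N))//; last by move=> k _; exact: expected_level_ge0.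
  by rewrite leeDl// nneseries_ge0// => k _ _; exact: expected_level_ge0.
by rewrite inver pnatr_eq0 gtn_eqF// gt0_mulye// lte_fin invr_gt0 ltr0n.
Qed.

Lemma infinite_mean_limit_constant : limit_constant X D = +oo%E.
Proof.
have D1 : 0 < (D.-1)%:R :> R by rewrite ltr0n; case: D D2 => [|[]].
have l1 := mulr_gt0 D1 mean_log_gt0.
rewrite /limit_constant mean_infinite mean_abs_logE -EFinM inver gt_eqF//.
by rewrite gt0_mulye// lte_fin invr_gt0.
Qed.

Lemma infinite_mean_profile (lambda x : R) : 0 < lambda ->
  periodic_profile X D lambda x = +oo%E.
Proof.
move=> l0; have D1 : 0 < (D.-1)%:R :> R by rewrite ltr0n; case: D D2 => [|[]].
rewrite /periodic_profile (profile_integralE D l0) mean_infinite mean_abs_logE.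
rewrite inver gt_eqF ?mean_log_gt0// gt0_mulye ?lte_fin ?invr_gt0 ?mean_log_gt0//.
rewrite gt0_mulye ?lte_fin ?divr_gt0 ?subr_gt0 ?expR_lt1 ?oppr_lt0//.
rewrite gt0_mulye// lte_fin (lt_le_trans _ (profile_integral_ge D2 l0 _))//.
by rewrite divr_gt0 ?expR_gt0.
Qed.

End cost_asymptotics.

Local Open Scope ereal_scope.

Theorem theorem3 (R : realType) (D : nat) (hD : (2 <= D)%N)
    (d : measure_display) (T : measurableType d) (P : probability T R)
    (X : splitting_data P) (delta : R) (hA : bounded_weights X delta)
    (d' : measure_display) (T' : measurableType d') (Q : probability T' R)
    (S : splitting_algorithm X D Q)
    (hlog : \int[splitting_measure X]_(y in `[0%R, 1%R])
              (`|ln y| / y)%:E < +oo) :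
  (* (i) *)
  (~ exponentially_arithmetic (splitting_measure X) ->
     (mean_degree X < +oo ->
        expected_cost S n / n%:R%:E @[n --> \oo] --> limit_constant X D) /\
     (mean_degree X = +oo ->
        limit_constant X D = +oo /\
        forall n, (D <= n)%N -> expected_cost S n / n%:R%:E = +oo)) /\
  (* (ii) *)
  (forall lambda : R, exponential_span (splitting_measure X) lambda ->
     let F := periodic_profile X D lambda in
     (forall x, F (x + 1)%R = F x) /\
     (mean_degree X < +oo ->
        (expected_cost S n / n%:R%:E) / F (ln n%:R / lambda)%R
          @[n --> \oo] --> 1) /\
     (mean_degree X = +oo ->
        forall n, (D <= n)%N ->
          expected_cost S n / n%:R%:E = +oo /\
          F (ln n%:R / lambda)%R = +oo)).
Proof.
split=> [nar|lambda span F].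
  (* With an infinite mean degree both sides are evaluated directly; otherwise the mean is a real
     [m], as the additive comparison requires. *)
  split=> [mfin|minf]; last first.
    split; first exact: infinite_mean_limit_constant hA hD hlog minf.
    by move=> n; exact: infinite_mean_cost.
  have [m mE] : exists m : R, mean_degree X = m%:E.
    exists (fine (mean_degree X)); rewrite fineK// ge0_fin_numE//.
    exact: le_trans (mean_degree_ge2 X).
  exact: (nonarithmetic_cost hA hD hlog S mE nar).
have [[l0 _] _] := span.
split; first by move=> x; exact: periodic_profileD1.
split=> [mfin|minf n Dn]; last first.
  split; first exact: infinite_mean_cost.
  exact: (infinite_mean_profile hA hD hlog minf _ l0).
have [m mE] : exists m : R, mean_degree X = m%:E.
  exists (fine (mean_degree X)); rewrite fineK// ge0_fin_numE//.
  exact: le_trans (mean_degree_ge2 X).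
exact: (arithmetic_cost hA hD hlog S mE span).
Qed.
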